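(* Let $V$ be a grading-restricted vertex superalgebra, $g$ an automorphism of $V$ and $W$ a lower-bounded generalized $g$-twisted $V$-module with twisted vertex operator map $Y_W^g$. For $u, v\in V$, $$Y_{W}^{g}(u, x_1)Y_{W}^{g}(v, x_2)- (-1)^{|u||v|} Y_{W}^{g}(v, x_2)Y_{W}^{g}(u, x_1) = \mathrm{Res}_{x_{0}}\, x_1^{-1}\delta\left(\frac{x_2+x_0}{x_1}\right)Y_{W}^{g}\left(Y_{V}\left(\left(\frac{x_2+x_0}{x_1}\right)^{\mathcal{L}_{g}}u, x_0\right)v, x_2\right).$$
   Context: Conventions: $x,x_0,x_1,x_2$ are formal variables; logarithms of formal variables are also formal variables; $\delta(x)=\sum_{n\in\mathbb Z}x^n$; $\mathrm{Res}_{x_0}$ is the coefficient of $x_0^{-1}$. Expressions $(x_2+x_0)^n$ ($n\in\mathbb C$) and $\log(x_2+x_0)=\log x_2+\log(1+x_0/x_2)$ are expanded as power series in the second variable $x_0$. For $z\in\mathbb C^\times$ and $p\in\mathbb Z$, $l_p(z)=\log|z|+i\arg z+2p\pi i$ with $0\le\arg z<2\pi$. $W\{x\}$ denotes formal series $\sum_{n\in\mathbb C}w_nx^n$, $w_n\in W$. Elements of $V$, $W$ are taken of pure parity, so $|\cdot|$ is defined. A grading-restricted vertex superalgebra is a $\frac{\mathbb Z}{2}$-graded complex vector space $V=\coprod_{n\in\frac{\mathbb Z}{2}}V_{(n)}$ with a linear map $Y_V:V\otimes V\to V[[x,x^{-1}]]$ and a vacuum $\mathbf 1\in V_{(0)}$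 such that: (i) $\dim V_{(n)}<\infty$ and $V_{(n)}=0$ for $n$ sufficiently negative; with $L_V(0)v=nv$ for $v\in V_{(n)}$, $[L_V(0),Y_V(v,x)]=x\frac{d}{dx}Y_V(v,x)+Y_V(L_V(0)v,x)$; (ii) $Y_V(\mathbf 1,x)=1_V$ and $\lim_{x\to0}Y_V(u,x)\mathbf 1=u$; (iii) with $L_V(-1)v=\lim_{x\to0}\frac{d}{dx}Y_V(v,x)\mathbf 1$, $\frac{d}{dx}Y_V(v,x)=Y_V(L_V(-1)v,x)=[L_V(-1),Y_V(v,x)]$; (iv) duality: with $|u|=0$ for $u\in\coprod_{n\in\mathbb Z}V_{(n)}$ and $|u|=1$ for $u\in\coprod_{n\in\mathbb Z+\frac12}V_{(n)}$, for $v\in V$, $v'\in V'$ (graded dual) the series $\langle v',Y_V(u_1,z_1)Y_V(u_2,z_2)v\rangle$, $(-1)^{|u_1||u_2|}\langle v',Y_V(u_2,z_2)Y_V(u_1,z_1)v\rangle$, $\langle v',Y_V(Y_V(u_1,z_1-z_2)u_2,z_2)v\rangle$ converge absolutely in $|z_1|>|z_2|>0$, $|z_2|>|z_1|>0$, $|z_2|>|z_1-z_2|>0$, respectively, to a common rational function with only possible poles at $z_1=0,z_2=0,z_1=z_2$. An automorphism $g$ of $V$ is a weight-preserving invertible linear map with $gY_V(u,x)v=Y_V(gu,x)gv$. A generalized $g$-twisted $V$-module is a $\mathbb C\times\mathbb Z_2\times\mathbb C/\mathbb Z$-graded space $W=\coprod_{n\in\mathbb C,s\in\mathbb Z_2,\alpha\in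 P_W}W_{[n]}^{s;[\alpha]}$ (weight, fermion number, $g$-weight; $P_W\subset\{\alpha:0\le\Re(\alpha)<1\}$), $|w|=s$ for $w$ of fermion number $s$, with operators $L_W(0),L_W(-1)$, an action of $g$, and a linear map $Y_W^g:V\otimes W\to W\{x\}[\log x]$ such that, writing $(Y_W^g)^p(v,z)$ for the result of substituting $x^n=e^{nl_p(z)}$, $\log x=l_p(z)$: (1) $(Y_W^g)^{p+1}(gv,z)w=(Y_W^g)^p(v,z)w$; (2) $Y_W^g(\mathbf 1,x)w=w$; (3) duality: for $u,v\in V$, $w\in W$, $w'\in W'$ (graded dual) there is $f(z_1,z_2)=\sum_{i,j,k,l=0}^Na_{ijkl}z_1^{m_i}z_2^{n_j}(\log z_1)^k(\log z_2)^l(z_1-z_2)^{-t}$ ($m_i,n_j\in\mathbb C$, $t\in\mathbb Z_+$) such that for all $p\in\mathbb Z$ the series $\langle w',(Y_W^g)^p(u,z_1)(Y_W^g)^p(v,z_2)w\rangle$, $(-1)^{|u||v|}\langle w',(Y_W^g)^p(v,z_2)(Y_W^g)^p(u,z_1)w\rangle$, $\langle w',(Y_W^g)^p(Y_V(u,z_1-z_2)v,z_2)w\rangle$ converge absolutely in $|z_1|>|z_2|>0$, $|z_2|>|z_1|>0$, $|z_2|>|z_1-z_2|>0$, and their sums equal the branch $f^{p,p}$ (obtained with $z_i^{m}=e^{ml_p(z_i)}$, $\log z_i=l_p(z_i)$) in $|z_1|>|z_2|>0$, in $|z_2|>|z_1|>0$, and in $|z_2|>|z_1-z_2|>0$, $|\arg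 z_1-\arg z_2|<\frac\pi2$, respectively; (4) $L_W(0)-n$ is nilpotent on each element of $W_{[n]}$; $[L_W(0),Y_W^g(v,x)]=x\frac d{dx}Y_W^g(v,x)+Y_W^g(L_V(0)v,x)$; $g-e^{2\pi i\alpha}$ is nilpotent on each element of $W^{[\alpha]}$; $gY_W^g(u,x)w=Y_W^g(gu,x)gw$; $|Y_W^g(u,x)w|=|u|+|w|$; (5) $\frac d{dx}Y_W^g(v,x)=[L_W(-1),Y_W^g(v,x)]$ (then also $=Y_W^g(L_V(-1)v,x)$). Here $W_{[n]}=\coprod_{s,\alpha}W_{[n]}^{s;[\alpha]}$ and $W^{[\alpha]}=\coprod_{n,s}W_{[n]}^{s;[\alpha]}$. It is lower-bounded if for some $B\in\mathbb R$, $W_{[n]}=0$ whenever $\Re(n)<B$. $V^{[\alpha]}$ is the generalized eigenspace of $g$ on $V$ with eigenvalue $e^{2\pi i\alpha}$, $0\le\Re(\alpha)<1$. On $V$, $\mathcal S_g$ acts on $V^{[\alpha]}$ as multiplication by $\alpha$, $\mathcal N_g=\frac1{2\pi i}\log(e^{-2\pi i\mathcal S_g}g)$ is nilpotent on each $V_{(n)}$, and $\mathcal L_g=\mathcal S_g+\mathcal N_g$, so $g=e^{2\pi i\mathcal L_g}$. For $u\in V^{[\alpha]}$, $\left(\frac{x_2+x_0}{x_1}\right)^{\mathcal L_g}u=(x_2+x_0)^{\alpha}x_1^{-\alpha}e^{(\log(x_2+x_0)-\log x_1)\mathcal N_g}u$, extended linearly in $u$. *)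

(* Defs.v *)
From HB Require Import structures.
From mathcomp Require Import all_boot all_order all_algebra finmap.
From mathcomp Require Import complex.
From mathcomp Require Import all_classical all_reals all_analysis.

Set Implicit Arguments.
Unset Strict Implicit.
Unset Printing Implicit Defensive.

Import Order.TTheory GRing.Theory Num.Theory.

Local Open Scope classical_set_scope.
Local Open Scope ring_scope.

Section ComplexAnalysis.
Variable R : realType.
Local Notation C := R[i].
Implicit Types z s : C.

Definition cexp z : C :=
  Complex (expR (complex.Re z) * cos (complex.Im z))
          (expR (complex.Re z) * sin (complex.Im z)).

Definition twopii : C := Complex 0 (2 * pi).

Definition cmod z : R := complex.Re `|z|.

(* The argument in [0, 2 pi[, for z != 0; acos takes its values in [0, pi]. *)
Definition arg z : R :=
  let a := acos (complex.Re z / cmod z) in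
  if 0 <= complex.Im z then a else 2 * pi - a.

Definition lp (p : int) z : C :=
  Complex (ln (cmod z)) (arg z + 2 * p%:~R * pi).

Definition abs_conv (I : choiceType) (f : I -> C) : Prop :=
  summable [set: I] (fun i => (cmod (f i))%:E).

Definition has_sum (I : choiceType) (f : I -> C) s : Prop :=
  forall e : R, 0 < e -> exists A : {fset I}, forall B : {fset I},
    (A `<=` B)%fset -> cmod (\sum_(i <- B) f i - s) < e.

Definition binC (b : C) (n : nat) : C :=
  (\prod_(j < n) (b - j%:R)) / n`!%:R.

(* Representatives of C/Z. *)
Definition in_strip z : bool := 0 <= complex.Re z < 1.

End ComplexAnalysis.

(* A decomposition V = \coprod_(i : I) V_i, given by its projections;
   V_i is the set of v with [gproj i v = v]. *)
Record grading (K : nzRingType) (V : lmodType K) (I : choiceType) := Grading {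
  gproj : I -> {linear V -> V};
  gproj_proj : forall i j v,
    gproj i (gproj j v) = if i == j then gproj j v else 0;
  gproj_fin : forall v, finite_set [set i | gproj i v != 0];
  gproj_sum : forall v, \sum_(i \in [set: I]) gproj i v = v
}.

Section Grading.
Variables (K : nzRingType) (V : lmodType K) (I : choiceType).
Variable G : grading V I.

(* The subspace \coprod_(i in A) V_i. *)
Definition gr_sub (A : set I) : set V :=
  [set v | forall i, ~ A i -> gproj G i v = 0].

(* The graded dual \coprod_i (V_i)^*. *)
Definition graded_dual : set {scalar V} :=
  [set phi | finite_set [set i | exists v, phi (gproj G i v) != 0]].

End Grading.

(* The (1/2)Z-grading is indexed by int, the component of index k being
   V_(k/2).  [vY n u v] is the coefficient of x^n in Y_V(u, x) v. *)
Record vsa_data (R : realType) := VsaData {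
  vsort :> lmodType R[i];
  vgr : grading vsort int;
  vY : int -> vsort -> vsort -> vsort;
  vac : vsort
}.

Section VertexSuperalgebra.
Variables (R : realType) (V : vsa_data R).
Local Notation C := R[i].

Definition half (k : int) : C := k%:~R / 2.

Definition vL0 (v : V) : V := \sum_(k \in [set: int]) half k *: gproj (vgr V) k v.

(* lim_(x -> 0) d/dx Y_V(v, x) 1; the absence of negative powers of x is
   part of the creation property [vsa_creation_reg]. *)
Definition vLm1 (v : V) : V := vY 1 v (vac V).

Definition vparity (b : bool) : set V :=
  gr_sub (vgr V) [set k : int | odd `|k|%N = b].

Record is_vsa : Prop := IsVsa {
  vsa_linl : forall n v, linear (fun u => vY n u v : V);
  vsa_linr : forall n u, linear (vY n u : V -> V);
  vsa_findim : forall k : int, exists (d : nat) (b : 'I_d -> V),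
    forall v : V, gproj (vgr V) k v = v ->
    exists c : 'I_d -> C, v = \sum_i c i *: b i;
  vsa_lower : exists N : int, forall (k : int) (v : V),
    (k < N)%R -> gproj (vgr V) k v = 0;
  vsa_vac_wt : gproj (vgr V) 0 (vac V) = vac V;
  vsa_L0 : forall (n : int) (u v : V),
    vL0 (vY n u v) - vY n u (vL0 v) = n%:~R *: vY n u v + vY n (vL0 u) v;
  vsa_vac : forall (n : int) (v : V),
    vY n (vac V) v = if n == 0 then v else 0;
  vsa_creation_reg : forall (n : int) (u : V), (n < 0)%R -> vY n u (vac V) = 0;
  vsa_creation : forall u : V, vY 0 u (vac V) = u;
  vsa_Lm1_der : forall (n : int) (u v : V),
    (n + 1)%:~R *: vY (n + 1) u v = vY n (vLm1 u) v;
  vsa_Lm1_comm : forall (n : int) (u v : V),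
    (n + 1)%:~R *: vY (n + 1) u v = vLm1 (vY n u v) - vY n u (vLm1 v);
  vsa_duality : forall (b1 b2 : bool) (u1 u2 v : V) (v' : {scalar V}),
    vparity b1 u1 -> vparity b2 u2 -> graded_dual (vgr V) v' ->
    exists (P : {poly {poly C}}) (r s t : nat), forall z1 z2 : C,
      let f := (P.[z1%:P]).[z2] / (z1 ^+ r * z2 ^+ s * (z1 - z2) ^+ t) in
      let prod12 := fun mn : int * int =>
        v' (vY mn.1 u1 (vY mn.2 u2 v)) * z1 ^ mn.1 * z2 ^ mn.2 in
      let prod21 := fun mn : int * int =>
        (-1) ^+ (b1 && b2) *
        (v' (vY mn.2 u2 (vY mn.1 u1 v)) * z1 ^ mn.1 * z2 ^ mn.2) in
      let iterate := fun mn : int * int =>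
        v' (vY mn.2 (vY mn.1 u1 u2) v) * (z1 - z2) ^ mn.1 * z2 ^ mn.2 in
      [/\ 0 < `|z2| < `|z1| -> abs_conv prod12 /\ has_sum prod12 f,
          0 < `|z1| < `|z2| -> abs_conv prod21 /\ has_sum prod21 f
        & 0 < `|z1 - z2| < `|z2| -> abs_conv iterate /\ has_sum iterate f]
}.

Record is_vsa_aut (g : {linear V -> V}) : Prop := IsVsaAut {
  aut_bij : bijective g;
  aut_wt : forall (k : int) (v : V),
    gproj (vgr V) k v = v -> gproj (vgr V) k (g v) = g v;
  aut_Y : forall (n : int) (u v : V), g (vY n u v) = vY n (g u) (g v)
}.

End VertexSuperalgebra.

(* The grading is by (weight, fermion number, g-weight), classes of C/Z being
   given by their representatives in 0 <= Re < 1 ([tw_strip] below).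
   [tY n k v w] is the coefficient of x^n (log x)^k in Y_W^g(v, x) w. *)
Record twmod_data (R : realType) (V : vsa_data R) := TwmodData {
  tsort :> lmodType R[i];
  tgr : grading tsort (R[i] * bool * R[i])%type;
  tL0 : {linear tsort -> tsort};
  tLm1 : {linear tsort -> tsort};
  tact : {linear tsort -> tsort};
  tY : R[i] -> nat -> V -> tsort -> tsort
}.

Section TwistedModule.
Variables (R : realType) (V : vsa_data R) (g : {linear V -> V}).
Variable W : twmod_data V.
Local Notation C := R[i].

Definition tweight (n : C) : set W := gr_sub (tgr W) [set i | i.1.1 = n].
Definition tparity (b : bool) : set W := gr_sub (tgr W) [set i | i.1.2 = b].
Definition tgweight (a : C) : set W := gr_sub (tgr W) [set i | i.2 = a].

(* The term in x^n of Y_W^g(v, x) w, after the substitution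
   x^n = e^(n l_p(z)), log x = l_p(z). *)
Definition tYsub (p : int) (z : C) (n : C) (v : V) (w : W) : W :=
  \sum_(k \in [set: nat]) (cexp (n * lp p z) * lp p z ^+ k) *: tY n k v w.

(* The coefficients of d/dx and x d/dx applied to
   \sum_(n, k) F n k x^n (log x)^k. *)
Definition fddx (F : C -> nat -> W) (n : C) (k : nat) : W :=
  (n + 1) *: F (n + 1) k + k.+1%:R *: F (n + 1) k.+1.
Definition fxddx (F : C -> nat -> W) (n : C) (k : nat) : W :=
  n *: F n k + k.+1%:R *: F n k.+1.

Record is_twmod : Prop := IsTwmod {
  tw_linl : forall n k w, linear (fun v => tY n k v w : W);
  tw_linr : forall n k v, linear (tY n k v : W -> W);
  tw_log : forall (v : V) (w : W), exists K : nat,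
    forall n k, (K <= k)%N -> tY n k v w = 0;
  tw_strip : forall i w, ~~ in_strip i.2 -> gproj (tgr W) i w = 0;
  (* an equality in the completion \prod_i W_i *)
  tw_equivariance : forall (p : int) (z : C) (v : V) (w : W) i, z != 0 ->
    \sum_(n \in [set: C]) gproj (tgr W) i (tYsub (p + 1) z n (g v) w) =
    \sum_(n \in [set: C]) gproj (tgr W) i (tYsub p z n v w);
  tw_vac : forall n k (w : W),
    tY n k (vac V) w = if (n == 0) && (k == 0%N) then w else 0;
  tw_duality : forall (bu bv : bool) (u v : V) (w : W) (w' : {scalar W}),
    vparity bu u -> vparity bv v -> graded_dual (tgr W) w' ->
    exists (N t : nat) (a : nat -> nat -> nat -> nat -> C) (m n : nat -> C),
    forall (p : int) (z1 z2 : C),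
      let l1 := lp p z1 in let l2 := lp p z2 in
      let f :=
        \sum_(i < N.+1) \sum_(j < N.+1) \sum_(k < N.+1) \sum_(l < N.+1)
          a i j k l * cexp (m i * l1) * cexp (n j * l2) * l1 ^+ k * l2 ^+ l
          / (z1 - z2) ^+ t in
      let prod12 := fun rs : C * C =>
        w' (tYsub p z1 rs.1 u (tYsub p z2 rs.2 v w)) in
      let prod21 := fun rs : C * C =>
        (-1) ^+ (bu && bv) * w' (tYsub p z2 rs.2 v (tYsub p z1 rs.1 u w)) in
      let iterate := fun rs : int * C =>
        (z1 - z2) ^ rs.1 * w' (tYsub p z2 rs.2 (vY rs.1 u v) w) in
      [/\ 0 < `|z2| < `|z1| -> abs_conv prod12 /\ has_sum prod12 f,
          0 < `|z1| < `|z2| -> abs_conv prod21 /\ has_sum prod21 f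
        & 0 < `|z1 - z2| < `|z2| -> abs_conv iterate /\
            (`|arg z1 - arg z2| < pi / 2 -> has_sum iterate f)];
  tw_L0_nilp : forall (n : C) (w : W), tweight n w ->
    exists K, iter K (fun x => tL0 W x - n *: x) w = 0;
  tw_L0 : forall (v : V) (w : W) n k,
    tL0 W (tY n k v w) - tY n k v (tL0 W w) =
    fxddx (fun n k => tY n k v w) n k + tY n k (vL0 v) w;
  tw_act_nilp : forall (a : C) (w : W), tgweight a w ->
    exists K, iter K (fun x => tact W x - cexp (twopii R * a) *: x) w = 0;
  tw_act : forall (u : V) (w : W) n k,
    tact W (tY n k u w) = tY n k (g u) (tact W w);
  tw_parity : forall (bu bw : bool) (u : V) (w : W) n k,
    vparity bu u -> tparity bw w -> tparity (bu (+) bw) (tY n k u w);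
  tw_Lm1 : forall (v : V) (w : W) n k,
    fddx (fun n k => tY n k v w) n k =
    tLm1 W (tY n k v w) - tY n k v (tLm1 W w)
}.

Definition lower_bounded : Prop :=
  exists B : R, forall (n : C) (w : W),
    complex.Re n < B -> tweight n w -> w = 0.

End TwistedModule.

Section AutomorphismLog.
Variables (R : realType) (V : vsa_data R) (g : {linear V -> V}).
Local Notation C := R[i].

(* V^[a] *)
Definition gen_eig (a : C) : set V :=
  [set u | exists K, iter K (fun x => g x - cexp (twopii R * a) *: x) u = 0].

Definition eig_decomp (u : V) (d : C -> V) : Prop :=
  [/\ finite_set [set a | d a != 0],
      forall a, ~~ in_strip a -> d a = 0,
      forall a, gen_eig a (d a)
    & \sum_(a \in [set: C]) d a = u].

(* The component of u in V^[a], for V = \coprod_a V^[a]. *)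
Definition gcomp (u : V) : C -> V := xget (fun=> 0) [set d | eig_decomp u d].

(* e^(c S_g) *)
Definition expS (c : C) (u : V) : V :=
  \sum_(a \in [set: C]) cexp (c * a) *: gcomp u a.

(* N_g = (2 pi i)^-1 log (e^(-2 pi i S_g) g), where
   log (1 + M) = \sum_j (-1)^j / (j + 1) M^(j + 1). *)
Definition Ng (u : V) : V :=
  (twopii R)^-1 *: \sum_(j \in [set: nat])
    ((-1) ^+ j / j.+1%:R) *:
    iter j.+1 (fun x => expS (- twopii R) (g x) - x) u.

End AutomorphismLog.

(* The tuple (e0, e1, e2, k1, k2) stands for the monomial
   x0^e0 x1^e1 x2^e2 (log x1)^k1 (log x2)^k2; multiplying monomials is adding
   tuples componentwise.  A formal series is the family of its coefficients,
   and the sums below have finite support wherever they are used. *)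
Notation mono R := (R[i] * R[i] * R[i] * nat * nat)%type.
Notation fser R M := (mono R -> M).

Section FormalSeries.
Variable R : realType.
Local Notation C := R[i].

Definition fmono (m : mono R) : fser R C := fun m' => (m' == m)%:R.

Definition fadd (M : nmodType) (F G : fser R M) : fser R M :=
  fun m => F m + G m.
Definition fopp (M : zmodType) (F : fser R M) : fser R M := fun m => - F m.
Definition fsum (M : nmodType) (I : choiceType) (F : I -> fser R M) : fser R M :=
  fun m => \sum_(i \in [set: I]) F i m.
Definition fscale (M : lmodType C) (c : C) (F : fser R M) : fser R M :=
  fun m => c *: F m.

Definition fmul (M : lmodType C) (s : fser R C) (F : fser R M) : fser R M :=
  fun m => \sum_(q \in [set q : mono R * mono R | q.1 + q.2 = m])
    s q.1 *: F q.2.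

Definition fmulC : fser R C -> fser R C -> fser R C := @fmul C^o.
Definition fscaleC : C -> fser R C -> fser R C := @fscale C^o.

Definition fpow (s : fser R C) (j : nat) : fser R C :=
  iter j (fmulC s) (fmono 0).

Definition fx1 (b : C) : fser R C := fmono (0, b, 0, 0%N, 0%N).
Definition flog1 : fser R C := fmono (0, 0, 0, 1%N, 0%N).
Definition flog2 : fser R C := fmono (0, 0, 0, 0%N, 1%N).

(* (x2 + x0)^b *)
Definition fx20 (b : C) : fser R C :=
  fsum (fun i : nat =>
    fscaleC (binC b i) (fmono (i%:R, 0, b - i%:R, 0%N, 0%N))).

(* log (x2 + x0) *)
Definition flog20 : fser R C :=
  fadd flog2 (fsum (fun i : nat =>
    fscaleC ((-1) ^+ i / i.+1%:R)
      (fmono (i.+1%:R, 0, - i.+1%:R, 0%N, 0%N)))).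

(* delta ((x2 + x0) / x1) *)
Definition fdelta : fser R C :=
  fsum (fun n : int => fmulC (fx20 n%:~R) (fx1 (- n%:~R))).

(* Res_x0 *)
Definition fres0 (M : Type) (F : fser R M) : C -> C -> nat -> nat -> M :=
  fun e1 e2 k1 k2 => F (-1, e1, e2, k1, k2).

Variables (V : vsa_data R) (g : {linear V -> V}) (W : twmod_data V).

(* e^((log (x2 + x0) - log x1) N_g) u *)
Definition fexpN (u : V) : fser R V :=
  fun m => \sum_(j \in [set: nat])
    ((j`!%:R)^-1 * fpow (fadd flog20 (fopp flog1)) j m) *: iter j (Ng g) u.

(* ((x2 + x0) / x1)^(L_g) u *)
Definition fpowL (u : V) : fser R V :=
  fsum (fun a : C => fmul (fx20 a) (fmul (fx1 (- a)) (fexpN (gcomp g u a)))).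

(* Y_V(F, x0) v *)
Definition fYV (F : fser R V) (v : V) : fser R V :=
  fun m => \sum_(q \in [set q : int * mono R |
                   (q.1%:~R, 0, 0, 0%N, 0%N) + q.2 = m]) vY q.1 (F q.2) v.

(* Y_W^g(F, x2) w *)
Definition fYW (F : fser R V) (w : W) : fser R W :=
  fun m => \sum_(q \in [set q : C * nat * mono R |
                   (0, 0, q.1.1, 0%N, q.1.2) + q.2 = m])
    tY q.1.1 q.1.2 (F q.2) w.

End FormalSeries.

(* Main.v *)
Require Import Defs.
From HB Require Import structures.
From mathcomp Require Import all_boot all_order all_algebra finmap.
From mathcomp Require Import complex.
From mathcomp Require Import all_classical all_reals all_analysis.
From mathcomp Require Import ring lra zify.

(** The commutator formula is the residue theorem for the function f of the
    duality axiom, in the variable z = z1 / z2.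

    Both sides are trilinear, so u, v and w may be taken homogeneous, with u in
    V^[a].  Apply a linear functional supported on one component of W.  By weights
    each exponent of x1 is then paired with a single exponent of x2, and the two
    products and the iterate become series in one variable.  Put z2 = 1 and
    z1 = e^x with x real: all logarithms are real, and f is Phi(x) / (e^x - 1)^t
    with Phi a quasi-polynomial, a finite sum of terms e^(m x) x^k.  Replacing u
    by e^(x N_g) u removes the logarithms from the products ([tYsub_unlog]).
    They turn into z^(- a) times Laurent series in z that sum to the same function
    for z > 1 and for z < 1.

    That this function is rational up to the factor z^(- a) follows from asymptotic
    expansions at the ends of the half-line alone.  For z > 1 the series is an asymptotic expansion of a
    quasi-polynomial in powers of e^(- x), and a quasi-polynomial with such an
    expansion is a finite sum of its terms ([qp_asym]).  So the three series are
    the expansions at infinity, 0 and 1 of P(z) / (z - 1)^t with P a Laurent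
    polynomial, and the difference of the first two is the residue at 1
    ([residue_at_one], a Vandermonde convolution; [twisted_residue],
    [core_functional]).  Here z^a is expanded at z = 1 + x as (1 + x)^a, and
    e^(x N_g) gives the powers of log (1 + x): together they are the operator
    ((x2 + x0) / x1)^(L_g).

    The logarithms are governed by equivariance: passing from l_p to l_(p + 1)
    undoes g.  As e^(2 pi i m N_g) is polynomial in m, this yields that Y(v, x) is
    Y_0(x^(- N_g) v, x) with Y_0 free of logarithms, with exponents in - a + Z on
    V^[a] ([tY_log], [tY_exponent]).  For the same reason N_g is a derivation
    ([Ng_der]), which reduces all coefficients to those without logarithms.

    Linear functionals separate vectors by Zorn's lemma ([functional_sep]), so the
    identity holds in W.  On the right-hand side of the theorem the exponent of x1
    determines the component of u in V^[a] and the exponent of the delta function,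
    and what remains is the same finite sum ([fres0_residue_part]). *)

Set Implicit Arguments.
Unset Strict Implicit.
Unset Printing Implicit Defensive.

Import Order.TTheory GRing.Theory Num.Theory.
Local Open Scope complex_scope.
Local Open Scope ring_scope.

(** * Binomial coefficients and powers of log (1 + X) *)

Section Combinatorics.
Variable R : realType.
Local Notation C := R[i].
Implicit Types (a b s : C).

Lemma binC0 b : binC b 0 = 1.
Proof. by rewrite /binC big_ord0 fact0 divr1. Qed.

Lemma binCS b n : n.+1%:R * binC b n.+1 = (b - n%:R) * binC b n.
Proof.
rewrite /binC big_ord_recr /= factS natrM.
have h1 : (n.+1%:R : C) != 0 by rewrite pnatr_eq0.
have h2 : (n`!%:R : C) != 0 by rewrite pnatr_eq0 -lt0n fact_gt0.
by field; rewrite h2 nat1r h1.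
Qed.

Lemma binC_pascal b n : binC (b + 1) n.+1 = binC b n.+1 + binC b n.
Proof.
elim: n => [|n IH].
  have h (x : C) : binC x 1 = x by have := binCS x 0; rewrite binC0 mul1r subr0 mulr1.
  by rewrite !h binC0.
have h1 : (n.+2%:R : C) != 0 by rewrite pnatr_eq0.
apply: (mulfI h1); rewrite mulrDr !binCS IH.
have := binCS b n; rewrite -[n.+2%:R]natr1 -[n.+1%:R]natr1 => h.
have -> : (b + 1 - (n%:R + 1)) * (binC b n.+1 + binC b n) =
  (b - n%:R) * binC b n.+1 + (b - n%:R) * binC b n by ring.
by rewrite -h; ring.
Qed.

(** As a and b are arbitrary complex numbers, this is by induction with the
    recurrence (m + 1) C(a, m + 1) = (a - m) C(a, m). *)
Lemma binC_vandermonde a b m :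
  \sum_(i < m.+1) binC a i * binC b (m - i) = binC (a + b) m.
Proof.
elim: m => [|m IH]; first by rewrite big_ord1 !binC0 mulr1.
have h1 : (m.+1%:R : C) != 0 by rewrite pnatr_eq0.
apply: (mulfI h1); rewrite binCS -IH.
have -> : m.+1%:R * (\sum_(i < m.+2) binC a i * binC b (m.+1 - i)) =
  (\sum_(i < m.+2) (i%:R * binC a i) * binC b (m.+1 - i)) +
  \sum_(i < m.+2) binC a i * ((m.+1 - i)%:R * binC b (m.+1 - i)).
  rewrite mulr_sumr -big_split; apply: eq_bigr => i _ /=.
  have -> : (m.+1%:R : C) = i%:R + (m.+1 - i)%:R.
    by rewrite -natrD subnKC // -ltnS.
  by ring.
rewrite big_ord_recl /= mul0r mul0r add0r [X in _ + X]big_ord_recr /=.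
rewrite subnn mul0r mulr0 addr0 -big_split mulr_sumr.
apply: eq_bigr => i _ /=.
have im : (i <= m)%N by rewrite -ltnS.
rewrite /bump /= add1n subSS binCS (subSn im) binCS.
by rewrite (natrB _ im); ring.
Qed.

(** The series log (1 + X) modulo X^(N + 1). *)
Definition log1p (N : nat) : {poly C} :=
  \sum_(i < N) ((-1) ^+ i / i.+1%:R) *: 'X^(i.+1).

Lemma log1p_factor N : exists p, log1p N = 'X * p.
Proof.
exists (\poly_(i < N) ((-1) ^+ i / i.+1%:R)).
by rewrite poly_def mulr_sumr; apply: eq_bigr => i _; rewrite exprS -scalerAr.
Qed.

Lemma coef_log1pX_lt N k j : (j < k)%N -> (log1p N ^+ k)`_j = 0.
Proof.
by move=> h; have [p ->] := log1p_factor N; rewrite exprMn coefXnM h.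
Qed.

Lemma deriv_log1p N : (1 + 'X) * (log1p N)^`() = 1 - (- 'X) ^+ N.
Proof.
have -> : (log1p N)^`() = \sum_(i < N) (- 'X) ^+ i.
  rewrite /log1p raddf_sum /=; apply: eq_bigr => i _.
  rewrite derivZ derivXn /= -['X^_ *+ _]scaler_nat scalerA divfK ?pnatr_eq0 //.
  by rewrite -mul_polyC polyC_exp polyCN [RHS]exprNn.
rewrite -{2}(expr1n {poly C} N) subrXX opprK; congr (_ * _).
by apply: eq_bigr => i _; rewrite expr1n mul1r.
Qed.

(** The identity e^(s log (1 + X)) = (1 + X)^s: the coefficients of both sides
    satisfy the recurrence expressed by (1 + X) F' = s F. *)
Lemma exp_log1p s N K j : (j <= N)%N -> (j < K)%N ->
  \sum_(k < K) (s ^+ k / k`!%:R) * (log1p N ^+ k)`_j = binC s j.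
Proof.
move=> jN jK.
pose F := \sum_(k < K) (s ^+ k / k`!%:R) *: log1p N ^+ k.
have FE i : F`_i = \sum_(k < K) (s ^+ k / k`!%:R) * (log1p N ^+ k)`_i.
  by rewrite coef_sum; apply: eq_bigr => k _; rewrite coefZ.
rewrite -FE.
case: K jK @F FE => // K jK F FE.
have dF : (1 + 'X) * F^`() =
    (s *: F - (s ^+ K.+1 / K`!%:R) *: log1p N ^+ K) * (1 - (- 'X) ^+ N).
  rewrite -deriv_log1p [RHS]mulrCA; congr (_ * _).
  rewrite /F raddf_sum /= big_ord_recl /= expr0 derivZ (derivC (1 : C)) scaler0.
  rewrite add0r big_ord_recr /= scalerDr scalerA mulrA -exprS addrK.
  rewrite scaler_sumr mulr_suml; apply: eq_bigr => k _.
  rewrite derivZ deriv_exp /= add0n [_ * log1p N ^+ k]mulrC -!scalerAl.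
  rewrite -[(_ * _) *+ _]scaler_nat !scalerA; congr (_ *: _).
  rewrite /bump /= add1n exprS factS natrM.
  have h1 : (k.+1%:R : C) != 0 by rewrite pnatr_eq0.
  have h2 : (k`!%:R : C) != 0 by rewrite pnatr_eq0 -lt0n fact_gt0.
  by field; rewrite h2 nat1r h1.
have rec i : (i < N)%N -> (i < K)%N -> i.+1%:R * F`_i.+1 = (s - i%:R) * F`_i.
  move=> iN iK; have := congr1 (fun p : {poly C} => p`_i) dF.
  rewrite mulrDl mul1r coefD coefXM coef_deriv mulrBr mulr1 coefB.
  rewrite exprNn mulrA coefMXn iN subr0 coefB !coefZ coef_log1pX_lt // mulr0 subr0.
  rewrite mulrBl => <-; rewrite -[F`_i.+1 *+ _]mulr_natl.
  case: i {iN iK} => [|i] /=; first by rewrite addr0 mul0r subr0.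
  by rewrite coef_deriv -[F`_i.+1 *+ _]mulr_natl addrK.
elim: j jN jK => [|j IH] jN jK.
  rewrite FE binC0 big_ord_recl expr0 coef1 /= fact0 divr1 mulr1.
  by rewrite big1 ?addr0 // => k _; rewrite coef_log1pX_lt ?mulr0.
have h1 : (j.+1%:R : C) != 0 by rewrite pnatr_eq0.
apply: (mulfI h1); rewrite binCS rec // IH //; exact: ltnW.
Qed.

(** The coefficient of X^q in log (1 + X)^k. *)
Definition log1pc (k q : nat) : C := (log1p q ^+ k)`_q.

Lemma log1pcE N k q : (q <= N)%N -> (log1p N ^+ k)`_q = log1pc k q.
Proof.
move=> qN; rewrite /log1pc.
have -> : log1p N = log1p q + 'X^(q.+1) * \sum_(i < N - q)
    ((-1) ^+ (q + i) / (q + i).+1%:R) *: 'X^i.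
  rewrite /log1p -(big_mkord predT (fun i => ((-1) ^+ i / i.+1%:R) *: 'X^(i.+1))).
  rewrite (big_cat_nat (n := q)) //= big_mkord; congr (_ + _).
  rewrite -{1}[q]add0n big_addn big_mkord mulr_sumr; apply: eq_bigr => i _.
  by rewrite -scalerAr -exprD addSn addnC.
rewrite exprDn big_ord_recl subn0 expr0 mulr1 bin0 mulr1n coefD coef_sum.
rewrite big1 ?addr0 // => i _; rewrite coefMn.
by rewrite exprMn -exprM mulrCA coefXnM lift0 mulnS addSn ltnS leq_addr mul0rn.
Qed.

(** The coefficient of X^p in (1 + X)^a log (1 + X)^k / k!. *)
Definition powlog1pc (a : C) (k p : nat) : C :=
  \sum_(i < p.+1) binC a i * log1pc k (p - i) / k`!%:R.

(** The coefficients of (z - 1) F, where f gives those of the series F in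
    z. *)
Definition shiftdiff (f : int -> C) : int -> C := fun n : int => f (n - 1) - f n.

(** The coefficients of (z - 1)^(- t), expanded at infinity. *)
Definition invpow_oo (t : nat) (n : int) : C :=
  if t is t'.+1 then (if n < 0 then binC (- 1 - n%:~R) t' else 0) else (n == 0)%:R.
(** The coefficients of (z - 1)^(- t), expanded at 0. *)
Definition invpow_0 (t : nat) (n : int) : C :=
  if t is t'.+1 then (if n < 0 then 0 else - binC (- 1 - n%:~R) t') else (n == 0)%:R.

Lemma binC_0n t : binC (0 : C) t = (t == 0)%:R.
Proof.
case: t => [|t]; first by rewrite binC0.
by rewrite /binC big_ord_recl /= subr0 !mul0r.
Qed.

Lemma binCN1 t : binC (- 1 : C) t = (-1) ^+ t.
Proof.
elim: t => [|t IH]; first by rewrite binC0.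
have h1 : (t.+1%:R : C) != 0 by rewrite pnatr_eq0.
by apply: (mulfI h1); rewrite binCS IH -natr1 exprS; ring.
Qed.

Lemma shiftdiff_binC t (n : int) :
  binC (- 1 - (n - 1)%:~R : C) t.+1 - binC (- 1 - n%:~R) t.+1 = binC (- 1 - n%:~R) t.
Proof.
have -> : - 1 - (n - 1)%:~R = (- 1 - n%:~R : C) + 1 by rewrite intrB; ring.
by rewrite binC_pascal addrAC subrr add0r.
Qed.

Lemma shiftdiff_invpow_oo t : shiftdiff (invpow_oo t.+1) = invpow_oo t.
Proof.
apply: funext => n; rewrite /shiftdiff /invpow_oo.
have [n0|n0] := ltrP n 0.
  have -> : n - 1 < 0 by lia.
  case: t => [|t]; last by rewrite shiftdiff_binC.
  by rewrite !binC0 subrr; have -> : (n == 0) = false by lia.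
have [n1|n1] := ltrP (n - 1) 0.
  have -> : n = 0 by lia.
  rewrite sub0r rmorphN1 opprK addNr binC_0n subr0.
  by case: t.
by rewrite subrr; case: t => //; have -> : (n == 0) = false by lia.
Qed.

Lemma shiftdiff_invpow_0 t : shiftdiff (invpow_0 t.+1) = invpow_0 t.
Proof.
apply: funext => n; rewrite /shiftdiff /invpow_0.
have [n0|n0] := ltrP n 0.
  have -> : n - 1 < 0 by lia.
  by rewrite subrr; case: t => //; have -> : (n == 0) = false by lia.
have [n1|n1] := ltrP (n - 1) 0.
  have -> : n = 0 by lia.
  rewrite sub0r opprK subr0 binCN1.
  by case: t => // t; rewrite binCN1 exprS mulN1r.
case: t => [|t]; last by rewrite opprK addrC -[in RHS]shiftdiff_binC opprB.
by rewrite !binC0 subrr; have -> : (n == 0) = false by lia.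
Qed.

(** The difference f - h is constant, and it vanishes far to the right. *)
Lemma shiftdiff_uniq_top (f h : int -> C) (n0 : int) : shiftdiff f = shiftdiff h ->
  (forall n, n0 < n -> f n = h n) -> f = h.
Proof.
move=> fh h0; apply: funext => n.
have [m mE] : exists m : nat, n0 < n + m%:Z.
  by exists (absz (n0 - n)).+1; lia.
elim: m n mE => [|m IH] n nm; first by apply: h0; rewrite addr0 in nm.
have := congr1 (fun k => k (n + 1)) fh; rewrite /shiftdiff addrK.
by rewrite (IH (n + 1)); [move/addIr | lia].
Qed.

Lemma shiftdiff_uniq_bot (f h : int -> C) (n0 : int) : shiftdiff f = shiftdiff h ->
  (forall n, n < n0 -> f n = h n) -> f = h.
Proof.
move=> fh h0; apply: funext => n.
have [m mE] : exists m : nat, n - m%:Z < n0.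
  by exists (absz (n0 - n)).+1; lia.
elim: m n mE => [|m IH] n nm; first by apply: h0; rewrite subr0 in nm.
have := congr1 (fun k => k n) fh; rewrite /shiftdiff.
by rewrite (IH (n - 1)); [move/addrI/oppr_inj | lia].
Qed.

Lemma shiftdiff_top f n0 : (forall n : int, n0 < n -> f n = 0) ->
  forall n, n0 + 1 < n -> shiftdiff f n = 0.
Proof. by move=> h n hn; rewrite /shiftdiff !h ?subrr //; lia. Qed.

Lemma shiftdiff_bot f n0 : (forall n : int, n < n0 -> f n = 0) ->
  forall n, n < n0 -> shiftdiff f n = 0.
Proof. by move=> h n hn; rewrite /shiftdiff !h ?subrr //; lia. Qed.

Section ResidueAtOne.
Variables (K : nat) (a : nat -> C) (kappa : nat -> int).

Let lin (p : int -> C) n := \sum_(k < K) a k * p (n - kappa k).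

Let shiftdiff_lin p : shiftdiff (lin p) = lin (shiftdiff p).
Proof.
apply: funext => n; rewrite /shiftdiff /lin -sumrB; apply: eq_bigr => k _.
by rewrite -mulrBr; congr (_ * (p _ - _)); lia.
Qed.

(** Division by (z - 1)^t is unique among series bounded above. *)
Lemma shiftdiff_solve_top t c n0 : (forall n : int, n0 < n -> c n = 0) ->
  iter t shiftdiff c = lin (fun n => (n == 0)%:R) -> c = lin (invpow_oo t).
Proof.
elim: t c n0 => [|t IH] c n0 c0 cE; first exact: cE.
have h : shiftdiff c = lin (invpow_oo t).
  by apply: (IH _ (n0 + 1)); [exact: shiftdiff_top | rewrite -iterSr].
have [M hM] : exists M : int, forall k : 'I_K, kappa k < M.
  exists (\sum_(k < K) `|kappa k| + 1) => k.
  rewrite (bigD1 k) //=.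
  have : (0 : int) <= \sum_(i < K | i != k) `|kappa i| by apply: sumr_ge0.
  move: (\sum_(i < K | i != k) `|kappa i|) (ler_norm (kappa k)) => S h1 h2.
  by rewrite -addrA (le_lt_trans h1) // ltrDl ltr_wpDl.
apply: (@shiftdiff_uniq_top _ _ (Num.max n0 M)).
  by rewrite h shiftdiff_lin shiftdiff_invpow_oo.
move=> n; rewrite gt_max => /andP[h1 h2]; rewrite c0 // /lin big1 // => k _.
by rewrite /invpow_oo ifF ?mulr0 //; have := hM k; lia.
Qed.

(** Division by (z - 1)^t is unique among series bounded below. *)
Lemma shiftdiff_solve_bot t d n0 : (forall n : int, n < n0 -> d n = 0) ->
  iter t shiftdiff d = lin (fun n => (n == 0)%:R) -> d = lin (invpow_0 t).
Proof.
elim: t d n0 => [|t IH] d n0 d0 dE; first exact: dE.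
have h : shiftdiff d = lin (invpow_0 t).
  by apply: (IH _ n0); [exact: shiftdiff_bot | rewrite -iterSr].
have [M hM] : exists M : int, forall k : 'I_K, M < kappa k.
  exists (- (\sum_(k < K) `|kappa k|) - 1) => k.
  rewrite (bigD1 k) //=.
  have : (0 : int) <= \sum_(i < K | i != k) `|kappa i| by apply: sumr_ge0.
  move: (\sum_(i < K | i != k) `|kappa i|) (ler_norm (- kappa k)) => S.
  rewrite normrN => h1 h2.
  by rewrite -opprD ltrNl (le_lt_trans h1) // -addrA ltrDl ltr_wpDl.
apply: (@shiftdiff_uniq_bot _ _ (Num.min n0 M)).
  by rewrite h shiftdiff_lin shiftdiff_invpow_0.
move=> n; rewrite lt_min => /andP[h1 h2]; rewrite d0 // /lin big1 // => k _.
by rewrite /invpow_0 ifT ?mulr0 //; have := hM k; lia.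
Qed.

(** The residue theorem for z^n P(z) / (z - 1)^(t + 1), where P is the Laurent
    polynomial with coefficients a_k and exponents kappa_k: c, d and b are the
    expansions of P(z) / (z - 1)^(t + 1) at infinity, 0 and 1. *)
Lemma residue_at_one t (c d b : int -> C) n0 n1 :
  (forall n : int, n0 < n -> c n = 0) -> (forall n : int, n < n1 -> d n = 0) ->
  iter t.+1 shiftdiff c = lin (fun n => (n == 0)%:R) ->
  iter t.+1 shiftdiff d = lin (fun n => (n == 0)%:R) ->
  (forall n : int, n < - t.+1%:Z -> b n = 0) ->
  (forall m : nat, b (m%:Z - t.+1%:Z) = \sum_(k < K) a k * binC (kappa k)%:~R m) ->
  forall (n : int) T, (t < T)%N ->
  c (- 1 - n) - d (- 1 - n) = \sum_(i < T) binC n%:~R i * b (- 1 - i%:Z).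
Proof.
move=> c0 d0 cE dE b0 bE n T tT.
rewrite (shiftdiff_solve_top c0 cE) (shiftdiff_solve_bot d0 dE) /lin -sumrB.
(* the expansions of (z - 1)^-(t + 1) at infinity and 0 differ by a polynomial
   in the exponent *)
transitivity (\sum_(k < K) a k * binC (n%:~R + (kappa k)%:~R) t).
  apply: eq_bigr => k _; rewrite -mulrBr; congr (_ * _).
  have -> : n%:~R + (kappa k)%:~R = - 1 - (- 1 - n - kappa k)%:~R :> C.
    by rewrite !intrB rmorphN1; ring.
  by rewrite /invpow_oo /invpow_0; case: ifP; rewrite ?subr0 ?sub0r ?opprK.
rewrite -(subnKC tT) big_split_ord /= [X in _ = _ + X]big1 ?addr0; last first.
  by move=> i _; rewrite b0 ?mulr0 //; lia.
transitivity (\sum_(i < t.+1) \sum_(k < K)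
    a k * (binC n%:~R i * binC (kappa k)%:~R (t - i))).
  rewrite exchange_big /=; apply: eq_bigr => k _.
  by rewrite -mulr_sumr binC_vandermonde.
apply: eq_bigr => i _.
have -> : - 1 - i%:Z = (t - i)%N%:Z - t.+1%:Z by have := ltn_ord i; lia.
by rewrite bE mulr_sumr; apply: eq_bigr => k _; ring.
Qed.

End ResidueAtOne.

End Combinatorics.

(** * The complex exponential and the argument *)

Section ComplexExponential.
Variable R : realType.
Local Notation C := R[i].
Implicit Types (z s a : C) (x y : R).

Lemma cexpD z s : cexp (z + s) = cexp z * cexp s.
Proof.
case: z s => [a b] [c d]; rewrite /cexp /= expRD cosD sinD.
apply/eqP; rewrite eq_complex /=; apply/andP; split; apply/eqP; ring.
Qed.

Lemma cexp0 : cexp (0 : C) = 1.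
Proof. by rewrite /cexp /= expR0 cos0 sin0 mulr0 mulr1. Qed.

Lemma cexp_neq0 z : cexp z != 0.
Proof.
apply/negP => /eqP h; have := cexpD z (- z).
by rewrite subrr cexp0 h mul0r => /eqP; rewrite oner_eq0.
Qed.

Lemma cexpN z : cexp (- z) = (cexp z)^-1.
Proof.
apply: (mulfI (cexp_neq0 z)); rewrite -cexpD subrr cexp0 mulfV //.
exact: cexp_neq0.
Qed.

Lemma cexpMn z n : cexp (n%:R * z) = cexp z ^+ n.
Proof.
elim: n => [|n IH]; first by rewrite mul0r cexp0.
by rewrite -nat1r mulrDl mul1r cexpD IH exprS.
Qed.

Lemma cexpMz z (n : int) : cexp (n%:~R * z) = cexp z ^ n.
Proof.
case: n => n; first by rewrite (_ : _%:~R = n%:R) // cexpMn.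
by rewrite NegzE mulrNz mulNr cexpN (_ : _%:~R = n.+1%:R) // cexpMn exprnN.
Qed.

Lemma cexp_real x : cexp x%:C = (expR x)%:C.
Proof. by rewrite /cexp /= sin0 cos0 mulr0 mulr1. Qed.

Lemma realC_le x y : (x%:C <= y%:C) = (x <= y).
Proof. by rewrite lecE /= eqxx. Qed.

Lemma realC_lt x y : (x%:C < y%:C) = (x < y).
Proof. by rewrite ltcE /= eqxx. Qed.

Lemma norm_realC x : `|x%:C| = `|x|%:C.
Proof. by rewrite normc_def /= expr0n /= addr0 sqrtr_sqr. Qed.

Lemma cmodE z : (cmod z)%:C = `|z|.
Proof. by rewrite /cmod normc_def. Qed.

Lemma norm_cexp z : `|cexp z| = (expR (complex.Re z))%:C.
Proof.
rewrite normc_def /cexp /= !exprMn -mulrDr cos2Dsin2 mulr1 sqrtr_sqr.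
by rewrite ger0_norm // expR_ge0.
Qed.

Lemma cmod_pos x : 0 < x -> cmod x%:C = x.
Proof. by move=> x0; rewrite /cmod norm_realC ger0_norm // ltW. Qed.

Lemma arg_pos x : 0 < x -> arg x%:C = 0.
Proof. by move=> x0; rewrite /arg /= lexx cmod_pos // divff ?gt_eqF // acos1. Qed.

Lemma lp_pos p x : 0 < x -> lp p x%:C = (ln x)%:C + p%:~R * twopii R.
Proof.
move=> x0; rewrite /lp cmod_pos // arg_pos // add0r /twopii.
have -> : (p%:~R : C) = (p%:~R : R)%:C by rewrite rmorph_int.
rewrite -[RHS]/(Complex (ln x + (p%:~R * 0 - 0 * (2 * pi)))
  (0 + (p%:~R * (2 * pi) + 0 * 0))).
by congr Complex; ring.
Qed.

Lemma lp0_pos x : 0 < x -> lp 0 x%:C = (ln x)%:C.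
Proof. by move=> x0; rewrite lp_pos // mul0r addr0. Qed.

Lemma twopii_neq0 : twopii R != 0.
Proof.
rewrite /twopii eq_complex /= eqxx /= mulf_neq0 ?pnatr_eq0 //.
by rewrite gt_eqF // pi_gt0.
Qed.

Lemma cexp_twopii_int (n : int) : cexp (twopii R * n%:~R) = 1.
Proof.
have -> : cexp (twopii R * n%:~R) = cexp (twopii R) ^ n by rewrite mulrC cexpMz.
rewrite /cexp /twopii /= expR0 mulr_natl cos2pi sin2pi.
by rewrite mulr1 mulr0 exp1rz.
Qed.

Lemma cmod_ge_Re z : `|complex.Re z| <= cmod z.
Proof. by rewrite -realC_le cmodE normc_ge_Re. Qed.

Lemma cmod_gt0 z : z != 0 -> 0 < cmod z.
Proof. by rewrite -realC_lt cmodE normr_gt0. Qed.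

Lemma cmod_sqr z : cmod z ^+ 2 = complex.Re z ^+ 2 + complex.Im z ^+ 2.
Proof. by rewrite /cmod normc_def /= sqr_sqrtr // addr_ge0 ?sqr_ge0. Qed.

Let arg_dom z : z != 0 -> -1 <= complex.Re z / cmod z <= 1.
Proof.
move=> z0; have c0 := cmod_gt0 z0.
rewrite -ler_norml normrM normfV (gtr0_norm c0) ler_pdivrMr // mul1r.
exact: cmod_ge_Re.
Qed.

Let sin_arg_acos z : z != 0 ->
  sin (acos (complex.Re z / cmod z)) = `|complex.Im z| / cmod z.
Proof.
move=> z0; have c0 := cmod_gt0 z0; rewrite sin_acos ?arg_dom //.
have -> : 1 - (complex.Re z / cmod z) ^+ 2 = (`|complex.Im z| / cmod z) ^+ 2.
  rewrite !expr_div_n real_normK ?num_real // cmod_sqr.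
  have h : complex.Re z ^+ 2 + complex.Im z ^+ 2 != 0.
    by rewrite -cmod_sqr expf_neq0 // gt_eqF.
  by field.
by rewrite sqrtr_sqr ger0_norm // divr_ge0 // ltW.
Qed.

Lemma cexp_arg z : z != 0 -> z = (cmod z)%:C * cexp (Complex 0 (arg z)).
Proof.
move=> z0; have c0 := cmod_gt0 z0.
have hc : cos (arg z) = complex.Re z / cmod z.
  rewrite /arg; case: lerP => _; first by rewrite acosK // in_itv /= arg_dom.
  by rewrite cosB mulr_natl cos2pi sin2pi mul0r addr0 mul1r acosK // in_itv /= arg_dom.
have hs : sin (arg z) = complex.Im z / cmod z.
  rewrite /arg; case: lerP => im.
    by rewrite sin_arg_acos // ger0_norm.
  rewrite sinB mulr_natl cos2pi sin2pi mul0r sub0r mul1r sin_arg_acos //.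
  by rewrite ltr0_norm // mulNr opprK.
rewrite /cexp /= expR0 !mul1r hc hs.
rewrite -[RHS]/(Complex (cmod z * (complex.Re z / cmod z) - 0 * (complex.Im z / cmod z))
  (cmod z * (complex.Im z / cmod z) + 0 * (complex.Re z / cmod z))).
rewrite !mul0r subr0 addr0 ![cmod z * _]mulrC !divfK ?gt_eqF //.
by case: z {z0 c0 hc hs}.
Qed.

Lemma arg_bnd z : z != 0 -> 0 <= arg z < 2 * pi.
Proof.
move=> z0; have c0 := cmod_gt0 z0; have b1 := arg_dom z0.
have [h1 h2] := (acos_ge0 b1, acos_lepi b1); have p0 := pi_gt0 R.
rewrite /arg; case: (lerP 0 (complex.Im z)) => im.
  by move: (acos _) h1 h2 => t h1 h2; apply/andP; split; lra.
suff h : 0 < acos (complex.Re z / cmod z).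
  by move: (acos _) h1 h2 h => t h1 h2 h; apply/andP; split; lra.
rewrite lt_neqAle h1 andbT eq_sym; apply/negP => /eqP h.
have := sin_arg_acos z0; rewrite h sin0 => /esym/eqP.
by rewrite mulf_eq0 invr_eq0 normr_eq0 (lt_eqF im) gt_eqF.
Qed.

Lemma cexp_twopii_surj z : z != 0 ->
  exists2 a : C, in_strip a & cexp (twopii R * a) = z.
Proof.
move=> z0; have c0 := cmod_gt0 z0; have /andP[h1 h2] := arg_bnd z0.
have p0 := pi_gt0 R.
(* log z / (2 pi i) *)
exists (Complex (arg z / (2 * pi)) (- ln (cmod z) / (2 * pi))).
  rewrite /in_strip /= divr_ge0 //= ?ltr_pdivrMr ?mul1r //; first by lra.
  by lra.
rewrite [RHS]cexp_arg // -[in RHS](lnK c0) -cexp_real -cexpD; congr cexp.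
rewrite -[LHS]/(Complex (0 * (arg z / (2 * pi)) - 2 * pi * (- ln (cmod z) / (2 * pi)))
  (0 * (- ln (cmod z) / (2 * pi)) + 2 * pi * (arg z / (2 * pi)))).
rewrite -[RHS]/(Complex (ln (cmod z) + 0) (0 + arg z)).
have h : 2 * (pi : R) != 0 by rewrite gt_eqF // mulr_gt0.
by rewrite !mul0r sub0r !add0r addr0 ![_ * (_ / _)]mulrC !divfK // opprK.
Qed.

Lemma cexp_twopii_inj a s :
  cexp (twopii R * a) = cexp (twopii R * s) -> exists n : int, a - s = n%:~R.
Proof.
move=> h; have {h}: cexp (twopii R * (a - s)) = 1.
  by rewrite mulrBr cexpD cexpN h mulfV // cexp_neq0.
case: (a - s) => x y.
rewrite -[twopii R * _]/(Complex (0 * x - 2 * pi * y) (0 * y + 2 * pi * x)).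
rewrite !mul0r sub0r add0r /cexp /= => -[h1 h2].
have p0 := pi_gt0 R.
have e1 : `|expR (- (2 * pi * y))| = 1.
  have : `|expR (- (2 * pi * y)) * cos (2 * pi * x)| ^+ 2 +
         `|expR (- (2 * pi * y)) * sin (2 * pi * x)| ^+ 2 = 1.
    by rewrite h1 h2 normr0 normr1 expr0n expr1n addr0.
  rewrite !normrM !exprMn !real_normK ?num_real // -mulrDr cos2Dsin2 mulr1.
  by move=> h; apply/eqP; rewrite -sqrp_eq1 ?normr_ge0 // real_normK ?num_real // h.
have y0 : y = 0.
  move: e1; rewrite ger0_norm ?expR_ge0 // -expR0 => /expR_inj/eqP.
  by rewrite oppr_eq0 mulf_eq0 gt_eqF ?mulr_gt0 //= => /eqP.
move: h1 h2; rewrite y0 mulr0 oppr0 expR0 !mul1r => hcos hsin.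
pose n := Num.floor x; pose x' := x - n%:~R.
have xn : 0 <= x' < 1.
  by rewrite /x' subr_ge0 ltrBlDl floor_le_tmp -intrD1 floorD1_gt.
exists n.
suff -> : x = n%:~R by rewrite -[LHS]/((n%:~R : R)%:C) rmorph_int.
apply/eqP; rewrite -subr_eq0; apply/negP => /negP xn0.
(* the fractional part x' of x has 1 = cos (2 pi x') = 1 - 2 sin^2 (pi x') *)
have hc : cos (2 * pi * x') = 1.
  have := cexp_twopii_int (- n).
  rewrite (_ : (- n)%:~R = (- n%:~R : R)%:C); last by rewrite -mulrNz rmorph_int.
  rewrite -[twopii R * _]/(Complex (0 * (- n%:~R) - 2 * pi * 0) (0 * 0 + 2 * pi * (- n%:~R))).
  rewrite !mul0r mulr0 subr0 add0r /cexp /= expR0 !mul1r => -[c1 s1].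
  by rewrite /x' mulrBr -mulrN cosD hcos hsin c1 s1 mul0r subr0 mulr1.
have hs2 : 0 < sin (pi * x').
  apply: sin_gt0_pi; rewrite mulr_gt0 //=; last by rewrite lt_neqAle eq_sym xn0; case/andP: xn.
  by rewrite -[ltRHS]mulr1 ltr_pM2l //; case/andP: xn.
move: hc; rewrite -mulrA mulr_natl cos_mulr2n => hc.
have := cos2Dsin2 (pi * x'); have := exprn_gt0 2 hs2; move: hc.
by rewrite mulr2n; lra.
Qed.

End ComplexExponential.

(** * Derivatives of complex valued functions of a real variable *)

Section ComplexDerivative.
Variable R : realType.
Local Notation C := R[i].
Implicit Types (z s a : C) (x y : R) (F G H : R -> C).

Lemma complex_ReM z s :
  complex.Re (z * s) = complex.Re z * complex.Re s - complex.Im z * complex.Im s.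
Proof. by case: z s => [? ?] [? ?]. Qed.
Lemma complex_ImM z s :
  complex.Im (z * s) = complex.Re z * complex.Im s + complex.Im z * complex.Re s.
Proof. by case: z s => [? ?] [? ?]. Qed.
Lemma complex_ReD z s : complex.Re (z + s) = complex.Re z + complex.Re s.
Proof. by case: z s => [? ?] [? ?]. Qed.
Lemma complex_ImD z s : complex.Im (z + s) = complex.Im z + complex.Im s.
Proof. by case: z s => [? ?] [? ?]. Qed.

Definition cderiv F G x :=
  is_derive x 1 (fun x => complex.Re (F x)) (complex.Re (G x)) /\
  is_derive x 1 (fun x => complex.Im (F x)) (complex.Im (G x)).

Lemma cderivD F G F' G' x : cderiv F F' x -> cderiv G G' x ->
  cderiv (fun x => F x + G x) (fun x => F' x + G' x) x.
Proof.
move=> [a b] [c d]; split.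
  rewrite complex_ReD (_ : (fun x => _) = (fun x => complex.Re (F x)) + (fun x => complex.Re (G x))).
    exact: is_deriveD.
  by apply: funext => y; rewrite complex_ReD.
rewrite complex_ImD (_ : (fun x => _) = (fun x => complex.Im (F x)) + (fun x => complex.Im (G x))).
  exact: is_deriveD.
by apply: funext => y; rewrite complex_ImD.
Qed.

Lemma cderivM F G F' G' x : cderiv F F' x -> cderiv G G' x ->
  cderiv (fun x => F x * G x) (fun x => F' x * G x + F x * G' x) x.
Proof.
move=> [a b] [c d]; split.
  rewrite (_ : (fun x => _) = (fun x => complex.Re (F x)) * (fun x => complex.Re (G x)) -
     (fun x => complex.Im (F x)) * (fun x => complex.Im (G x))).
    apply: is_derive_eq; rewrite complex_ReD !complex_ReM /GRing.scale /=; ring.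
  by apply: funext => y; rewrite complex_ReM.
rewrite (_ : (fun x => _) = (fun x => complex.Re (F x)) * (fun x => complex.Im (G x)) +
     (fun x => complex.Im (F x)) * (fun x => complex.Re (G x))).
  apply: is_derive_eq; rewrite complex_ImD !complex_ImM /GRing.scale /=; ring.
by apply: funext => y; rewrite complex_ImM.
Qed.

Lemma cderiv_cst z x : cderiv (fun=> z) (fun=> 0) x.
Proof. by split; exact: is_derive_cst. Qed.

Lemma cderiv_id x : cderiv (fun x => x%:C) (fun=> 1) x.
Proof. by split; [exact: is_derive_id | exact: is_derive_cst]. Qed.

Lemma cderiv_eq F G G' x : cderiv F G x -> G x = G' x -> cderiv F G' x.
Proof. by rewrite /cderiv => h <-. Qed.

Lemma cderiv_poly (p : {poly C}) x :
  cderiv (fun x => p.[x%:C]) (fun x => p^`().[x%:C]) x.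
Proof.
elim/poly_ind: p => [|p c IH].
  rewrite deriv0; under [fun x => _]funext do rewrite horner0.
  exact: cderiv_eq (cderiv_cst 0 x) _; rewrite horner0.
under [fun x => (_ + _).[_]]funext do rewrite hornerMXaddC.
apply: cderiv_eq (cderivD (cderivM IH (cderiv_id x)) (cderiv_cst c x)) _.
by rewrite derivD derivM derivX derivC !hornerE.
Qed.

Lemma cderiv_cexp a x : cderiv (fun x => cexp (a * x%:C)) (fun x => a * cexp (a * x%:C)) x.
Proof.
case: a => u v.
have E y : Complex u v * y%:C = Complex (u * y) (v * y).
  by rewrite -[LHS]/(Complex (u * y - v * 0) (u * 0 + v * y)) !mulr0 subr0 add0r.
have du : is_derive x 1 (fun y => u * y) u.
  by rewrite -[X in is_derive _ _ _ X]mulr1; apply: is_deriveZ.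
have dv : is_derive x 1 (fun y => v * y) v.
  by rewrite -[X in is_derive _ _ _ X]mulr1; apply: is_deriveZ.
have de := is_derive1_comp (is_derive_expR (u * x)) du.
have dc := is_derive1_comp (is_derive_cos (v * x)) dv.
have ds := is_derive1_comp (is_derive_sin (v * x)) dv.
rewrite /cderiv E /cexp /=; split.
  rewrite (_ : (fun x => _) = (expR \o (fun y => u * y)) * (cos \o (fun y => v * y))).
    apply: is_derive_eq; rewrite /= /GRing.scale /=; ring.
  by apply: funext => y /=; rewrite !mulr0 subr0 add0r.
rewrite (_ : (fun x => _) = (expR \o (fun y => u * y)) * (sin \o (fun y => v * y))).
  apply: is_derive_eq; rewrite /= /GRing.scale /=; ring.
by apply: funext => y /=; rewrite !mulr0 subr0 add0r.
Qed.

Lemma cderiv_ln1D x : -1 < x -> cderiv (fun x => (ln (1 + x))%:C) (fun x => ((1 + x)^-1)%:C) x.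
Proof.
move=> x1; split; last exact: is_derive_cst.
have dx : is_derive x 1 (fun y => 1 + y) 1.
  by rewrite -[X in is_derive _ _ _ X]add0r; apply: is_deriveD.
have h : 0 < 1 + x by rewrite -ltrBlDl sub0r.
have := is_derive1_comp (is_derive1_ln h) dx.
by rewrite mulr1.
Qed.

Lemma normC_le_ReIm z : `|z| <= (`|complex.Re z| + `|complex.Im z|)%:C.
Proof.
case: z => u v; have -> : Complex u v = u%:C + Complex 0 v.
  by rewrite -[RHS]/(Complex (u + 0) (0 + v)) addr0 add0r.
apply: le_trans (ler_normD _ _) _.
rewrite -[complex.Re _]/(u + 0) -[complex.Im _]/(0 + v) addr0 add0r rmorphD /=.
by rewrite lerD // ?norm_realC // normc_def /= expr0n /= add0r sqrtr_sqr.
Qed.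

(** The mean value theorem for the real and the imaginary part, whence the
    factor 2. *)
Lemma cderiv_bound F G (M : R) N :
  (forall x, 0 <= x < 1 -> cderiv F G x) -> F 0 = 0 ->
  (forall x, 0 < x < 1 -> `|G x| <= (M * x ^+ N)%:C) ->
  forall x, 0 < x < 1 -> `|F x| <= (2 * M * x ^+ N.+1)%:C.
Proof.
move=> dF F0 bG x /andP[x0 x1].
have M0 : 0 <= M.
  have := le_trans (normr_ge0 _) (bG x _); rewrite x0 x1 => /(_ isT).
  by rewrite (realC_le 0) pmulr_lge0 // exprn_gt0.
have key (f df : R -> R) : f 0 = 0 -> (forall y, 0 <= y < 1 -> is_derive y 1 f (df y)) ->
    (forall y, 0 < y < 1 -> `|df y| <= M * y ^+ N) -> `|f x| <= M * x ^+ N.+1.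
  move=> f0 ddf bdf.
  have [c|c|c] := @MVT R f df 0 x x0.
  - by rewrite in_itv /= => /andP[c0 cx]; apply: ddf; rewrite (ltW c0) (lt_trans cx).
  - apply: derivable_within_continuous => y; rewrite in_itv /= => /andP[y0 yx].
    by apply: ex_derive; apply: ddf; rewrite y0 (le_lt_trans yx).
  rewrite in_itv /= => /andP[c0 cx]; rewrite f0 !subr0 => ->.
  rewrite normrM (gtr0_norm x0) exprSr mulrA ler_wpM2r ?(ltW x0) //.
  apply: le_trans (bdf _ _) _; first by rewrite c0 (lt_trans cx).
  by rewrite ler_wpM2l // lerXn2r ?nnegrE ?(ltW c0) ?(ltW x0) // ltW.
have h1 : `|complex.Re (F x)| <= M * x ^+ N.+1.
  apply: (key (fun x => complex.Re (F x)) (fun x => complex.Re (G x))).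
  - by rewrite F0.
  - by move=> y /dF[].
  - by move=> y /bG h; rewrite -realC_le; apply: le_trans h; exact: normc_ge_Re.
have h2 : `|complex.Im (F x)| <= M * x ^+ N.+1.
  apply: (key (fun x => complex.Im (F x)) (fun x => complex.Im (G x))).
  - by rewrite F0.
  - by move=> y /dF[].
  - move=> y /bG h; rewrite -realC_le; apply: le_trans h.
    have := normc_ge_Re ((G y) * Complex 0 1).
    rewrite complex_ReM /= mulr0 mulr1 sub0r normrN normrM.
    by rewrite [X in _ <= _ * X]normc_def /= expr0n expr1n add0r sqrtr1 mulr1.
apply: le_trans (normC_le_ReIm _) _; rewrite realC_le.
by rewrite -mulrA mulr_natl mulr2n lerD.
Qed.

End ComplexDerivative.

(** * Asymptotic expansions at 0 from the right *)

Section AsymptoticExpansion.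
Variable R : realType.
Local Notation C := R[i].
Implicit Types (z s a : C) (x y : R) (F G H h : R -> C) (p q : {poly C}).

(** h(x) = p(x) + O(x^N) as x tends to 0 from the right. *)
Definition asym N h p := exists2 M : C, 0 <= M &
  forall x, 0 < x < 1/2 -> `|h x - p.[x%:C]| <= M * x%:C ^+ N.

Lemma small_real x : 0 < x < 1/2 -> 0 <= x%:C <= 1.
Proof.
move=> /andP[h1 h2]; rewrite (realC_le 0) (ltW h1) (realC_le x 1) ltW //.
by apply: lt_trans h2 _; lra.
Qed.

Lemma norm_small x : 0 < x < 1/2 -> `|x%:C| = x%:C.
Proof. by move=> /small_real/andP[h1 _]; rewrite ger0_norm. Qed.

Lemma poly_bounded p : exists2 B : C, 0 <= B &
  forall x, 0 < x < 1/2 -> `|p.[x%:C]| <= B.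
Proof.
exists (\sum_(i < size p) `|p`_i|); first exact: sumr_ge0.
move=> x hx; rewrite horner_coef; apply: le_trans (ler_norm_sum _ _ _) _.
apply: ler_sum => i _; rewrite normrM normrX norm_small // ler_piMr //.
by apply: exprn_ile1; case/andP: (small_real hx).
Qed.

Lemma asym_ext N h h' p : (forall x, 0 < x < 1/2 -> h x = h' x) ->
  asym N h p -> asym N h' p.
Proof. by move=> e [M M0 hM]; exists M => // x hx; rewrite -e // hM. Qed.

Lemma asym_poly N p : asym N (fun x => p.[x%:C]) p.
Proof. by exists 0 => // x hx; rewrite subrr normr0 mul0r. Qed.

Lemma asym_cst N z : asym N (fun=> z) z%:P.
Proof. by exists 0 => // x hx; rewrite hornerC subrr normr0 mul0r. Qed.

Lemma asym_bounded N h p : asym N h p -> exists2 B : C, 0 <= B &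
  forall x, 0 < x < 1/2 -> `|h x| <= B.
Proof.
move=> [M M0 hM]; have [B B0 hB] := poly_bounded p.
exists (M + B); first exact: addr_ge0.
move=> x hx; rewrite -[h x](subrK p.[x%:C]).
apply: le_trans (ler_normD _ _) (lerD _ (hB _ hx)).
apply: le_trans (hM _ hx) _; rewrite ler_piMr //.
by apply: exprn_ile1; case/andP: (small_real hx).
Qed.

Lemma asymD N h1 h2 p1 p2 : asym N h1 p1 -> asym N h2 p2 ->
  asym N (fun x => h1 x + h2 x) (p1 + p2).
Proof.
move=> [M M0 hM] [M' M'0 hM']; exists (M + M'); first exact: addr_ge0.
move=> x hx; rewrite hornerD opprD addrACA mulrDl.
by apply: le_trans (ler_normD _ _) (lerD (hM _ hx) (hM' _ hx)).
Qed.

Lemma asymM N h1 h2 p1 p2 : asym N h1 p1 -> asym N h2 p2 ->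
  asym N (fun x => h1 x * h2 x) (p1 * p2).
Proof.
move=> a1 a2; have [B B0 hB] := asym_bounded a1; have [B' B'0 hB'] := poly_bounded p2.
case: a1 a2 => [M M0 hM] [M' M'0 hM'].
exists (B * M' + M * B'); first by rewrite addr_ge0 ?mulr_ge0.
move=> x hx; have /andP[x0 _] := small_real hx.
have -> : h1 x * h2 x - (p1 * p2).[x%:C] =
   h1 x * (h2 x - p2.[x%:C]) + (h1 x - p1.[x%:C]) * p2.[x%:C] by rewrite hornerM; ring.
apply: le_trans (ler_normD _ _) _; rewrite !normrM mulrDl; apply: lerD.
  by rewrite -mulrA ler_pM ?normr_ge0 ?hB ?hM'.
by rewrite mulrAC ler_pM ?normr_ge0 ?hB' ?hM.
Qed.

Lemma asym_sum N K (h : 'I_K -> R -> C) (p : 'I_K -> {poly C}) :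
  (forall k, asym N (h k) (p k)) ->
  asym N (fun x => \sum_(k < K) h k x) (\sum_(k < K) p k).
Proof.
elim: K h p => [|K IH] h p hp.
  rewrite big_ord0 -polyC0; apply: asym_ext (asym_cst N 0) => x _.
  by rewrite big_ord0.
rewrite big_ord_recr /=; apply: asym_ext (asymD (IH _ _ (fun k => hp _)) (hp ord_max)) => x _.
by rewrite big_ord_recr.
Qed.

Lemma asymX N h p k : asym N h p -> asym N (fun x => h x ^+ k) (p ^+ k).
Proof.
move=> hp; elim: k => [|k IH]; first exact: (asym_cst N 1).
rewrite exprS; apply: asym_ext (asymM hp IH) => x _; exact/esym/exprS.
Qed.

Lemma asym_trunc N h p q : (forall i, (i < N)%N -> p`_i = q`_i) ->
  asym N h p -> asym N h q.
Proof.
move=> pq [M M0 hM].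
have e : p - q = drop_poly N (p - q) * 'X^N.
  rewrite -[LHS](poly_take_drop N) (_ : take_poly _ _ = 0) ?add0r //.
  apply/polyP => i; rewrite coef_take_poly coef0; case: ifP => // iN.
  by rewrite coefB pq // subrr.
have [B B0 hB] := poly_bounded (drop_poly N (p - q)).
exists (M + B); first exact: addr_ge0.
move=> x hx; have /andP[x0 _] := small_real hx.
have -> : h x - q.[x%:C] = (h x - p.[x%:C]) + (p - q).[x%:C].
  by rewrite hornerD hornerN; ring.
rewrite mulrDl; apply: le_trans (ler_normD _ _) (lerD (hM _ hx) _).
rewrite e hornerM hornerXn normrM normrX norm_small // ler_wpM2r ?hB //.
exact: exprn_ge0.
Qed.

Lemma cmod_ge0 z : 0 <= cmod z.
Proof. by rewrite -realC_le cmodE normr_ge0. Qed.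

Lemma le_small_eq0 z (K : C) : 0 <= K -> (forall x, 0 < x < 1/2 -> `|z| <= K * x%:C) -> z = 0.
Proof.
move=> K0 h; apply/eqP; rewrite -normr_eq0 -cmodE; apply/eqP.
have K0' : K = (complex.Re K)%:C by case: K K0 {h} => u v; rewrite lecE /= => /andP[/eqP -> _].
have k0 : 0 <= complex.Re K by rewrite -realC_le -K0'.
suff h0 : cmod z <= 0.
  by have -> : cmod z = 0 by apply/eqP; rewrite eq_le h0 cmod_ge0.
rewrite leNgt; apply/negP => c0.
pose x := Num.min (1/4) (cmod z / (2 * (complex.Re K + 1))).
have x0 : 0 < x.
  by rewrite lt_min; apply/andP; split; [lra | apply: divr_gt0 => //; lra].
have x1 : x < 1/2 by rewrite gt_min; apply/orP; left; lra.
have := h x; rewrite x0 x1 -cmodE K0' -rmorphM /= realC_le => /(_ isT).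
apply/negP; rewrite -ltNge.
have : x <= cmod z / (2 * (complex.Re K + 1)) by rewrite ge_min lexx orbT.
rewrite ler_pdivlMr; last by lra.
by nra.
Qed.

Lemma poly_small_eq0 N p (K : C) : 0 <= K ->
  (forall x, 0 < x < 1/2 -> `|p.[x%:C]| <= K * x%:C ^+ N) ->
  forall i, (i < N)%N -> p`_i = 0.
Proof.
move=> K0; elim: N p => // N IH p hr i iN.
elim/poly_ind: p hr => [|r c _] hr; first by rewrite coef0.
have c0 : c = 0.
  have [B B0 hB] := poly_bounded r.
  apply: (@le_small_eq0 _ (K + B)); first exact: addr_ge0.
  move=> x hx; have /andP[x0 x1] := small_real hx.
  have -> : c = (r * 'X + c%:P).[x%:C] - r.[x%:C] * x%:C by rewrite hornerMXaddC; ring.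
  apply: le_trans (ler_normB _ _) _; rewrite mulrDl; apply: lerD.
    apply: le_trans (hr _ hx) _; rewrite ler_wpM2l // exprS ler_piMr //.
    exact: exprn_ile1.
  by rewrite normrM norm_small // ler_wpM2r ?hB.
rewrite c0 coefD coefMX coefC; case: i iN => [|i] iN /=; first by rewrite addr0.
rewrite addr0; apply: IH => // x hx; have /andP[x0 x1] := hx.
have := hr _ hx; rewrite c0 addr0 hornerMX normrM norm_small // exprSr mulrA.
by rewrite ler_pM2r // (realC_lt 0).
Qed.

Lemma asym_uniq N h p q : asym N h p -> asym N h q ->
  forall i, (i < N)%N -> p`_i = q`_i.
Proof.
move=> [M M0 hM] [M' M'0 hM'] i iN; apply/eqP; rewrite -subr_eq0 -coefB; apply/eqP.
apply: (@poly_small_eq0 N _ (M + M')) => //; first exact: addr_ge0.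
move=> x hx.
have -> : (p - q).[x%:C] = (h x - q.[x%:C]) - (h x - p.[x%:C]) by rewrite hornerD hornerN; ring.
by rewrite mulrDl [leRHS]addrC; apply: le_trans (ler_normB _ _) (lerD (hM' _ hx) (hM _ hx)).
Qed.

Definition seriessum (F : nat -> C) s := forall e : C, 0 < e ->
  exists K0, forall K, (K0 <= K)%N -> `|\sum_(n < K) F n - s| < e.

(** The terms of index at least N are at most (2 x)^N times those of the
    series at 1/2, which converges absolutely. *)
Lemma asym_series (c : nat -> C) h (M : C) N :
  (forall K, \sum_(n < K) `|c n * (2^-1) ^+ n| <= M) ->
  (forall x, 0 < x < 1/2 -> seriessum (fun n => c n * x%:C ^+ n) (h x)) ->
  asym N h (\poly_(i < N) c i).
Proof.
move=> hM hS; have M0 : 0 <= M by have := hM 0; rewrite big_ord0.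
exists (M * 2 ^+ N); first by rewrite mulr_ge0 // exprn_ge0.
move=> x hx; have /andP[x0 x1] := hx; have /andP[y0 y1] := small_real hx.
apply/ler_addgt0Pr => e e0; have [K0 hK] := hS x hx e e0.
pose K := maxn K0 N; have /hK hK' : (K0 <= K)%N by rewrite leq_maxl.
have NK : (N <= K)%N by rewrite leq_maxr.
rewrite horner_poly.
have -> : h x - \sum_(i < N) c i * x%:C ^+ i =
   - (\sum_(n < K) c n * x%:C ^+ n - h x) + \sum_(N <= n < K) c n * x%:C ^+ n.
  rewrite -(big_mkord predT (fun n => c n * x%:C ^+ n)).
  rewrite -[X in _ = - (X - _) + _](big_mkord predT (fun n => c n * x%:C ^+ n)).
  by rewrite (big_cat_nat (leq0n N) NK) /=; ring.
rewrite [leRHS]addrC; apply: le_trans (ler_normD _ _) _.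
apply: lerD; first by rewrite normrN ltW.
apply: le_trans (ler_norm_sum _ _ _) _.
apply: le_trans (_ : (\sum_(N <= n < K) `|c n * 2^-1 ^+ n|) * (2 * x%:C) ^+ N <= _).
  rewrite mulr_suml; apply: ler_sum_nat => n /andP[Nn _].
  have e1 : x%:C = 2^-1 * (2 * x%:C) by rewrite mulrA mulVf ?mul1r // pnatr_eq0.
  rewrite {1}e1 exprMn mulrA normrM.
  have t0 : 0 <= 2 * x%:C by rewrite mulr_ge0.
  rewrite ler_wpM2l // normrX ger0_norm // ler_wiXn2l //.
  have -> : 2 * x%:C = (2 * x)%:C by rewrite rmorphM /= rmorph_nat.
  by rewrite (realC_le _ 1); lra.
rewrite exprMn mulrA ler_wpM2r ?exprn_ge0 // ler_wpM2r ?exprn_ge0 //.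
apply: le_trans (hM K); rewrite -(big_mkord predT (fun n => `|c n * 2^-1 ^+ n|)).
by rewrite (big_cat_nat (leq0n N) NK) /= lerDr sumr_ge0.
Qed.

(** The derivative of the remainder of order N + 1 is a times the remainder of
    order N. *)
Lemma cexp_taylor a N : exists2 M : R, 0 <= M & forall y, 0 < y < 1 ->
  `|cexp (a * y%:C) - \sum_(k < N) (a ^+ k / k`!%:R) * y%:C ^+ k| <= (M * y ^+ N)%:C.
Proof.
pose E N : {poly C} := \poly_(k < N) (a ^+ k / k`!%:R).
have hE n y : \sum_(k < n) (a ^+ k / k`!%:R) * y%:C ^+ k = (E n).[y%:C].
  by rewrite horner_poly.
elim: N => [|N [M M0 IH]].
  exists (expR `|complex.Re a|); first exact: expR_ge0.
  move=> y /andP[y0 y1]; rewrite big_ord0 subr0 norm_cexp expr0 mulr1 realC_le ler_expR.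
  rewrite complex_ReM /= mulr0 subr0; apply: le_trans (ler_norm _) _.
  by rewrite normrM (gtr0_norm y0) ler_piMr // ltW.
exists (2 * (cmod a * M)).
  by rewrite !mulr_ge0 // cmod_ge0.
move=> y hy; rewrite hE.
apply: (@cderiv_bound _ (fun y => cexp (a * y%:C) - (E N.+1).[y%:C])
   (fun y => a * cexp (a * y%:C) + (- E N.+1)^`().[y%:C]) _ N) => //.
- move=> x _; under [fun x => _ - _]funext do rewrite -hornerN.
  exact: cderivD (cderiv_cexp a x) (cderiv_poly _ x).
- rewrite mulr0 cexp0 horner_coef0 coef_poly /= fact0 expr0 divr1 subrr //.
move=> x hx; have /= := IH x hx; rewrite hE => h.
have -> : (- E N.+1)^`() = - (a *: E N).
  rewrite derivN; congr (- _); apply/polyP => i.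
  rewrite coef_deriv coefZ !coef_poly ltnS; case: ifP => // _; last by rewrite mul0rn mulr0.
  rewrite factS natrM exprS -mulr_natl.
  have h1 : (i.+1%:R : C) != 0 by rewrite pnatr_eq0.
  have h2 : (i`!%:R : C) != 0 by rewrite pnatr_eq0 -lt0n fact_gt0.
  by field; rewrite h2 nat1r h1.
rewrite hornerN hornerZ -mulrBr normrM -cmodE -mulrA rmorphM /= ler_wpM2l //.
by rewrite (realC_le 0) cmod_ge0.
Qed.

Lemma realCX x n : (x ^+ n)%:C = x%:C ^+ n.
Proof. exact: rmorphXn. Qed.

(** The derivative of the remainder is (- x)^N / (1 + x). *)
Lemma asym_ln1D N : asym N (fun x => (ln (1 + x))%:C) (log1p R N).
Proof.
have d y : 0 <= y < 1 -> cderiv (fun x => (ln (1 + x))%:C + (- log1p R N).[x%:C])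
   (fun x => ((1 + x)^-1)%:C + (- log1p R N)^`().[x%:C]) y.
  by move=> /andP[y0 _]; apply: cderivD (cderiv_ln1D _) (cderiv_poly _ y); lra.
have F0 : (ln (1 + 0))%:C + (- log1p R N).[(0 : R)%:C] = 0.
  by have [p ->] := log1p_factor R N; rewrite addr0 ln1 rmorph0 hornerN hornerM hornerX mul0r oppr0 addr0.
exists (2%:R : C) => // x /andP[x0 x1].
have h1 : 0 < x < 1 by rewrite x0 /=; lra.
have H := cderiv_bound (M := 1) (N := N) d F0.
have {H} : `|(ln (1 + x))%:C - (log1p R N).[x%:C]| <= (2 * 1 * x ^+ N.+1)%:C.
  rewrite -hornerN; apply: H => // y /andP[y0 y1].
  have -> : ((1 + y)^-1)%:C + (- log1p R N)^`().[y%:C] = (1 + y%:C)^-1 * (- y%:C) ^+ N.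
    have hy : 1 + y%:C != 0 by rewrite gt_eqF // ltr_wpDr // (realC_le 0) ltW.
    have := congr1 (fun p => p.[y%:C]) (deriv_log1p R N).
    rewrite derivN hornerN hornerM hornerD hornerX hornerC hornerD hornerN horner_exp.
    rewrite hornerN hornerX hornerC fmorphV rmorphD rmorph1 /=.
    move=> e; apply: (mulfI hy); rewrite mulrDr mulrN e mulfV // mulrA mulfV // mul1r.
    by ring.
  have -> : (1 * y ^+ N)%:C = y%:C ^+ N by rewrite mul1r realCX.
  rewrite normrM normfV normrX normrN (norm_realC y) (gtr0_norm y0).
  rewrite ger0_norm ?addr_ge0 // ?(realC_le 0) ?(ltW y0) // ler_piMl ?exprn_ge0 //.
    by rewrite (realC_le 0) ltW.
  by rewrite invf_le1 ?lerDl ?ltr_wpDr // (realC_le 0) ltW.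
move=> h; apply: le_trans h _.
rewrite mulr1 exprS rmorphM /= rmorph_nat ler_wpM2l // rmorphM /= rmorphXn /=.
by rewrite ler_piMl ?exprn_ge0 ?(realC_le 0) ?(realC_le _ 1) // ltW //; lra.
Qed.

Lemma ln1D_bnd x : 0 < x -> 0 < ln (1 + x) <= x.
Proof. by move=> x0; rewrite ln_gt0 ?ltrDl //= le_ln1Dx //; lra. Qed.

(** The binomial series: insert the expansion of log (1 + x) in the Taylor
    polynomial of the exponential. *)
Lemma asym_cexp_ln a N :
  asym N (fun x => cexp (a * (ln (1 + x))%:C)) (\poly_(i < N) binC a i).
Proof.
have [M M0 hM] := cexp_taylor a N.
have h : asym N (fun x => \sum_(k < N) (a ^+ k / k`!%:R) * (ln (1 + x))%:C ^+ k)
   (\sum_(k < N) (a ^+ k / k`!%:R)%:P * log1p R N ^+ k).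
  by apply: asym_sum => k; apply: asymM (asym_cst _ _) _; exact/asymX/asym_ln1D.
apply: (@asym_trunc _ _ (\sum_(k < N) (a ^+ k / k`!%:R)%:P * log1p R N ^+ k)).
  move=> i iN; rewrite coef_poly iN coef_sum -(exp_log1p a (ltnW iN) iN).
  by apply: eq_bigr => k _; rewrite coefCM.
case: h => [M' M'0 hM'].
exists (M%:C + M'); first by rewrite addr_ge0 // (realC_le 0).
move=> x hx; have /andP[x0 x1] := hx; have /andP[l0 l1] := ln1D_bnd x0.
have := hM' x hx; set S := (\sum_(k < N) _); set P := (\sum_(k < N) _) => h1.
have -> : cexp (a * (ln (1 + x))%:C) - P.[x%:C] =
   (cexp (a * (ln (1 + x))%:C) - S) + (S - P.[x%:C]) by ring.
rewrite mulrDl; apply: le_trans (ler_normD _ _) (lerD _ h1).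
apply: le_trans (hM _ _) _; first by rewrite l0; lra.
rewrite rmorphM rmorphXn /= ler_wpM2l ?(realC_le 0) //.
by rewrite lerXn2r ?nnegrE ?(realC_le 0) ?realC_le // ltW.
Qed.

End AsymptoticExpansion.

(** * Quasi-polynomials *)

Lemma partition_big_key (I J : eqType) (V : nmodType) (s : seq I) (E : seq J)
    (f : I -> J) (F : I -> V) : uniq E -> {subset map f s <= E} ->
  \sum_(i <- s) F i = \sum_(k <- E) \sum_(i <- s | f i == k) F i.
Proof.
move=> uE sE; under [RHS]eq_bigr do rewrite big_mkcond.
rewrite exchange_big; apply: eq_big_seq => i si.
rewrite (bigD1_seq (f i)) ?sE ?map_f //= eqxx big1 ?addr0 // => k.
by rewrite eq_sym => /negPf ->.
Qed.

Section QuasiPoly.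
Variable R : realType.
Local Notation C := R[i].
Implicit Types (z a m : C) (x y : R) (p q : {poly C}).

(** A quasi-polynomial, as the list of the exponents m and the coefficients p
    of its terms e^(m x) p(x). *)
Definition qp (s : seq (C * {poly C})) x : C :=
  \sum_(mp <- s) cexp (mp.1 * x%:C) * mp.2.[x%:C].

Lemma poly_eq0_inj (f : nat -> C) p : injective f -> (forall n, p.[f n] = 0) -> p = 0.
Proof.
move=> fI hp; apply: (@roots_geq_poly_eq0 _ p [seq f n | n <- iota 0 (size p)]).
- by apply/allP => z /mapP[n _ ->]; apply/rootP.
- by rewrite map_inj_uniq ?iota_uniq.
- by rewrite size_map size_iota.
Qed.

Lemma cexp_eq1_small z : `|z| < 1 -> cexp z = 1 -> z = 0.
Proof.
move=> z1 e; have e1 := @twopii_neq0 R.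
have [n] : exists n : int, z / twopii R - 0 = n%:~R.
  by apply: cexp_twopii_inj; rewrite mulr0 cexp0 mulrC divfK.
rewrite subr0 => /(canRL (divfK e1)) hz; move: z1; rewrite hz => z1.
have [->|n0] := eqVneq n 0; first by rewrite mul0r.
suff : (1 : C) < 1 by rewrite ltxx.
apply: le_lt_trans z1; rewrite normrM.
have h1 : (1 : C) <= `|n%:~R|.
  have -> : (n%:~R : C) = (n%:~R : R)%:C by rewrite rmorph_int.
  by rewrite norm_realC (realC_le 1) -intr_norm ler1z; lia.
apply: le_trans h1 _; rewrite ler_peMr //.
rewrite /twopii normc_def /= expr0n add0r sqrtr_sqr (realC_le 1) ger0_norm.
  by have := pi_ge2 R; lra.
by rewrite mulr_ge0 // pi_ge0.
Qed.

(** Solutions of e^z = 1 are isolated, so a small step avoids them. *)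
Lemma exists_step (D : seq C) : exists2 h : R, 0 < h &
  forall d, d \in D -> d != 0 -> cexp (d * h%:C) != 1.
Proof.
pose S := \sum_(d <- D) cmod d.
have S0 : 0 <= S by apply: sumr_ge0 => d _; exact: cmod_ge0.
exists (1 + S)^-1; first by rewrite invr_gt0 ltr_wpDr.
move=> d dD d0; apply/negP => /eqP /cexp_eq1_small h.
have hn : (1 + S)^-1%:C != 0 by rewrite gt_eqF // (realC_lt 0) invr_gt0 ltr_wpDr.
suff /h/eqP : `|d * (1 + S)^-1%:C| < 1 by rewrite mulf_eq0 (negPf d0) (negPf hn).
rewrite normrM -cmodE norm_realC -rmorphM (realC_lt _ 1) ger0_norm ?invr_ge0 ?addr_ge0 //.
have dS : cmod d <= S.
  by rewrite /S (big_rem d) //= lerDl; apply: sumr_ge0 => ? _; exact: cmod_ge0.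
rewrite ltr_pdivrMr ?mul1r; first by apply: le_lt_trans dS _; rewrite ltrDr.
by rewrite ltr_wpDr.
Qed.

Lemma cexp_not_small z m (B : R) (M : C) : B < complex.Re m ->
  (forall x, 1 <= x -> `|cexp (m * x%:C) * z| <= M * (expR (B * x))%:C) -> z = 0.
Proof.
move=> Bm h; pose e := complex.Re m - B; have e0 : 0 < e by rewrite subr_gt0.
have M0 : 0 <= M.
  have := le_trans (normr_ge0 _) (h 1 (lexx _)).
  by rewrite pmulr_lge0 // (realC_lt 0) expR_gt0.
have hx x : 1 <= x -> `|z| * (expR (e * x))%:C <= M.
  move=> x1; have := h x x1.
  rewrite normrM norm_cexp complex_ReM /= mulr0 subr0.
  have -> : complex.Re m * x = e * x + B * x by rewrite /e; ring.
  rewrite expRD rmorphM /= mulrAC [_ * `|z|]mulrC ler_pM2r //.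
  by rewrite (realC_lt 0) expR_gt0.
apply: (@le_small_eq0 _ _ (M / e%:C)).
  by rewrite divr_ge0 // (realC_le 0) ltW.
move=> x /andP[x0 x1].
have hy : 1 <= x^-1 by rewrite -invr1 lef_pV2 ?posrE //; lra.
have h2 : `|z| * (e / x)%:C <= M.
  apply: le_trans (hx _ hy); rewrite ler_wpM2l // realC_le.
  by apply: le_trans (expR_ge1Dx _); rewrite lerDr.
have -> : `|z| = `|z| * (e / x)%:C * (x / e)%:C.
  rewrite -mulrA -rmorphM /= mulrA divfK ?(gt_eqF x0) // divff ?(gt_eqF e0) //.
  by rewrite mulr1.
have -> : M / e%:C * x%:C = M * (x / e)%:C.
  by rewrite -mulrA; congr (_ * _); rewrite mulrC -fmorphV -rmorphM.
by rewrite ler_wpM2r // (realC_le 0) divr_ge0 // ltW.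
Qed.

(** The effect on one term of f(x) |-> f(x + h) - e^(m h) f(x).  This operator
    lowers the degree of the coefficient of e^(m x), and for a suitable h it
    annihilates no other coefficient. *)
Definition qp_step (h : R) m (mp : C * {poly C}) : C * {poly C} :=
  (mp.1, cexp (mp.1 * h%:C) *: (mp.2 \Po ('X + (h%:C)%:P)) - cexp (m * h%:C) *: mp.2).

Lemma qp_stepE h m s x : qp (map (qp_step h m) s) x =
  qp s (x + h) - cexp (m * h%:C) * qp s x.
Proof.
rewrite /qp big_map mulr_sumr -sumrB; apply: eq_bigr => -[m' p] _ /=.
rewrite hornerD hornerN !hornerZ horner_comp hornerD hornerX hornerC.
have -> : (x + h)%:C = x%:C + h%:C by rewrite rmorphD.
by rewrite [m' * (_ + _)]mulrDr cexpD; ring.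
Qed.

Lemma size_qp_step h m mp : (size (qp_step h m mp).2 <= size mp.2)%N.
Proof.
case: mp => m' p /=; apply: leq_trans (size_polyD _ _) _.
rewrite size_polyN geq_max; apply/andP; split; last exact: size_scale_leq.
by apply: leq_trans (size_scale_leq _ _) _; rewrite size_comp_poly2 // size_XaddC.
Qed.

Lemma lead_coef_shift (h : C) p : (p \Po ('X + h%:P))`_(size p).-1 = lead_coef p.
Proof.
have sz : size (p \Po ('X + h%:P)) = size p by rewrite size_comp_poly2 // size_XaddC.
by rewrite -sz -lead_coefE lead_coef_comp ?size_XaddC // lead_coefXaddC expr1n mulr1.
Qed.

Lemma size_qp_step_eq h m (p : {poly C}) : p != 0 ->
  (size (qp_step h m (m, p)).2 < size p)%N.
Proof.
move=> p0; rewrite /= -scalerBr.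
apply: leq_ltn_trans (size_scale_leq _ _) _.
have sp : (0 < size p)%N by rewrite size_poly_gt0.
rewrite -(prednK sp) ltnS; apply/leq_sizeP => j.
rewrite leq_eqVlt => /orP[/eqP <-|].
  by rewrite coefB lead_coef_shift -lead_coefE subrr.
rewrite prednK // => hj; rewrite coefB !nth_default ?subrr //.
by rewrite size_comp_poly2 // size_XaddC.
Qed.

Lemma qp_step_eq0 h m m' p : cexp ((m' - m) * h%:C) != 1 ->
  (qp_step h m (m', p)).2 = 0 -> p = 0.
Proof.
move=> hne /= e; apply/eqP; rewrite -lead_coef_eq0.
have := congr1 (fun q : {poly C} => q`_(size p).-1) e.
rewrite coefB !coefZ lead_coef_shift -lead_coefE coef0 -mulrBl => /eqP.
rewrite mulf_eq0 subr_eq0 => /orP[/eqP e2|//]; case/negP: hne.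
by rewrite mulrBl cexpD cexpN e2 mulfV // cexp_neq0.
Qed.

(** Induction on the sum of the degrees: the difference operator of a term
    that occurs reduces the sum to the case of a single constant coefficient,
    and e^(m x) is not O(e^(B x)). *)
Lemma qp_uniq_small_eq0 s (B : R) (M : C) : 0 <= M -> uniq (map fst s) ->
  (forall mp, mp \in s -> B < complex.Re mp.1) ->
  (forall x, 1 <= x -> `|qp s x| <= M * (expR (B * x))%:C) ->
  forall mp, mp \in s -> mp.2 = 0.
Proof.
have [n] := ubnP (\sum_(mp <- s) size mp.2)%N.
elim: n s M => // n IH s M sn M0 su sB hM.
have [/allP h|/allPn[[m p] ms p0]] := boolP (all (fun mp : C * {poly C} => mp.2 == 0) s).
  by move=> mp /h/eqP.
suff : False by [].
have [h h0 hh] := exists_step [seq m' - m | m' <- map fst s].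
(* the difference operator for m lowers the degree of p *)
have hz : forall mp, mp \in map (qp_step h m) s -> mp.2 = 0.
  apply: (IH _ (M * (expR (B * h))%:C + `|cexp (m * h%:C)| * M)).
  - rewrite big_map; rewrite ltnS in sn; apply: leq_trans sn.
    rewrite !(big_rem (m, p) ms) /= -addSn leq_add //; first exact: size_qp_step_eq.
    by apply: leq_sum => mp _; exact: size_qp_step.
  - by rewrite addr_ge0 ?mulr_ge0 // (realC_le 0) expR_ge0.
  - by rewrite -map_comp.
  - by move=> mp /mapP[mp' /sB hmp ->].
  - move=> x x1; rewrite qp_stepE; apply: le_trans (ler_normB _ _) _.
    rewrite mulrDl; apply: lerD.
      apply: le_trans (hM _ _) _; first by rewrite ler_wpDr // ltW.
      by rewrite -mulrA -rmorphM /= -expRD mulrDr addrC lexx.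
    by rewrite normrM -mulrA ler_wpM2l // hM.
have pz mp : mp \in s -> mp.1 != m -> mp.2 = 0.
  case: mp => m' q /= mq m'm; apply: (@qp_step_eq0 h m m').
    by apply: hh; rewrite ?subr_eq0 //; apply: map_f; apply: (map_f fst mq).
  exact: (hz _ (map_f _ mq)).
(* p is invariant under the translation by h *)
have pc : p = (p.[0])%:P.
  have := hz _ (map_f (qp_step h m) ms); rewrite /= -scalerBr => /eqP.
  rewrite scaler_eq0 (negPf (cexp_neq0 _)) /= => /eqP e.
  apply/eqP; rewrite -subr_eq0; apply/eqP.
  apply: (@poly_eq0_inj (fun k : nat => k%:R * h%:C)).
    move=> i j /mulIf e2; apply/eqP; rewrite -(eqr_nat C); apply/eqP/e2.
    by rewrite gt_eqF // (realC_lt 0).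
  elim=> [|k IHk]; first by rewrite mul0r !hornerE subrr.
  rewrite -[RHS]IHk !(hornerD, hornerN, hornerC); congr (_ - _).
  have := congr1 (fun q : {poly C} => q.[k%:R * h%:C]) e.
  rewrite hornerD hornerN horner_comp hornerD hornerX hornerC horner0 => /eqP.
  by rewrite subr_eq0 -natr1 mulrDl mul1r => /eqP.
have sE x : qp s x = cexp (m * x%:C) * p.[0].
  rewrite /qp (big_rem (m, p) ms) /= big1_seq ?addr0; first by rewrite {1}pc hornerC.
  move=> [m' q] /andP[_ mq]; rewrite (pz (m', q)) /= ?horner0 ?mulr0 //.
    exact: mem_rem mq.
  apply/negP => /eqP e; move: su mq; rewrite (perm_uniq (perm_map fst (perm_to_rem ms))) /=.
  by move=> /andP[/negP nm _] mq; apply: nm; have := map_f fst mq; rewrite /= e.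
have p00 : p.[0] = 0.
  apply: (@cexp_not_small _ m B M); first exact: (sB _ ms).
  by move=> x x1; rewrite -sE hM.
by move: p0; rewrite pc p00 eqxx.
Qed.

Lemma qp_small_eq0 s (B : R) (M : C) : 0 <= M ->
  (forall mp, mp \in s -> B < complex.Re mp.1) ->
  (forall x, 1 <= x -> `|qp s x| <= M * (expR (B * x))%:C) ->
  forall x, qp s x = 0.
Proof.
move=> M0 sB hM.
pose t := [seq (m, \sum_(mp <- s | mp.1 == m) mp.2) | m <- undup (map fst s)].
have tE x : qp t x = qp s x.
  rewrite /qp big_map (@partition_big_key _ _ _ s (undup (map fst s)) fst) ?undup_uniq //;
    last by move=> k; rewrite mem_undup.
  apply: eq_bigr => m _ /=.
  rewrite horner_sum mulr_sumr; apply: eq_bigr => mp /eqP <- //.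
move=> x; rewrite -tE /qp big1_seq // => mp /andP[_ mt].
rewrite (@qp_uniq_small_eq0 t B M M0 _ _ _ mp mt) ?horner0 ?mulr0 //.
- by rewrite -map_comp map_id undup_uniq.
- by move=> _ /mapP[m + ->] /=; rewrite mem_undup => /mapP[mp' ms ->]; exact: sB.
- by move=> y y1; rewrite tE hM.
Qed.

Lemma qp_cat s t x : qp (s ++ t) x = qp s x + qp t x.
Proof. by rewrite /qp big_cat. Qed.

(** Subtract the first N terms of the expansion: the result is a
    quasi-polynomial that decays faster than each of its exponentials, hence
    zero. *)
Lemma qp_asym s (c : nat -> C) :
  (forall N, asym N (fun r => qp s (- ln r)) (\poly_(i < N) c i)) ->
  exists N0, (forall n, (N0 <= n)%N -> c n = 0) /\
    forall x, qp s x = \sum_(n < N0) c n * cexp (- x%:C) ^+ n.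
Proof.
move=> hc.
pose t N : seq (C * {poly C}) := [seq (- n%:R, (- c n)%:P) | n <- iota 0 N].
have tE N x : qp (t N) x = - \sum_(n < N) c n * cexp (- x%:C) ^+ n.
  rewrite /qp big_map -[in RHS](big_mkord predT (fun n => c n * cexp (- x%:C) ^+ n)) -sumrN.
  rewrite /index_iota subn0; apply: eq_bigr => n _ /=.
  by rewrite hornerC mulNr -mulrN cexpMn; ring.
have [N0 hN0] : exists N0 : nat, forall mp, mp \in s -> - N0%:R < complex.Re mp.1.
  pose S := \sum_(mp <- s) `|complex.Re mp.1|.
  have S0 : 0 <= S by apply: sumr_ge0.
  exists (Num.bound S) => mp ms; rewrite ltrNl.
  have h1 : S < (Num.bound S)%:R by have := archi_boundP S0.
  apply: le_lt_trans h1; rewrite /S (big_rem mp) //=.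
  rewrite (le_trans (ler_norm _)) // normrN lerDl; exact: sumr_ge0.
have H N : (N0 <= N)%N -> forall x, qp s x = \sum_(n < N) c n * cexp (- x%:C) ^+ n.
  move=> NN x; apply/eqP; rewrite -subr_eq0 -tE -qp_cat; apply/eqP; move: x.
  have [M M0 hM] := hc N.
  apply: (@qp_small_eq0 _ (- N%:R) M) => //.
    move=> mp; rewrite mem_cat => /orP[/hN0|/mapP[n + ->]].
      by apply: le_lt_trans; rewrite lerN2 ler_nat.
    rewrite mem_iota => /andP[_ nN] /=.
    rewrite -[- n%:R]/(- (n%:R : C)) (_ : complex.Re _ = - n%:R) ?ltrN2 ?ltr_nat //.
    have -> : - (n%:R : C) = (- n%:R : R)%:C by rewrite rmorphN /= rmorph_nat.
    by [].
  move=> x x1; pose r := expR (- x).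
  have hr : 0 < r < 1 / 2.
    have h2 : 2 < expR x.
      by apply: le_lt_trans (expR_gt1Dx _); [lra | rewrite gt_eqF //; lra].
    by rewrite expR_gt0 /= /r expRN mul1r ltf_pV2 ?posrE ?expR_gt0.
  have := hM r hr; rewrite expRK opprK qp_cat tE horner_poly.
  have -> : r%:C = cexp (- x%:C) by rewrite /r -cexp_real rmorphN.
  move=> h; apply: le_trans h _; rewrite ler_wpM2l //.
  rewrite -cexpMn -cexp_real rmorphM rmorphN /= rmorph_nat mulNr mulrN lexx //.
exists N0; split; last exact: H.
move=> n hn; have := H n hn 0; have := H n.+1 (leqW hn) 0.
rewrite big_ord_recr /= => -> /eqP; rewrite -subr_eq0 addrAC subrr add0r.
by rewrite oppr0 cexp0 expr1n mulr1 => /eqP.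
Qed.

End QuasiPoly.

(** * The residue theorem on the positive half-line *)

Section PositiveHalfLine.
Variable R : realType.
Local Notation C := R[i].
Implicit Types (z a m : C) (x y : R) (p q : {poly C}).

Definition seriesabs (F : nat -> C) := exists M : C, forall K, \sum_(n < K) `|F n| <= M.

Lemma seriessum_scale F s z : seriessum F s -> seriessum (fun n => z * F n) (z * s).
Proof.
move=> hF e e0; have z1 : 0 < `|z| + 1 by rewrite ltr_wpDl.
have [K0 hK] := hF (e / (`|z| + 1)) (divr_gt0 e0 z1).
exists K0 => K /hK h; rewrite -mulr_sumr -mulrBr normrM.
apply: le_lt_trans (_ : (`|z| + 1) * `|\sum_(n < K) F n - s| < _).
  by rewrite ler_wpM2r // lerDl.
by rewrite mulrC -ltr_pdivlMr.
Qed.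

Lemma seriessum_ext (F G : nat -> C) s : (forall n, F n = G n) -> seriessum F s -> seriessum G s.
Proof. by move=> /funext ->. Qed.

Lemma iter_shiftdiff_top t (c : int -> C) (n0 : int) : (forall n, n0 < n -> c n = 0) ->
  forall n, n0 + t%:Z < n -> iter t (@shiftdiff R) c n = 0.
Proof.
move=> c0; elim: t => [|t IH] n hn; first by apply: c0; rewrite addr0 in hn.
by rewrite iterS /shiftdiff !IH ?subrr //; lia.
Qed.

Lemma iter_shiftdiff_bot t (c : int -> C) (n0 : int) : (forall n, n < n0 -> c n = 0) ->
  forall n, n < n0 -> iter t (@shiftdiff R) c n = 0.
Proof.
move=> c0; elim: t => [|t IH] n hn; first exact: c0.
by rewrite iterS /shiftdiff !IH ?subrr //; lia.
Qed.

(** The series c, bounded above by n0, is a power series in 1 / z up to the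
    factor z^n0, and its product with (1 - 1 / z)^t can be computed on
    truncations. *)
Lemma coef_poly_shiftdiff_top N t (c : int -> C) (n0 : int) :
  (forall n, n0 < n -> c n = 0) -> forall i, (i < N)%N ->
  ((1 - 'X) ^+ t * \poly_(j < N) c (n0 - j%:Z))`_i = iter t (@shiftdiff R) c (n0 + t%:Z - i%:Z).
Proof.
move=> c0; elim: t => [|t IH] i iN; first by rewrite expr0 mul1r coef_poly iN addr0.
rewrite exprS -mulrA mulrBl mul1r coefB coefXM (IH i iN).
rewrite iterS {1}/shiftdiff; congr (iter t _ c _ - _); first by lia.
case: i iN => [|i] iN /=; first by rewrite (iter_shiftdiff_top c0) //; lia.
by rewrite (IH i (ltnW iN)); congr (iter t _ c _); lia.
Qed.

Lemma coef_poly_shiftdiff_bot N t (d : int -> C) (n1 : int) :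
  (forall n, n < n1 -> d n = 0) -> forall i, (i < N)%N ->
  (('X - 1) ^+ t * \poly_(j < N) d (n1 + j%:Z))`_i = iter t (@shiftdiff R) d (n1 + i%:Z).
Proof.
move=> d0; elim: t => [|t IH] i iN; first by rewrite expr0 mul1r coef_poly iN.
rewrite exprS -mulrA mulrBl mul1r coefB coefXM (IH i iN).
rewrite iterS {1}/shiftdiff; congr (_ - _).
case: i iN => [|i] iN /=; first by rewrite (iter_shiftdiff_bot _ d0) //; lia.
by rewrite (IH i (ltnW iN)); congr (iter t _ d _); lia.
Qed.

Section ThreeExpansions.
Variables (alpha : C) (c d : int -> C) (J : nat) (b : nat -> int -> C).
Variables (s : seq (C * {poly C})) (t : nat) (F : nat -> R -> C).
Hypothesis c_top : exists n0 : int, forall n, n0 < n -> c n = 0.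
Hypothesis d_bot : exists n1 : int, forall n, n < n1 -> d n = 0.
Hypothesis b_bot : forall j (n : int), n < - t.+1%:Z -> b j n = 0.
Hypothesis sum_c : forall x (n0 : int), 0 < x -> (forall n, n0 < n -> c n = 0) ->
  let f := fun k : nat => c (n0 - k%:Z) * cexp (((n0 - k%:Z)%:~R - alpha) * x%:C) in
  seriesabs f /\ seriessum f (qp s x / (cexp x%:C - 1) ^+ t.+1).
Hypothesis sum_d : forall x (n1 : int), x < 0 -> (forall n, n < n1 -> d n = 0) ->
  let f := fun k : nat => d (n1 + k%:Z) * cexp (((n1 + k%:Z)%:~R - alpha) * x%:C) in
  seriesabs f /\ seriessum f (qp s x / (cexp x%:C - 1) ^+ t.+1).
Hypothesis sum_b : forall j x, 0 < x < 1 ->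
  let f := fun k : nat => b j (k%:Z - t.+1%:Z) * x%:C ^+ k in
  seriesabs f /\ seriessum f (F j x).
Hypothesis sum_F : forall x, 0 < x < 1 ->
  \sum_(j < J) ((ln (1 + x))%:C ^+ j / j`!%:R) * F j x = qp s (ln (1 + x)).

Lemma qp_shift a x : cexp (a * x%:C) * qp s x =
  qp [seq (a + mp.1, mp.2) | mp <- s] x.
Proof.
rewrite /qp big_map mulr_sumr; apply: eq_bigr => mp _ /=.
by rewrite mulrDl cexpD mulrA.
Qed.

(** As z = e^x tends to infinity, the series c provides the asymptotic
    expansion in powers of 1 / z required by [qp_asym]. *)
Lemma qp_laurent : exists K (a : nat -> C) (kappa : nat -> int),
  (forall x, qp s x = \sum_(k < K) a k * cexp (((kappa k)%:~R - alpha) * x%:C)) /\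
  (iter t.+1 (@shiftdiff R) c = fun n => \sum_(k < K) a k * (n - kappa k == 0)%:R).
Proof.
have [n0 c0] := c_top; set T := t.+1.
pose a (k : nat) := iter T (@shiftdiff R) c (n0 + T%:Z - k%:Z).
(* the top exponent n0 + T - alpha of (z - 1)^T c is moved to 0, and r = 1 /
   z *)
pose beta := alpha - n0%:~R - T%:R.
pose s' := [seq (beta + mp.1, mp.2) | mp <- s].
have s'E x : qp s' x = cexp (beta * x%:C) * qp s x by rewrite qp_shift.
have ha N : asym N (fun r => qp s' (- ln r)) (\poly_(i < N) a i).
  pose h r := cexp ((alpha - n0%:~R) * (- ln r)%:C) * (qp s (- ln r) / (cexp (- ln r)%:C - 1) ^+ T).
  have cE x k : 0 < x -> cexp ((alpha - n0%:~R) * x%:C) * (c (n0 - k%:Z) * cexp (((n0 - k%:Z)%:~R - alpha) * x%:C)) =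
      c (n0 - k%:Z) * (expR (- x))%:C ^+ k.
    move=> x0; rewrite mulrCA -cexpD; congr (_ * _).
    rewrite -cexp_real -cexpMn; congr cexp.
    rewrite intrB rmorphN /= -[k%:Z%:~R]/(k%:R : C); ring.
  have h1 : asym N h (\poly_(i < N) c (n0 - i%:Z)).
    have l2 : 0 < ln (2 : R) by rewrite ln_gt0 // ltr1n.
    have [[M hM] _] := sum_c l2 c0.
    apply: (@asym_series _ _ h (`|cexp ((alpha - n0%:~R) * (ln 2)%:C)| * M)).
      move=> K; apply: le_trans (ler_wpM2l (normr_ge0 _) (hM K)).
      rewrite mulr_sumr; apply: ler_sum => k _; rewrite -normrM cE //.
      by rewrite expRN lnK ?posrE // fmorphV rmorph_nat.
    move=> x /andP[x0 x1]; have lx : 0 < - ln x by rewrite oppr_gt0 ln_lt0 // x0 /=; lra.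
    have [_ /(seriessum_scale (cexp ((alpha - n0%:~R) * (- ln x)%:C)))] := sum_c lx c0.
    by apply: seriessum_ext => k; rewrite cE // opprK lnK ?posrE.
  have h2 : asym N (fun r => (1 - r%:C) ^+ T * h r) ((1 - 'X) ^+ T * \poly_(i < N) c (n0 - i%:Z)).
    apply: asymM h1; apply: asymX.
    by apply: asym_ext (asym_poly N (1 - 'X)) => x _; rewrite !hornerE.
  apply: asym_trunc (asym_ext _ h2).
    by move=> i iN; rewrite coef_poly_shiftdiff_top // coef_poly iN.
  move=> x /andP[x0 x1]; rewrite s'E /h.
  have -> : cexp (- ln x)%:C = x%:C^-1 by rewrite cexp_real expRN lnK ?posrE // fmorphV.
  have xn : x%:C != 0 by rewrite gt_eqF // (realC_lt 0).
  have xn1 : 1 - x%:C != 0 by rewrite subr_eq0 gt_eqF // (realC_lt _ 1); lra.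
  have -> : x%:C^-1 - 1 = (1 - x%:C) / x%:C by rewrite mulrBl mul1r divff.
  rewrite expr_div_n invf_div mulrCA [X in _ * X]mulrCA.
  have -> : cexp (beta * (- ln x)%:C) = cexp ((alpha - n0%:~R) * (- ln x)%:C) * x%:C ^+ T.
    rewrite -{3}[x]lnK ?posrE // -cexp_real -cexpMn -cexpD; congr cexp.
    by rewrite /beta rmorphN /=; ring.
  have : (1 - x%:C) ^+ T != 0 by rewrite expf_neq0.
  move: ((1 - x%:C) ^+ T) => w w0; field; exact: w0.
have [K [aK sK]] := qp_asym ha.
exists K, a, (fun k => n0 + T%:Z - k%:Z); split.
  move=> x; have := sK x; rewrite s'E => /(congr1 (fun z => cexp (- beta * x%:C) * z)).
  rewrite mulrA -cexpD mulNr addNr cexp0 mul1r => ->.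
  rewrite mulr_sumr; apply: eq_bigr => k _; rewrite mulrCA; congr (_ * _).
  rewrite -cexpMn -cexpD; congr cexp; rewrite /beta intrB intrD -![_%:Z%:~R]/(_%:R : C).
  ring.
apply: funext => n.
have [nn|nn] := ltP (n0 + T%:Z) n.
  rewrite (iter_shiftdiff_top c0 nn) big1 // => k _.
  by rewrite [_ == 0](_ : _ = false) ?mulr0 //; lia.
have [k nk] : exists k : nat, n = n0 + T%:Z - k%:Z by exists (absz (n0 + T%:Z - n)%R); lia.
rewrite nk -/(a k); have [kK|Kk] := ltnP k K.
  rewrite (bigD1 (Ordinal kK)) //= subrr eqxx mulr1 big1 ?addr0 // => i ik.
  rewrite [_ == 0](_ : _ = false) ?mulr0 //.
  by apply/negP => e; case/negP: ik; rewrite -val_eqE /=; lia.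
rewrite aK // big1 // => i _; rewrite [_ == 0](_ : _ = false) ?mulr0 //.
by have := ltn_ord i; lia.
Qed.

(** With z = e^x and Phi the quasi-polynomial of s, the hypotheses say that
    the series of c and d, times z^(- alpha), represent Phi / (z - 1)^(t + 1)
    for z > 1 and z < 1, and that the b_j do so near z = 1 when weighted by
    log (z)^j / j!.  As z^alpha Phi is a Laurent polynomial, this is
    [residue_at_one]; the expansion at 1 is identified by the uniqueness of
    asymptotic expansions. *)
Lemma twisted_residue (n : int) T : (t < T)%N ->
  c (- 1 - n) - d (- 1 - n) = \sum_(i < T) binC n%:~R i *
    \sum_(q < T) \sum_(j < J) powlog1pc alpha j q * b j (- 1 - i%:Z - q%:Z).
Proof.
move=> tT; have [n0 c0] := c_top; have [n1' d0'] := d_bot.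
have [K [a [kappa [sE cE]]]] := qp_laurent.
have [n1 d0 n1k] : exists2 n1 : int, (forall n, n < n1 -> d n = 0) & forall k : 'I_K, n1 <= kappa k.
  exists (Num.min n1' (- \sum_(k < K) `|kappa k|)).
    by move=> m; rewrite lt_min => /andP[/d0'].
  move=> k; rewrite ge_min; apply/orP; right; rewrite lerNl (bigD1 k) //=.
  by apply: le_trans (ler_norm _) _; rewrite normrN lerDl; exact: sumr_ge0.
(* the expansion of z^alpha Phi / (z - 1)^(t + 1) in powers of z - 1 *)
pose bb (m : int) := if m < - t.+1%:Z then 0 else
   \sum_(q < (absz (m + t.+1%:Z)%R).+1) \sum_(j < J) powlog1pc alpha j q * b j (m - q%:Z).
have bbE (i : nat) : \sum_(q < T) \sum_(j < J) powlog1pc alpha j q * b j (- 1 - i%:Z - q%:Z) = bb (- 1 - i%:Z).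
  rewrite /bb; case: ifP => hi.
    rewrite big1 // => q _; rewrite big1 // => j _; rewrite b_bot ?mulr0 //; lia.
  have hle : ((absz (- 1 - i%:Z + t.+1%:Z)%R).+1 <= T)%N by lia.
  rewrite -(subnKC hle) big_split_ord /= [X in _ + X]big1 ?addr0 //.
  move=> q _; rewrite big1 // => j _; rewrite b_bot ?mulr0 //; lia.
rewrite (residue_at_one (a := a) (kappa := kappa) (b := bb) (K := K) c0 d0 _ _ _ _ n tT) //.
- by apply: eq_bigr => i _; rewrite bbE.
(* the expansion d at 0 is found like that at infinity, with z tending to 0 *)
- apply: funext => m; have [mn|mn] := ltP m n1.
    rewrite (iter_shiftdiff_bot _ d0 mn) big1 // => k _; rewrite [_ == 0](_ : _ = false) ?mulr0 //.
    by have := n1k k; lia.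
  have [i mi] : exists i : nat, m = n1 + i%:Z by exists (absz (m - n1)); lia.
  pose N := i.+1; pose T' := t.+1.
  pose h (z : R) := \sum_(k < K) a k * z%:C ^+ (absz (kappa k - n1)%R).
  have zE (z : R) : 0 < z -> cexp ((alpha - n1%:~R) * (ln z)%:C) * qp s (ln z) = h z.
    move=> z0; rewrite sE mulr_sumr; apply: eq_bigr => k _; rewrite mulrCA; congr (_ * _).
    rewrite -cexpD -{3}[z]lnK ?posrE // -cexp_real -cexpMn; congr cexp.
    have -> : ((absz (kappa k - n1)%R)%:R : C) = (kappa k - n1)%:~R.
      by rewrite -[_%:R]/(_%:Z%:~R) gez0_abs // subr_ge0.
    rewrite intrB; ring.
  have dE x k : cexp ((alpha - n1%:~R) * x%:C) * (d (n1 + k%:Z) * cexp (((n1 + k%:Z)%:~R - alpha) * x%:C)) =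
      d (n1 + k%:Z) * (expR x)%:C ^+ k.
    rewrite mulrCA -cexpD; congr (_ * _).
    rewrite -cexp_real -cexpMn; congr cexp.
    rewrite intrD -[k%:Z%:~R]/(k%:R : C); ring.
  pose D (z : R) := cexp ((alpha - n1%:~R) * (ln z)%:C) * (qp s (ln z) / (cexp (ln z)%:C - 1) ^+ T').
  have h1 : asym N D (\poly_(k < N) d (n1 + k%:Z)).
    have l2 : - ln (2 : R) < 0 by rewrite oppr_lt0 ln_gt0 // ltr1n.
    have [[M hM] _] := sum_d l2 d0.
    apply: (@asym_series _ _ D (`|cexp ((alpha - n1%:~R) * (- ln 2)%:C)| * M)).
      move=> k; apply: le_trans (ler_wpM2l (normr_ge0 _) (hM k)).
      rewrite mulr_sumr; apply: ler_sum => l _; rewrite -normrM dE //.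
      by rewrite expRN lnK ?posrE // fmorphV rmorph_nat.
    move=> x /andP[x0 x1]; have lx : ln x < 0 by rewrite ln_lt0 // x0 /=; lra.
    have [_ /(seriessum_scale (cexp ((alpha - n1%:~R) * (ln x)%:C)))] := sum_d lx d0.
    by apply: seriessum_ext => k; rewrite dE // lnK ?posrE.
  have h2 : asym N (fun z : R => (z%:C - 1) ^+ T' * D z) (('X - 1) ^+ T' * \poly_(k < N) d (n1 + k%:Z)).
    apply: asymM h1; apply: asymX.
    by apply: asym_ext (asym_poly N ('X - 1)) => x _; rewrite !hornerE.
  have h3 : asym N (fun z : R => (z%:C - 1) ^+ T' * D z) (\sum_(k < K) (a k)%:P * 'X^(absz (kappa k - n1)%R)).
    apply: (@asym_ext _ _ h); last first.
      apply: asym_sum => k; apply: asymM (asym_cst _ _) _.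
      by apply: asym_ext (asym_poly N 'X^_) => x _; rewrite hornerXn.
    move=> x /andP[x0 x1]; rewrite -zE // /D cexp_real lnK ?posrE // mulrCA; congr (_ * _).
    rewrite mulrC divfK // expf_neq0 // subr_eq0 lt_eqF // (realC_lt _ 1); lra.
  have := asym_uniq h2 h3 (ltnSn i); rewrite coef_poly_shiftdiff_bot // -mi => ->.
  rewrite coef_sum; apply: eq_bigr => k _; rewrite coefCM coefXn; congr (_ * _%:R).
  by rewrite mi; have := n1k k; lia.
- by move=> m mt; rewrite /bb mt.
(* both sides are coefficients of asymptotic expansions of z^alpha Phi at z =
   1 + x *)
move=> m; rewrite /bb ifF; last by lia.
have -> : absz (m%:Z - t.+1%:Z + t.+1%:Z)%R = m by lia.
pose N := m.+1.
have h1 : asym N (fun x => \sum_(j < J) cexp (alpha * (ln (1 + x))%:C) *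
      (((ln (1 + x))%:C ^+ j * (j`!%:R)^-1) * F j x))
    (\sum_(j < J) (\poly_(i < N) binC alpha i) * (log1p R N ^+ j * ((j`!%:R)^-1)%:P *
       \poly_(k < N) b j (k%:Z - t.+1%:Z))).
  apply: asym_sum => j; apply: asymM (asym_cexp_ln _ _) _; apply: asymM.
    exact: asymM (asymX _ (asym_ln1D _ _)) (asym_cst _ _).
  have h2 : 0 < (2^-1 : R) < 1 by rewrite invr_gt0 /=; lra.
  have [[M hM] _] := sum_b j h2.
  apply: (@asym_series _ _ _ M).
    move=> k; have := hM k; by rewrite fmorphV rmorph_nat.
  move=> x /andP[x0 x1]; have hx : 0 < x < 1 by rewrite x0 /=; lra.
  by have [_] := sum_b j hx.
have h2 : asym N (fun x => \sum_(j < J) cexp (alpha * (ln (1 + x))%:C) *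
      (((ln (1 + x))%:C ^+ j * (j`!%:R)^-1) * F j x))
    (\sum_(k < K) (a k)%:P * \poly_(i < N) binC (kappa k)%:~R i).
  apply: (@asym_ext _ _ (fun x => \sum_(k < K) a k * cexp ((kappa k)%:~R * (ln (1 + x))%:C))).
    move=> x /andP[x0 x1]; have hx : 0 < x < 1 by rewrite x0 /=; lra.
    rewrite -mulr_sumr sum_F // sE mulr_sumr; apply: eq_bigr => k _; rewrite mulrCA.
    by rewrite -cexpD; congr (_ * cexp _); ring.
  by apply: asym_sum => k; exact: asymM (asym_cst _ _) (asym_cexp_ln _ _).
have := asym_uniq h1 h2 (ltnSn m); rewrite !coef_sum => e.
transitivity (\sum_(k < K) ((a k)%:P * \poly_(i < N) binC (kappa k)%:~R i)`_m); last first.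
  by apply: eq_bigr => k _; rewrite coefCM coef_poly ltnSn.
rewrite -e exchange_big /=; apply: eq_bigr => j _.
rewrite mulrA coefM; apply: eq_bigr => q _.
have qm : (q <= m)%N by rewrite -ltnS.
rewrite coef_poly ltnS leq_subr; congr (_ * b j _); last by lia.
rewrite mulrA coefMC /powlog1pc -mulr_suml coefM; congr (_ / _); apply: eq_bigr => i _.
have iq : (i <= q)%N by rewrite -ltnS.
rewrite coef_poly ltnS (leq_trans iq qm); congr (_ * _).
by rewrite log1pcE // (leq_trans (leq_subr _ _)) // (leq_trans qm).
Qed.

End ThreeExpansions.
End PositiveHalfLine.

(** * Functionals, gradings and generalized eigenvectors *)

Local Open Scope classical_set_scope.

Definition mklin (K : nzRingType) (V W : lmodType K) (f : V -> W) (hf : linear f) :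
  {linear V -> W} := HB.pack f (GRing.isLinear.Build K V W *:%R f hf).

(** A subspace that is maximal among those not containing x is a complement of
    K x, by Zorn's lemma; the functional is the coefficient of x. *)
Lemma functional_neq0 (K : fieldType) (V : lmodType K) (x : V) : x != 0 ->
  exists phi : {scalar V}, phi x != 0.
Proof.
move=> x0.
pose P (A : set V) := (forall a u v, A u -> A v -> A (a *: u + v)) /\ ~ A x.
have [F FP Ftot|A [[Alin Ax] Amax]] := @Zorn_bigcup V P.
  split; last by move=> [B FB Bx]; case: (FP _ FB).
  move=> a u v [B FB Bu] [B' FB' Bv].
  have [h|h] := Ftot _ _ FB FB'.
    by exists B' => //; apply: (FP _ FB').1 => //; exact: h.
  by exists B => //; apply: (FP _ FB).1 => //; exact: h.
have A0 : A 0.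
  apply: contrapT => nA0; apply: (Amax [set 0]).
    split; last by move=> h; apply: nA0; exact: h.
    move=> u Au; have := Alin (-1) u u Au Au; by rewrite scaleN1r addNr.
  split; first by move=> a u v -> ->; rewrite scaler0 addr0.
  by move/eqP; apply/negP.
have AZ a u : A u -> A (a *: u) by move=> Au; have := Alin a u 0 Au A0; rewrite addr0.
(* by maximality A + K y contains x unless y lies in A *)
have key y : exists c, A (y - c *: x).
  have [Ay|nAy] := pselect (A y); first by exists 0; rewrite scale0r subr0.
  have : ~ P [set z | exists a, exists2 u, A u & z = a *: y + u].
    apply: Amax; split.
      by move=> u Au; exists 0; exists u => //; rewrite scale0r add0r.
    move=> h; apply: nAy; apply: h; exists 1; exists 0 => //.
    by rewrite scale1r addr0.
  move=> nP; have [a [u Au xE]] : exists a, exists2 u, A u & x = a *: y + u.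
    apply: contrapT => nx; apply: nP; split => // c _ _ [a [u Au ->]] [a' [u' Au' ->]].
    exists (c * a + a'); exists (c *: u + u'); first exact: Alin.
    by rewrite scalerDr scalerA scalerDl addrACA.
  have a0 : a != 0.
    by apply/negP => /eqP a0; apply: Ax; rewrite xE a0 scale0r add0r.
  exists a^-1; rewrite xE scalerDr scalerA mulVf // scale1r opprD addNKr.
  by rewrite -scaleN1r scalerA; exact: AZ.
have uniq_c y c c' : A (y - c *: x) -> A (y - c' *: x) -> c = c'.
  move=> h h'; have := Alin (-1) _ _ h h'.
  rewrite scaleN1r opprB [X in A X](_ : _ = (c - c') *: x); last first.
    by rewrite scalerBl addrA subrK.
  have [->//|cc'] := eqVneq c c'; move=> /(AZ (c - c')^-1).
  by rewrite scalerA mulVf ?subr_eq0 // scale1r => /Ax.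
pose phi y := projT1 (cid (key y)).
have phiP y : A (y - phi y *: x) by rewrite /phi; case: cid.
have lin : linear_for *%R phi.
  move=> a u v; apply: (@uniq_c (a *: u + v)) => //.
  have := Alin a _ _ (phiP u) (phiP v).
  by rewrite scalerBr scalerA addrACA -opprD -scalerDl.
pose f : {scalar V} := HB.pack phi (GRing.isLinear.Build K V K *%R phi lin).
exists f; rewrite /= (_ : phi x = 1) ?oner_eq0 //.
by apply: (@uniq_c x) => //; rewrite scale1r subrr.
Qed.

Lemma functional_sep (K : fieldType) (V : lmodType K) (x y : V) :
  (forall phi : {scalar V}, phi x = phi y) -> x = y.
Proof.
move=> h; apply/eqP; rewrite -subr_eq0; apply: contrapT => /negP /functional_neq0 [phi].
by move/negP; apply; rewrite linearB subr_eq0; apply/eqP/h.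
Qed.

Section GradingTheory.
Variables (K : fieldType) (V : lmodType K) (I : choiceType) (G : grading V I).

Lemma grading_decomp v : exists s : seq I, v = \sum_(i <- s) gproj G i v.
Proof.
rewrite -[in X in exists s, X = _](gproj_sum G v).
by eexists; rewrite unlock; reflexivity.
Qed.

Lemma grading_eq u v : (forall i, gproj G i u = gproj G i v) -> u = v.
Proof.
move=> h; rewrite -(gproj_sum G u) -(gproj_sum G v).
by apply: eq_fsbigr => i _; exact: h.
Qed.

Lemma gproj_idem i v : gproj G i (gproj G i v) = gproj G i v.
Proof. by rewrite gproj_proj eqxx. Qed.

Lemma graded_dual_comp (phi : {scalar V}) i : graded_dual G (phi \o gproj G i).
Proof.
apply: (@sub_finite_set _ _ [set i]); last exact: finite_set1.
move=> j [v]; rewrite /= gproj_proj; case: (i =P j) => [->//|_].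
by rewrite linear0 eqxx.
Qed.

End GradingTheory.

Section GenEigen.
Variables (K : fieldType) (V : lmodType K) (A : {linear V -> V}).

Definition eigshift (e : K) (x : V) : V := A x - e *: x.
Definition geneigen (e : K) (x : V) := exists k, iter k (eigshift e) x = 0.

Lemma eigshift_linear e : linear (eigshift e).
Proof.
move=> a u v; rewrite /eigshift linearP scalerBr scalerDr opprD addrACA; congr (_ + _ + (_ + _)).
by rewrite !scalerA mulrC.
Qed.

Lemma iter_eigshift_linear e k : linear (iter k (eigshift e)).
Proof. by elim: k => // k IH a u v; rewrite !iterS IH eigshift_linear. Qed.

Lemma iter_eigshiftD e k u v : iter k (eigshift e) (u + v) = iter k (eigshift e) u + iter k (eigshift e) v.
Proof. by have := iter_eigshift_linear e k 1 u v; rewrite !scale1r. Qed.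

Lemma iter_eigshift0 e k : iter k (eigshift e) 0 = 0.
Proof. by elim: k => // k IH; rewrite iterS IH /eigshift raddf0 scaler0 subr0. Qed.

Lemma iter_eigshiftZ e k a u : iter k (eigshift e) (a *: u) = a *: iter k (eigshift e) u.
Proof. by have := iter_eigshift_linear e k a u 0; rewrite iter_eigshift0 !addr0. Qed.

Lemma eigshiftZ e a u : eigshift e (a *: u) = a *: eigshift e u.
Proof. exact: (iter_eigshiftZ e 1). Qed.

Lemma eigshiftB e u v : eigshift e (u - v) = eigshift e u - eigshift e v.
Proof. by rewrite -scaleN1r addrC eigshift_linear scaleN1r addrC. Qed.

Lemma geneigen0 e : geneigen e 0. Proof. by exists 0. Qed.

Lemma iter_eigshift_le e k l u : (k <= l)%N -> iter k (eigshift e) u = 0 -> iter l (eigshift e) u = 0.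
Proof. by move=> /subnK <- h; rewrite iterD h iter_eigshift0. Qed.

Lemma geneigenD e u v : geneigen e u -> geneigen e v -> geneigen e (u + v).
Proof.
move=> [k hk] [l hl]; exists (maxn k l); rewrite iter_eigshiftD.
by rewrite (iter_eigshift_le (leq_maxl k l) hk) (iter_eigshift_le (leq_maxr k l) hl) addr0.
Qed.

Lemma geneigenZ e a u : geneigen e u -> geneigen e (a *: u).
Proof. by move=> [k hk]; exists k; rewrite iter_eigshiftZ hk scaler0. Qed.

Lemma geneigenB e u v : geneigen e u -> geneigen e v -> geneigen e (u - v).
Proof. by move=> hu hv; rewrite -scaleN1r; apply: geneigenD => //; exact: geneigenZ. Qed.

Lemma geneigen_sum e (I : Type) (s : seq I) (P : pred I) (F : I -> V) :
  (forall i, P i -> geneigen e (F i)) -> geneigen e (\sum_(i <- s | P i) F i).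
Proof. by move=> h; apply: big_ind => //; [exact: geneigen0 | exact: geneigenD]. Qed.

Lemma eigshift_comm e e' x : eigshift e (eigshift e' x) = eigshift e' (eigshift e x).
Proof.
rewrite /eigshift !linearB /= !linearZ /= ?scalerBr !scalerA [e' * e]mulrC.
by rewrite addrACA.
Qed.

Lemma iter_eigshift_comm e e' k x : iter k (eigshift e) (eigshift e' x) = eigshift e' (iter k (eigshift e) x).
Proof. by elim: k => // k IH; rewrite !iterS IH eigshift_comm. Qed.

Lemma geneigen_eigshift e e' x : geneigen e x -> geneigen e (eigshift e' x).
Proof.
move=> [k hk]; exists k; rewrite iter_eigshift_comm hk.
by rewrite /eigshift raddf0 scaler0 subr0.
Qed.

Lemma geneigen_eigshift_inv e x : geneigen e (eigshift e x) -> geneigen e x.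
Proof. by move=> [k hk]; exists k.+1; rewrite iterSr. Qed.

Lemma geneigen_app e x : geneigen e x -> geneigen e (A x).
Proof.
move=> h; have -> : A x = eigshift e x + e *: x by rewrite subrK.
by apply: geneigenD; [exact: geneigen_eigshift | exact: geneigenZ].
Qed.

Lemma geneigen_inj e e' x : e != e' -> geneigen e x -> eigshift e' x = 0 -> x = 0.
Proof.
move=> ee' [k hk] h; have Ax : A x = e' *: x by apply/eqP; rewrite -subr_eq0; apply/eqP.
have hE j : iter j (eigshift e) x = (e' - e) ^+ j *: x.
  elim: j => [|j IH]; first by rewrite expr0 scale1r.
  by rewrite iterS IH /eigshift linearZ /= Ax !scalerA -scalerBl exprS mulrBl [_ * e']mulrC.
move: hk; rewrite hE => /eqP; rewrite scaler_eq0 expf_eq0 subr_eq0 eq_sym (negPf ee').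
by rewrite andbF => /eqP.
Qed.

Lemma geneigen_iter_inj e e' k x : e != e' -> geneigen e x -> iter k (eigshift e') x = 0 -> x = 0.
Proof.
move=> ee'; elim: k x => // k IH x hx; rewrite iterSr => /IH h.
by apply: (geneigen_inj ee' hx); apply: h; exact: geneigen_eigshift.
Qed.

(** A power of A - e kills the component of e and is injective on the
    others. *)
Lemma geneigen_indep (E : seq K) (y : K -> V) : uniq E -> (forall k, geneigen k (y k)) ->
  \sum_(k <- E) y k = 0 -> forall k, k \in E -> y k = 0.
Proof.
elim: E y => // e E IH y /= /andP[eE uE] hy; rewrite big_cons => hs.
have [m hm] := hy e.
have yE k : k \in E -> y k = 0.
  move=> kE; apply: (@geneigen_iter_inj k e m) => //.
    by apply/negP => /eqP ke; move: eE; rewrite -ke kE.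
  apply: (IH (fun k => iter m (eigshift e) (y k))) => // [l|].
    by elim: (m) => // j hj; rewrite iterS; exact: geneigen_eigshift.
  have := congr1 (iter m (eigshift e)) hs; rewrite iter_eigshiftD hm add0r iter_eigshift0 => h.
  rewrite -[RHS]h; exact/esym/(big_morph _ (iter_eigshiftD e m) (iter_eigshift0 e m)).
move=> k; rewrite inE => /orP[/eqP ->|/yE//].
by move: hs; rewrite big1_seq ?addr0 // => i /andP[_ /yE].
Qed.

Lemma geneigen_sum_proj (I : eqType) (s : seq I) (lam : I -> K) (F : I -> V) e x :
  (forall i, geneigen (lam i) (F i)) -> x = \sum_(i <- s) F i -> geneigen e x ->
  forall k, k != e -> \sum_(i <- s | lam i == k) F i = 0.
Proof.
move=> hF xE hx k ke.
pose y l := \sum_(i <- s | lam i == l) F i - (if l == e then x else 0).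
pose E := undup (k :: e :: map lam s).
have yk : y k = 0.
  apply: (@geneigen_indep E y); rewrite ?undup_uniq //; last by rewrite mem_undup inE eqxx.
    move=> l; apply: geneigenB; last by case: eqP => [->|_] //; exact: geneigen0.
    by apply: geneigen_sum => i /eqP <-.
  rewrite /y sumrB -(@partition_big_key _ _ _ s E lam F) ?undup_uniq //; last first.
    by move=> l ls; rewrite mem_undup !inE ls !orbT.
  rewrite [X in _ - X](bigD1_seq e) ?undup_uniq ?mem_undup ?inE ?eqxx ?orbT //=.
  by rewrite [X in _ - (_ + X)]big1 ?addr0 -?xE ?subrr // => l /negPf ->.
by move: yk; rewrite /y (negPf ke) subr0.
Qed.

(** A - e' is invertible on the generalized eigenspace of e, where it is e -
    e' plus a nilpotent operator. *)
Lemma geneigen_solve e e' x : e != e' -> geneigen e x -> exists2 y, geneigen e y & eigshift e' y = x.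
Proof.
move=> ee' [k]; elim: k x => [|k IH] x hx.
  by exists 0; [exact: geneigen0 | rewrite /eigshift raddf0 scaler0 subr0 -hx].
have [y' hy' y'E] := IH (eigshift e x) (etrans (esym (iterSr _ _ _)) hx).
have d0 : e - e' != 0 by rewrite subr_eq0.
exists ((e - e')^-1 *: (x - y')).
  by apply: geneigenZ; apply: geneigenB => //; exists k.+1.
have h : eigshift e' x - eigshift e x = (e - e') *: x.
  by rewrite /eigshift opprB addrC addrA subrK -scalerBl.
by rewrite eigshiftZ eigshiftB y'E h scalerA mulVf // scale1r.
Qed.

Implicit Types p q : {poly K}.

Definition polyact (p : {poly K}) (x : V) : V := \sum_(i < size p) p`_i *: iter i A x.

Lemma polyactE n p x : (size p <= n)%N -> polyact p x = \sum_(i < n) p`_i *: iter i A x.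
Proof.
move=> pn; rewrite /polyact -(subnKC pn) big_split_ord /= [X in _ = _ + X]big1 ?addr0 // => i _.
by rewrite nth_default ?scale0r // leq_addr.
Qed.

Lemma iterA_linear k : linear (iter k A).
Proof. by elim: k => // k IH a u v; rewrite !iterS IH linearP. Qed.

Lemma polyact_linear p : linear (polyact p).
Proof.
move=> a u v; rewrite /polyact scaler_sumr -big_split; apply: eq_bigr => i _ /=.
by rewrite iterA_linear scalerDr !scalerA mulrC.
Qed.

Lemma polyactD p q x : polyact (p + q) x = polyact p x + polyact q x.
Proof.
pose n := maxn (size p) (size q).
rewrite !(@polyactE n) ?leq_maxl ?leq_maxr ?size_polyD //.
by rewrite -big_split; apply: eq_bigr => i _; rewrite coefD scalerDl.
Qed.

Lemma polyactC c x : polyact c%:P x = c *: x.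
Proof. by rewrite (@polyactE 1) ?size_polyC_leq1 // big_ord1 coefC. Qed.

Lemma polyactMX p x : polyact (p * 'X) x = polyact p (A x).
Proof.
rewrite (@polyactE (size p).+1); last first.
  by apply: leq_trans (size_polyMleq _ _) _; rewrite size_polyX addnC.
rewrite big_ord_recl coefMX scale0r add0r; apply: eq_bigr => i _.
by rewrite coefMX /= -iterSr.
Qed.

Lemma polyactZ c p x : polyact (c *: p) x = c *: polyact p x.
Proof.
rewrite (@polyactE (size p)) ?size_scale_leq // /polyact scaler_sumr.
by apply: eq_bigr => i _; rewrite coefZ scalerA.
Qed.

Lemma polyactA p x : polyact p (A x) = A (polyact p x).
Proof.
rewrite /polyact raddf_sum; apply: eq_bigr => i _.
by rewrite [RHS](linearZZ A) -iterSr iterS.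
Qed.

Lemma polyactM p q x : polyact (p * q) x = polyact p (polyact q x).
Proof.
elim/poly_ind: p x => [|p c IH] x.
  by rewrite mul0r -polyC0 !polyactC !scale0r.
rewrite mulrDl !polyactD mul_polyC polyactZ polyactC; congr (_ + _).
by rewrite mulrAC !polyactMX IH polyactA.
Qed.

Lemma polyact_trunc n p q x : iter n A x = 0 -> (forall i, (i < n)%N -> p`_i = q`_i) ->
  polyact p x = polyact q x.
Proof.
move=> hx pq; pose m := maxn (size p) (size q).
rewrite !(@polyactE m) ?leq_maxl ?leq_maxr //; apply: eq_bigr => i _.
have [/pq ->//|ni] := ltnP i n.
have -> : iter i A x = 0; last by rewrite !scaler0.
rewrite -(subnK ni) iterD hx; elim: (i - n)%N => // k IHk.
by rewrite iterS IHk linear0.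
Qed.

Lemma polyact_XsubC e x : polyact ('X - e%:P) x = eigshift e x.
Proof.
have -> : 'X - e%:P = 1%:P * 'X + (- e)%:P by rewrite mul1r polyCN.
by rewrite polyactD polyactMX !polyactC scale1r scaleNr.
Qed.

(** The span of all generalized eigenvectors, presented so as to argue by
    adding one generalized eigenvector at a time. *)
Inductive eigspan : V -> Prop :=
| eigspan0 : eigspan 0
| eigspan_add e x u : geneigen e x -> eigspan u -> eigspan (x + u).

Lemma eigspanD u v : eigspan u -> eigspan v -> eigspan (u + v).
Proof.
move=> hu hv; elim: hu => [|e x w hx _ IH]; first by rewrite add0r.
by rewrite -addrA; exact: (eigspan_add hx IH).
Qed.

Lemma eigspan_eigshift_solve e u : eigspan u -> exists2 t, eigspan t & geneigen e (u - eigshift e t).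
Proof.
elim=> [|e' x w hx _ [t ht IH]].
  by exists 0; [exact: eigspan0 | rewrite sub0r -scaleN1r; apply/geneigenZ/geneigen_eigshift/geneigen0].
have [ee'|ee'] := eqVneq e' e.
  by exists t => //; rewrite -addrA; apply: geneigenD => //; rewrite -ee'.
have [y hy yE] := geneigen_solve ee' hx.
exists (y + t); first exact: eigspan_add hy ht.
have -> : x + w - eigshift e (y + t) = w - eigshift e t; last by [].
have h : eigshift e (y + t) = eigshift e y + eigshift e t := iter_eigshiftD e 1 y t.
by rewrite h yE opprD addrACA subrr add0r.
Qed.

(** Primary decomposition, one factor A - z at a time: (A - z) u lies in the
    span, and solving (A - z) t = (A - z) u there up to a generalized
    eigenvector of z leaves a generalized eigenvector u - t. *)
Lemma eigspan_roots (s : seq K) u : polyact (\prod_(z <- s) ('X - z%:P)) u = 0 -> eigspan u.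
Proof.
elim: s u => [|z s IH] u.
  by rewrite big_nil -[1]/(1%:P) polyactC scale1r => ->; exact: eigspan0.
rewrite big_cons mulrC polyactM polyact_XsubC => /IH hu.
have [t ht h] := eigspan_eigshift_solve z hu.
rewrite -[u](subrK t); apply: (@eigspan_add z) ht; apply: geneigen_eigshift_inv.
by rewrite eigshiftB.
Qed.

End GenEigen.

(** * Weights and generalized eigenspaces in V *)

Section LinearFacts.
Variables (K : nzRingType) (V W : lmodType K) (f : V -> W) (hf : linear f).
Lemma linD u v : f (u + v) = f u + f v. Proof. exact: (raddfD (mklin hf)). Qed.
Lemma linB u v : f (u - v) = f u - f v. Proof. exact: (raddfB (mklin hf)). Qed.
Lemma linZ a u : f (a *: u) = a *: f u. Proof. exact: (linearZZ (mklin hf)). Qed.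
Lemma lin0 : f 0 = 0. Proof. exact: (raddf0 (mklin hf)). Qed.
Lemma lin_sum (I : Type) (r : seq I) (P : pred I) F :
  f (\sum_(i <- r | P i) F i) = \sum_(i <- r | P i) f (F i).
Proof. exact: (raddf_sum (mklin hf)). Qed.
End LinearFacts.

Section FiniteSums.
Variables (I : choiceType) (M : nmodType).

Lemma fsumT (r : seq I) (F : I -> M) : uniq r -> (forall i, i \notin r -> F i = 0) ->
  \sum_(i \in [set: I]) F i = \sum_(i <- r) F i.
Proof.
move=> ur h; rewrite (@fsbigE _ _ _ _ _ r _ ur) //; last by move=> i _; exact: h.
by under eq_bigl do rewrite in_setT.
Qed.

Lemma fsumT1 (i0 : I) (F : I -> M) : (forall i, i != i0 -> F i = 0) ->
  \sum_(i \in [set: I]) F i = F i0.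
Proof.
by move=> h; rewrite (@fsumT [:: i0]) ?big_seq1 // => i; rewrite inE; exact: h.
Qed.
End FiniteSums.

Lemma fsum_nat (M : nmodType) (J : nat) (F : nat -> M) : (forall j, (J <= j)%N -> F j = 0) ->
  \sum_(j \in [set: nat]) F j = \sum_(j < J) F j.
Proof.
move=> h; rewrite (@fsumT _ _ (iota 0 J)) ?iota_uniq //.
  by rewrite -[in RHS](big_mkord predT F) /index_iota subn0.
by move=> j; rewrite mem_iota /= add0n -leqNgt; exact: h.
Qed.

Lemma finite_set_seq (T : choiceType) (A : set T) : finite_set A ->
  exists2 r : seq T, uniq r & forall i, i \notin r -> ~ A i.
Proof.
move=> fA; exists (fset_set A); first exact: fset_uniq.
by move=> i /negP h Ai; apply: h; rewrite in_fset_set // inE.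
Qed.

Lemma grading_seq (K : fieldType) (V : lmodType K) (I : choiceType) (G : grading V I) v :
  exists2 r : seq I, uniq r & forall i, i \notin r -> gproj G i v = 0.
Proof.
have [r ur h] := finite_set_seq (gproj_fin G v); exists r => // i /h /= /negP.
by rewrite negbK => /eqP.
Qed.

Section VertexAlgebra.
Variables (R : realType) (V : vsa_data R) (hV : is_vsa V).
Local Notation C := R[i].

Local Notation hlf := (Defs.half R).

Definition vwt (k : int) (v : V) := gproj (vgr V) k v = v.

Lemma vwt_gproj k v : vwt k (gproj (vgr V) k v).
Proof. exact: gproj_idem. Qed.

Lemma vwt_other k v j : vwt k v -> j != k -> gproj (vgr V) j v = 0.
Proof. by move=> <- jk; rewrite gproj_proj (negPf jk). Qed.

Lemma vwtZ k a v : vwt k v -> vwt k (a *: v).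
Proof. by rewrite /vwt linearZ /= => ->. Qed.

Lemma vwtD k u v : vwt k u -> vwt k v -> vwt k (u + v).
Proof. by rewrite /vwt linearD /= => -> ->. Qed.

Lemma gproj_vL0 j v : gproj (vgr V) j (vL0 v) = hlf j *: gproj (vgr V) j v.
Proof.
have [r ur hr] := grading_seq (vgr V) v.
rewrite /vL0 (@fsumT _ _ r) //; last by move=> i /hr ->; rewrite scaler0.
rewrite linear_sum; have [jr|jr] := boolP (j \in r).
  rewrite (bigD1_seq j) //= linearZ /= gproj_idem big1 ?addr0 // => i ij.
  by rewrite linearZ /= gproj_proj eq_sym (negPf ij) scaler0.
rewrite hr // scaler0 big1_seq // => i /andP[_ ir]; rewrite linearZ /= gproj_proj.
by case: eqP => [e|_]; [rewrite e ir in jr | rewrite scaler0].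
Qed.

Lemma vL0_vwt k v : vwt k v -> vL0 v = hlf k *: v.
Proof.
move=> h; apply: (@grading_eq _ _ _ (vgr V)) => j; rewrite gproj_vL0 linearZ /=.
by have [->//|jk] := eqVneq j k; rewrite (vwt_other h jk) !scaler0.
Qed.

Lemma half_inj : injective hlf.
Proof.
move=> a b; rewrite /Defs.half => /(congr1 (fun z => z * 2)).
by rewrite !divfK ?pnatr_eq0 // => /eqP; rewrite eqr_int => /eqP.
Qed.

(** The commutator of L(0) with Y gives the weight of Y(u) v; the index of a
    component is twice its weight. *)
Lemma vwt_vY a b n u v : vwt a u -> vwt b v -> vwt (n *+ 2 + a + b) (vY n u v).
Proof.
move=> ha hb; set k := n *+ 2 + a + b; have := vsa_L0 hV n u v.
rewrite (vL0_vwt ha) (vL0_vwt hb) (linZ (vsa_linr hV n u)) (linZ (vsa_linl hV n v)).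
move/eqP; rewrite subr_eq -!scalerDl => /eqP e.
have ek : n%:~R + hlf a + hlf b = hlf k.
  by rewrite /Defs.half /k mulr2n !intrD; field.
apply: (@grading_eq _ _ _ (vgr V)) => j; rewrite gproj_proj.
case: eqP => [->//|/eqP kj]; apply/esym/eqP.
have := congr1 (gproj (vgr V) j) e; rewrite gproj_vL0 linearZ /= ek => /eqP.
rewrite -subr_eq0 -scalerBl scaler_eq0 subr_eq0 => /orP[/eqP /half_inj jk|//].
by rewrite jk eqxx in kj.
Qed.

Lemma vY_suml n (I : Type) (r : seq I) (F : I -> V) v :
  vY n (\sum_(i <- r) F i) v = \sum_(i <- r) vY n (F i) v.
Proof. exact: (lin_sum (vsa_linl hV n v)). Qed.

Lemma vY_sumr n (I : Type) (r : seq I) (F : I -> V) u :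
  vY n u (\sum_(i <- r) F i) = \sum_(i <- r) vY n u (F i).
Proof. exact: (lin_sum (vsa_linr hV n u)). Qed.

Lemma vY_trunc (u v : V) : exists N : int, forall n, n < N -> vY n u v = 0.
Proof.
have [B hB] := vsa_lower hV.
have key a b u' v' : vwt a u' -> vwt b v' -> forall n, n *+ 2 + a + b < B -> vY n u' v' = 0.
  by move=> ha hb n hn; rewrite -(vwt_vY n ha hb) hB.
have [r ->] := grading_decomp (vgr V) u; have [s ->] := grading_decomp (vgr V) v.
have [N hN] : exists N : int, forall i j n, i \in r -> j \in s -> n < N -> n *+ 2 + i + j < B.
  exists (- (\sum_(i <- r) `|i| + \sum_(j <- s) `|j| + `|B|)) => i j n ir js.
  have hi : `|i| <= \sum_(i <- r) `|i| by rewrite (big_rem i ir) /= lerDl sumr_ge0.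
  have hj : `|j| <= \sum_(j <- s) `|j| by rewrite (big_rem j js) /= lerDl sumr_ge0.
  by move: (\sum_(i <- r) _) (\sum_(j <- s) _) hi hj => p q; lia.
exists N => n nN; rewrite vY_suml big1_seq // => i /andP[_ ir].
rewrite vY_sumr big1_seq // => j /andP[_ js].
by apply: (key i j) (hN _ _ _ ir js nN); exact: vwt_gproj.
Qed.

Section Automorphism.
Implicit Types u v x : V.
Variables (g : {linear V -> V}) (hg : is_vsa_aut g).
Local Notation e2 a := (cexp (twopii R * a)).

Lemma aut_gproj k v : gproj (vgr V) k (g v) = g (gproj (vgr V) k v).
Proof.
have [r rE] := grading_decomp (vgr V) v.
have h j : gproj (vgr V) k (g (gproj (vgr V) j v)) = g (gproj (vgr V) k (gproj (vgr V) j v)).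
  have e := aut_wt hg (vwt_gproj j v); rewrite -e !gproj_proj e.
  by case: eqP => // _; rewrite linear0.
transitivity (\sum_(j <- r) g (gproj (vgr V) k (gproj (vgr V) j v))).
  by rewrite {1}rE !raddf_sum; apply: eq_bigr => j _; exact: h.
by rewrite [in RHS]rE !raddf_sum.
Qed.

Lemma gen_eigE a u : gen_eig g a u = geneigen g (e2 a) u.
Proof. by []. Qed.

(** The weight spaces are finite dimensional and stable under g, so each
    homogeneous vector is killed by a polynomial in g, which splits over the
    complex numbers. *)
Lemma eigspan_all u : eigspan g u.
Proof.
have [r ->] := grading_decomp (vgr V) u.
elim: r => [|k r IH]; first by rewrite big_nil; exact: eigspan0.
rewrite big_cons; apply: eigspanD IH.
have [d [b hb]] := vsa_findim hV k.
set w := gproj (vgr V) k u.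
have hw i : vwt k (iter i g w).
  by elim: i => [|i IH]; [exact: vwt_gproj | rewrite iterS; exact: aut_wt].
pose co i := projT1 (cid (hb _ (hw i))).
have coE i : iter i g w = \sum_j co i j *: b j by rewrite /co; case: cid.
pose M : 'M[C]_(d.+1, d) := \matrix_(i, j) co i j.
(* d + 1 vectors in a space spanned by d vectors are dependent *)
have : kermx M != 0.
  rewrite -mxrank_eq0 mxrank_ker -lt0n subn_gt0.
  exact: leq_ltn_trans (rank_leq_col M) _.
case/rowV0Pn => x /sub_kermxP xM x0.
pose p : {poly C} := \poly_(i < d.+1) (x 0 (inord i)).
have p0 : p != 0.
  apply/negP => /eqP p0; case/negP: x0; apply/eqP/rowP => i.
  have := congr1 (fun q : {poly C} => q`_i) p0.
  by rewrite coef_poly ltn_ord inord_val coef0 mxE.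
have pw : polyact g p w = 0.
  rewrite (@polyactE _ _ _ d.+1) ?size_poly //.
  transitivity (\sum_(i < d.+1) \sum_j (x 0 i * M i j) *: b j).
    apply: eq_bigr => i _; rewrite coef_poly ltn_ord inord_val coE scaler_sumr.
    by apply: eq_bigr => j _; rewrite scalerA mxE.
  rewrite exchange_big big1 //= => j _; rewrite -scaler_suml.
  by have := congr1 (fun y : 'rV_d => y 0 j) xM; rewrite !mxE => ->; rewrite scale0r.
have [s sE] := closed_field_poly_normal p.
apply: (@eigspan_roots _ _ g s); move: pw; rewrite {1}sE polyactZ => /eqP.
by rewrite scaler_eq0 lead_coef_eq0 (negPf p0) => /eqP.
Qed.

Lemma eig_decompD u v d d' (c : C) : eig_decomp g u d -> eig_decomp g v d' ->
  eig_decomp g (c *: u + v) (fun a => c *: d a + d' a).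
Proof.
move=> [f1 s1 g1 e1] [f2 s2 g2 e3].
have [r1 ur1 hr1] := finite_set_seq f1; have [r2 ur2 hr2] := finite_set_seq f2.
have z1 a : a \notin r1 -> d a = 0 by move=> /hr1 /= /negP; rewrite negbK => /eqP.
have z2 a : a \notin r2 -> d' a = 0 by move=> /hr2 /= /negP; rewrite negbK => /eqP.
pose r := undup (r1 ++ r2).
have nr a : a \notin r -> (a \notin r1) /\ (a \notin r2).
  by rewrite mem_undup mem_cat negb_or => /andP[].
split.
- apply: (@sub_finite_set _ _ [set` r]); last exact: finite_seq.
  move=> a /= h; apply: contrapT => /negP /nr[/z1 h1 /z2 h2].
  by rewrite h1 h2 scaler0 addr0 eqxx in h.
- by move=> a ha; rewrite s1 // s2 // scaler0 addr0.
- by move=> a; rewrite gen_eigE; apply: geneigenD; [apply: geneigenZ; exact: g1 | exact: g2].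
rewrite (@fsumT _ _ r) ?undup_uniq //; last first.
  by move=> a /nr[/z1 -> /z2 ->]; rewrite scaler0 addr0.
rewrite big_split -scaler_sumr /= -(@fsumT _ _ r) ?undup_uniq //; last first.
  by move=> a /nr[/z1 -> _].
rewrite -(@fsumT _ _ r d') ?undup_uniq //; last by move=> a /nr[_ /z2 ->].
by rewrite e1 e3.
Qed.

Lemma eig_decomp_eig a u : in_strip a -> gen_eig g a u ->
  eig_decomp g u (fun b => if b == a then u else 0).
Proof.
move=> sa ha; split.
- apply: (@sub_finite_set _ _ [set a]); last exact: finite_set1.
  by move=> b /=; case: (b =P a) => // _ /eqP.
- by move=> b; case: eqP => // ->; rewrite sa.
- by move=> b; case: eqP => [->//|_]; rewrite gen_eigE; exact: geneigen0.
by rewrite (@fsumT1 _ _ a) ?eqxx // => b /negPf ->.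
Qed.

Lemma aut_geneigen0 x : geneigen g 0 x -> x = 0.
Proof.
have [h hK _] := aut_bij hg.
move=> [k]; elim: k => // k IH; rewrite iterS {1}/eigshift scale0r subr0 => e.
by apply: IH; rewrite -[LHS]hK e -[X in h X](linear0 g) hK.
Qed.

Lemma eig_decomp_exists u : exists d, eig_decomp g u d.
Proof.
elim: (eigspan_all u) => [|e x w hx _ [d hd]].
  exists (fun=> 0); split => //; first by rewrite (_ : [set _ | _] = set0) // -subset0 => a /=; rewrite eqxx.
    by move=> a; rewrite gen_eigE; exact: geneigen0.
  by rewrite (@fsumT _ _ [::]) ?big_nil.
have [e0|e0] := eqVneq e 0.
  by exists d; rewrite (aut_geneigen0 (x := x)) ?add0r // -e0.
have [a sa aE] := cexp_twopii_surj e0.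
have hx' : gen_eig g a x by rewrite gen_eigE aE.
exists (fun b => 1 *: (if b == a then x else 0) + d b).
by have := eig_decompD 1 (eig_decomp_eig sa hx') hd; rewrite scale1r.
Qed.

Lemma in_strip_inj a b : in_strip a -> in_strip b -> e2 a = e2 b -> a = b.
Proof.
rewrite /in_strip => /andP[a0 a1] /andP[b0 b1] /cexp_twopii_inj[n hn].
suff n0 : n = 0 by apply/eqP; rewrite -subr_eq0 hn n0.
have : complex.Re (a - b) = n%:~R.
  by rewrite hn -[X in _ = X]/(complex.Re (n%:~R : R)%:C) rmorph_int.
rewrite complex_ReD -[complex.Re (- b)]/(_) => h.
have hb : complex.Re (- b) = - complex.Re b by case: (b).
rewrite hb in h.
(* the real part of a - b lies strictly between - 1 and 1 *)
have h1 : (-1)%:~R < (n%:~R : R) by rewrite -h; lra.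
have h2 : (n%:~R : R) < 1%:~R by rewrite -h; lra.
by move: h1 h2; rewrite !ltr_int; lia.
Qed.

(** Distinct points of the strip give distinct eigenvalues of g. *)
Lemma eig_decomp_uniq u d d' : eig_decomp g u d -> eig_decomp g u d' -> d = d'.
Proof.
move=> h h'; have := eig_decompD (-1) h h'; rewrite scaleN1r addNr.
set dd := fun a => _; case=> f s ge_ sum0.
have [r ur hr] := finite_set_seq f.
have z a : a \notin r -> dd a = 0 by move=> /hr /= /negP; rewrite negbK => /eqP.
suff dd0 a : dd a = 0.
  apply: funext => a; have /eqP := dd0 a; rewrite /dd scaleN1r addrC subr_eq0.
  by move=> /eqP.
have [ar|/z//] := boolP (a \in r).
have [sa|/s//] := boolP (in_strip a).
pose r' := [seq b <- r | in_strip b].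
pose y k := \sum_(b <- r' | e2 b == k) dd b.
have yE : y (e2 a) = dd a.
  rewrite /y -big_filter (_ : [seq _ <- _ | _] = [:: a]) ?big_seq1 //.
  rewrite /r' -filter_predI -(@filter_pred1_uniq _ r a) //.
  apply: eq_in_filter => b br /=; apply/idP/idP => [/andP[/eqP e sb]|/eqP ->].
    by apply/eqP; apply: in_strip_inj.
  by rewrite eqxx sa.
rewrite -yE; apply: (@geneigen_indep _ _ g (undup (map (fun b => e2 b) r')) y); rewrite ?undup_uniq //.
- by move=> k; apply: geneigen_sum => b /eqP <-; exact: ge_.
- rewrite -(@partition_big_key _ _ _ r' _ (fun b => e2 b) dd) ?undup_uniq //; last first.
    by move=> k; rewrite mem_undup.
  rewrite /r' big_filter -[RHS]sum0 (@fsumT _ _ r) // [LHS]big_mkcond.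
  by apply: eq_bigr => b _; case: ifP => // /negbT /s ->.
by rewrite mem_undup; apply/mapP; exists a => //; rewrite mem_filter sa.
Qed.

Lemma gcompE u d : eig_decomp g u d -> gcomp g u = d.
Proof.
move=> hd; rewrite /gcomp; case: xgetP => [d' _ /= hd'|]; first exact: eig_decomp_uniq hd.
by move=> /(_ d).
Qed.

Lemma gcompP u : eig_decomp g u (gcomp g u).
Proof. by have [d hd] := eig_decomp_exists u; rewrite (gcompE hd). Qed.

Lemma gcomp_linear a : linear (gcomp g ^~ a).
Proof. by move=> c u v; rewrite (gcompE (eig_decompD c (gcompP u) (gcompP v))). Qed.

Lemma gcomp_eig a u b : in_strip a -> gen_eig g a u -> gcomp g u b = if b == a then u else 0.
Proof. by move=> sa ha; rewrite (gcompE (eig_decomp_eig sa ha)). Qed.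

Lemma gcomp_strip u a : ~~ in_strip a -> gcomp g u a = 0.
Proof. by case: (gcompP u) => _ h _ _; exact: h. Qed.

Lemma gcomp_gen u a : gen_eig g a (gcomp g u a).
Proof. by case: (gcompP u). Qed.

Lemma gcomp_seq u : exists2 r : seq C, uniq r & forall a, a \notin r -> gcomp g u a = 0.
Proof.
case: (gcompP u) => f _ _ _; have [r ur hr] := finite_set_seq f; exists r => // a /hr /= /negP.
by rewrite negbK => /eqP.
Qed.

Lemma gcomp_decomp u : exists2 r : seq C, uniq r & u = \sum_(a <- r) gcomp g u a.
Proof.
have [r ur hr] := gcomp_seq u; exists r => //; case: (gcompP u) => _ _ _ {1}<-.
exact: fsumT.
Qed.

(** The projections to the weight spaces commute with g, so they respect the
    unique decomposition. *)
Lemma gcomp_vwt k u a : vwt k u -> vwt k (gcomp g u a).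
Proof.
move=> hu; case: (gcompP u) => f s ge_ sum1.
have := gcompP u; rewrite -[in X in X -> _]hu => h.
suff /gcompE /(congr1 (fun d => d a)) : eig_decomp g (gproj (vgr V) k u) (fun b => gproj (vgr V) k (gcomp g u b)).
  by rewrite hu => /esym.
have [r ur hr] := gcomp_seq u.
split.
- by apply: sub_finite_set f => b /=; apply: contra => /eqP ->; rewrite linear0.
- by move=> b /s ->; rewrite linear0.
- move=> b; rewrite gen_eigE; have [m hm] := ge_ b; exists m.
  rewrite -[RHS](linear0 (gproj (vgr V) k)) -[X in _ = gproj _ _ X]hm.
  elim: (m) => // j IH; rewrite !iterS IH /eigshift (linearB (gproj (vgr V) k)) (linearZZ (gproj (vgr V) k)) aut_gproj //.
rewrite (@fsumT _ _ r) //; last by move=> b /hr ->; rewrite linear0.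
by rewrite -linear_sum; congr (gproj _ _ _); rewrite -[RHS]sum1 (@fsumT _ _ r).
Qed.

End Automorphism.
End VertexAlgebra.

(** * The derivation N_g *)

(** Linear functionals reduce this to polynomials with scalar coefficients. *)
Lemma poly_coefs_eq0 (R : realType) (V : lmodType R[i]) (K : nat) (F : nat -> V) :
  (forall m : nat, \sum_(k < K) (m%:R ^+ k : R[i]) *: F k = 0) ->
  forall k, (k < K)%N -> F k = 0.
Proof.
move=> h k kK; apply: functional_sep => phi; rewrite linear0.
have : \poly_(k < K) phi (F k) = 0.
  apply: (@poly_eq0_inj _ (fun m : nat => m%:R)).
    by move=> i j /eqP; rewrite eqr_nat => /eqP.
  move=> m; rewrite horner_poly -[RHS](linear0 phi) -[in RHS](h m) linear_sum.
  by apply: eq_bigr => i _; rewrite linearZ /= mulrC.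
by move=> /(congr1 (fun q : {poly R[i]} => q`_k)); rewrite coef_poly kK coef0.
Qed.

Section PolynomialAction.
Variables (K : fieldType) (V : lmodType K) (A : {linear V -> V}).
Implicit Types p q : {poly K}.

Lemma polyact_sum (I : Type) (r : seq I) (F : I -> {poly K}) x :
  polyact A (\sum_(i <- r) F i) x = \sum_(i <- r) polyact A (F i) x.
Proof.
elim: r => [|i r IH]; first by rewrite !big_nil -polyC0 polyactC scale0r.
by rewrite !big_cons polyactD IH.
Qed.

Lemma polyactXn n x : polyact A 'X^n x = iter n A x.
Proof.
elim: n x => [|n IH] x; first by rewrite expr0 -[1]/(1%:P) polyactC scale1r.
by rewrite exprSr polyactMX IH -iterSr.
Qed.

Lemma iter_polyact n p x : iter n A (polyact A p x) = polyact A p (iter n A x).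
Proof. by elim: n => // n IH; rewrite !iterS IH polyactA. Qed.

Lemma polyact0 p : polyact A p 0 = 0.
Proof. exact: (lin0 (polyact_linear A p)). Qed.

End PolynomialAction.

Section AutLog.
Variables (R : realType) (V : vsa_data R) (hV : is_vsa V).
Variables (g : {linear V -> V}) (hg : is_vsa_aut g).
Local Notation C := R[i].
Local Notation e2 a := (cexp (twopii R * a)).
Local Notation N := (Ng g).
Implicit Types u v x : V.

Lemma expS_linear c : linear (expS g c).
Proof.
move=> b u v; rewrite /expS.
have [r1 u1 h1] := gcomp_seq hV hg u; have [r2 u2 h2] := gcomp_seq hV hg v.
pose r := undup (r1 ++ r2).
have nr a : a \notin r -> (a \notin r1) /\ (a \notin r2).
  by rewrite mem_undup mem_cat negb_or => /andP[].
rewrite !(@fsumT _ _ r) ?undup_uniq //.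
- rewrite scaler_sumr -big_split; apply: eq_bigr => a _ /=.
  by rewrite (gcomp_linear hV hg) scalerDr !scalerA mulrC.
- by move=> a /nr[_ /h2 ->]; rewrite scaler0.
- by move=> a /nr[/h1 -> _]; rewrite scaler0.
- move=> a /nr[/h1 ha /h2 hb].
  by rewrite (gcomp_linear hV hg) ha hb scaler0 addr0 scaler0.
Qed.

Lemma expS_eig c a u : in_strip a -> gen_eig g a u -> expS g c u = cexp (c * a) *: u.
Proof.
move=> sa ha; rewrite /expS (@fsumT1 _ _ a); first by rewrite (gcomp_eig _ sa ha) eqxx.
by move=> b ba; rewrite (gcomp_eig _ sa ha) (negPf ba) scaler0.
Qed.

(** The unipotent part e^(2 pi i N_g) of g. *)
Definition unip x := expS g (- twopii R) (g x).
Definition unipB1 x := unip x - x.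

Lemma unip_linear : linear unip.
Proof. by move=> a u v; rewrite /unip linearP expS_linear. Qed.

Lemma unipB1_linear : linear unipB1.
Proof. by move=> a u v; rewrite /unipB1 unip_linear scalerBr opprD addrACA. Qed.

Definition unipB1L : {linear V -> V} := mklin unipB1_linear.

Lemma unip_geneigen z u : geneigen g z u -> unip u = z^-1 *: g u.
Proof.
move=> hu; have [z0|z0] := eqVneq z 0.
  by rewrite z0 in hu; rewrite (aut_geneigen0 hg hu) linear0 scaler0 (lin0 unip_linear).
have [a sa aE] := cexp_twopii_surj z0; rewrite /unip (@expS_eig _ a) //.
  by rewrite mulNr cexpN aE.
by rewrite gen_eigE aE; exact: geneigen_app.
Qed.

Lemma unipB1_geneigen z u : geneigen g z u -> unipB1 u = z^-1 *: eigshift g z u.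
Proof.
move=> hu; have [z0|z0] := eqVneq z 0.
  by rewrite z0 in hu *; rewrite (aut_geneigen0 hg hu) (lin0 unipB1_linear) /eigshift linear0 scaler0 subr0 scaler0.
by rewrite /unipB1 (unip_geneigen hu) /eigshift scalerBr scalerA mulVf // scale1r.
Qed.

Lemma iter_unipB1_geneigen z u k : geneigen g z u -> iter k unipB1 u = z^-1 ^+ k *: iter k (eigshift g z) u.
Proof.
move=> hu; elim: k => [|k IH]; first by rewrite expr0 scale1r.
rewrite !iterS IH (linZ unipB1_linear) (@unipB1_geneigen z); last first.
  by elim: (k) => // j hj; rewrite iterS; exact: geneigen_eigshift.
by rewrite scalerA exprSr.
Qed.

Lemma iter_unipB1_le j k u : (j <= k)%N -> iter j unipB1 u = 0 -> iter k unipB1 u = 0.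
Proof.
move=> /subnK <- h; rewrite iterD h; elim: (k - j)%N => // l IH.
by rewrite iterS IH (lin0 unipB1_linear).
Qed.

Lemma unipB1_nilp u : exists J, iter J unipB1 u = 0.
Proof.
elim: (eigspan_all hV hg u) => [|z x w [k hx] _ [J hJ]]; first by exists 0.
exists (maxn k J).
have := linD (iterA_linear unipB1L (maxn k J)) x w; rewrite /= => ->.
rewrite (iter_unipB1_le (leq_maxr k J) hJ) addr0 (@iter_unipB1_geneigen z); last by exists k.
by rewrite (iter_eigshift_le (leq_maxl k J) hx) scaler0.
Qed.

Definition Ng_poly J : {poly C} := (twopii R)^-1 *: log1p R J.

(** On vectors killed by a power of the nilpotent part, the series of N_g is a
    polynomial; all operators below are polynomials in the same operator. *)
Lemma Ng_polyact J u : iter J unipB1 u = 0 -> N u = polyact unipB1L (Ng_poly J) u.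
Proof.
move=> hJ; rewrite /Ng_poly polyactZ /Ng; congr (_ *: _).
rewrite (@fsum_nat _ J); last first.
  move=> j Jj; have := iter_unipB1_le (leqW Jj) hJ; rewrite /unipB1 /unip => ->.
  by rewrite scaler0.
rewrite /log1p polyact_sum; apply: eq_bigr => j _.
by rewrite polyactZ polyactXn.
Qed.

Lemma unipB1_polyact J p u : iter J unipB1 u = 0 -> iter J unipB1 (polyact unipB1L p u) = 0.
Proof.
move=> hJ; have := iter_polyact unipB1L J p u; rewrite /= => ->.
by rewrite hJ polyact0.
Qed.

Lemma iter_Ng J k u : iter J unipB1 u = 0 -> iter k N u = polyact unipB1L (Ng_poly J ^+ k) u.
Proof.
move=> hJ; elim: k => [|k IH].
  by rewrite expr0 -[1]/(1%:P) polyactC scale1r.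
by rewrite iterS IH exprS polyactM (@Ng_polyact J) //; exact: unipB1_polyact.
Qed.

Lemma Ng_linear : linear N.
Proof.
move=> a u v; have [J1 h1] := unipB1_nilp u; have [J2 h2] := unipB1_nilp v.
pose J := maxn J1 J2.
have hu := iter_unipB1_le (leq_maxl J1 J2) h1; have hv := iter_unipB1_le (leq_maxr J1 J2) h2.
rewrite !(@Ng_polyact J) // ?polyact_linear //.
by have := iterA_linear unipB1L J a u v; rewrite /= => ->; rewrite hu hv scaler0 addr0.
Qed.

Definition NgL : {linear V -> V} := mklin Ng_linear.

Lemma iter_Ng_linear k : linear (iter k N).
Proof. exact: (iterA_linear NgL k). Qed.

Lemma iter_Ng0 J k u : iter J unipB1 u = 0 -> (J <= k)%N -> iter k N u = 0.
Proof.
move=> hJ Jk; rewrite (iter_Ng _ hJ) (@polyact_trunc _ _ _ J _ 0) //.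
  by rewrite -polyC0 polyactC scale0r.
move=> i iJ; rewrite /Ng_poly exprZn coefZ coef_log1pX_lt ?mulr0 ?coef0 //.
exact: leq_trans iJ Jk.
Qed.

Lemma binC_nat (m j : nat) : binC (m%:R : C) j = 'C(m, j)%:R.
Proof.
elim: j => [|j IH]; first by rewrite binC0 bin0.
have h1 : (j.+1%:R : C) != 0 by rewrite pnatr_eq0.
apply: (mulfI h1); rewrite binCS IH -natrM mul_bin_left.
have [mj|jm] := ltnP m j.
  by rewrite bin_small // muln0 mulr0.
by rewrite natrM natrB.
Qed.

(** The binomial expansion of (1 + M)^m = e^(m log (1 + M)).  It is polynomial
    in m. *)
Lemma iter_unip J m u : iter J unipB1 u = 0 ->
  iter m unip u = \sum_(k < J) ((twopii R * m%:R) ^+ k / k`!%:R) *: iter k N u.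
Proof.
move=> hJ.
have hU : forall x, polyact unipB1L (1 + 'X) x = unip x.
  by move=> x; rewrite polyactD -[1]/(1%:P) polyactC scale1r -['X]expr1 polyactXn /= addrC subrK.
transitivity (polyact unipB1L ((1 + 'X) ^+ m) u).
  elim: m => [|m IH]; first by rewrite expr0 -[1]/(1%:P) polyactC scale1r.
  by rewrite iterS IH exprS polyactM hU.
rewrite (@polyact_trunc _ _ unipB1L J _ (\sum_(k < J) (m%:R ^+ k / k`!%:R) *: log1p R J ^+ k) _ hJ).
  rewrite polyact_sum; apply: eq_bigr => k _.
  rewrite (iter_Ng _ hJ) /Ng_poly exprZn !polyactZ scalerA; congr (_ *: _).
  have h1 : twopii R ^+ k != 0 by rewrite expf_neq0 ?twopii_neq0.
  have h2 : (k`!%:R : C) != 0 by rewrite pnatr_eq0 -lt0n fact_gt0.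
  by rewrite exprMn exprVn; field; rewrite h1 h2.
move=> i iJ; rewrite coef_sum.
under eq_bigr do rewrite coefZ.
rewrite (exp_log1p _ (ltnW iJ) iJ) binC_nat addrC exprDn coef_sum.
under eq_bigr do rewrite expr1n mulr1 coefMn coefXn.
have [im|mi] := leqP i m.
  rewrite (bigD1 (inord (m - i))) //= inordK ?ltnS ?leq_subr // subKn // eqxx.
  rewrite bin_sub // big1 ?addr0 // => k.
  rewrite -val_eqE /= inordK ?ltnS ?leq_subr // => kk.
  rewrite [_ == _](_ : _ = false) ?mul0rn //; have := ltn_ord k; lia.
rewrite bin_small // big1 // => k _.
rewrite [_ == _](_ : _ = false) ?mul0rn //; lia.
Qed.

(** (g - z z') Y(u) v = Y((g - z) u) g v + z Y(u) (g - z') v, and induction on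
    the two nilpotency orders. *)
Lemma geneigen_vY n z z' u v : geneigen g z u -> geneigen g z' v -> geneigen g (z * z') (vY n u v).
Proof.
move=> [k hk] [l hl].
have [m] := ubnP (k + l)%N; elim: m => // m IH in k l u v hk hl *.
move=> klm; case: k hk klm => [|k] hk klm.
  by rewrite [u]hk (lin0 (vsa_linl hV n v)); exact: geneigen0.
case: l hl klm => [|l] hl klm.
  by rewrite [v]hl (lin0 (vsa_linr hV n u)); exact: geneigen0.
apply: geneigen_eigshift_inv.
have -> : eigshift g (z * z') (vY n u v) = vY n (eigshift g z u) (g v) + z *: vY n u (eigshift g z' v).
  rewrite /eigshift (aut_Y hg) (linB (vsa_linl hV n (g v))) (linZ (vsa_linl hV n (g v))).
  by rewrite (linB (vsa_linr hV n u)) (linZ (vsa_linr hV n u)) scalerBr scalerA addrA subrK.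
have hgv : iter l.+1 (eigshift g z') (g v) = 0.
  have e := iter_eigshift_comm g z' 0 l.+1 v.
  have o x : eigshift g 0 x = g x by rewrite /eigshift scale0r subr0.
  by rewrite !o in e; rewrite e hl linear0.
apply: geneigenD.
  by apply: (IH k l.+1) => //; rewrite -iterSr.
apply: geneigenZ; apply: (IH k.+1 l) => //; first by rewrite -iterSr.
by lia.
Qed.

(** The semisimple part of g acts on Y(u) v as the product of the eigenvalues
    of u and v. *)
Lemma unip_vY n u v : unip (vY n u v) = vY n (unip u) (unip v).
Proof.
have hl w := vsa_linl hV n w; have hr w := vsa_linr hV n w.
elim: (eigspan_all hV hg u) => [|z x w hx _ IH].
  by rewrite (lin0 unip_linear) !(lin0 (hl _)) (lin0 unip_linear).
rewrite (linD unip_linear) !(linD (hl _)) (linD unip_linear) IH; congr (_ + _) => {w IH}.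
elim: (eigspan_all hV hg v) => [|z' y w hy _ IH].
  by rewrite (lin0 unip_linear) !(lin0 (hr _)) (lin0 unip_linear).
rewrite (linD unip_linear) !(linD (hr _)) (linD unip_linear) IH; congr (_ + _) => {w IH}.
rewrite (unip_geneigen (geneigen_vY n hx hy)) (unip_geneigen hx) (unip_geneigen hy) (aut_Y hg).
by rewrite (linZ (hr _)) (linZ (hl _)) scalerA invfM mulrC.
Qed.

Lemma iter_unip_vY n m u v : iter m unip (vY n u v) = vY n (iter m unip u) (iter m unip v).
Proof. by elim: m => // m IH; rewrite !iterS IH unip_vY. Qed.

(** The powers e^(2 pi i m N_g) of an automorphism are polynomial in m, so the
    linear coefficients of the two sides agree. *)
Lemma Ng_der n u v : N (vY n u v) = vY n (N u) v + vY n u (N v).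
Proof.
have hl w := vsa_linl hV n w; have hr w := vsa_linr hV n w.
have [J1 h1] := unipB1_nilp u; have [J2 h2] := unipB1_nilp v; have [J3 h3] := unipB1_nilp (vY n u v).
pose J := (maxn J1 (maxn J2 J3)).+2.
have hu : iter J unipB1 u = 0 by apply: iter_unipB1_le h1; rewrite /J; lia.
have hv : iter J unipB1 v = 0 by apply: iter_unipB1_le h2; rewrite /J; lia.
have hy : iter J unipB1 (vY n u v) = 0 by apply: iter_unipB1_le h3; rewrite /J; lia.
pose c := twopii R.
pose F k := if (k < J)%N then (c ^+ k / k`!%:R) *: iter k N (vY n u v) else 0.
pose T i j := (c ^+ i / i`!%:R * (c ^+ j / j`!%:R)) *: vY n (iter i N u) (iter j N v).
pose G k := \sum_(i < J) \sum_(j < J) if (i + j == k)%N then T i j else 0.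
(* the coefficients of m^k in U^m Y(u) v = Y(U^m u) U^m v, with U = e^(2 pi i
   N_g) *)
have FG k : (k < J + J)%N -> F k - G k = 0.
  apply: (@poly_coefs_eq0 _ _ (J + J) (fun k => F k - G k)) => m; under eq_bigr do rewrite scalerBr.
  rewrite sumrB; apply/eqP; rewrite subr_eq0; apply/eqP.
  transitivity (iter m unip (vY n u v)).
    rewrite (iter_unip m hy) big_split_ord /= [X in _ + X]big1 ?addr0; last first.
      by move=> i _; rewrite /F ltnNge leq_addr scaler0.
    by apply: eq_bigr => k' _; rewrite /F ltn_ord scalerA exprMn; congr (_ *: _); ring.
  rewrite iter_unip_vY (iter_unip m hu) (iter_unip m hv) vY_suml //.
  under [RHS]eq_bigr do rewrite scaler_sumr.
  rewrite [RHS]exchange_big /=; apply: eq_bigr => i _.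
  under [RHS]eq_bigr do rewrite scaler_sumr.
  rewrite [RHS]exchange_big /= vY_sumr //; apply: eq_bigr => j _.
  rewrite (linZ (hl _)) (linZ (hr _)).
  have ij : (i + j < J + J)%N by have := ltn_ord i; have := ltn_ord j; lia.
  rewrite (bigD1 (Ordinal ij)) //= eqxx big1 ?addr0; last first.
    by move=> k' /negPf; rewrite -val_eqE /= eq_sym => ->; rewrite scaler0.
  by rewrite /T !scalerA; congr (_ *: _); rewrite !exprMn exprD; ring.
have lt1J : (1 < J)%N by [].
have lt0J : (0 < J)%N by [].
have inner i k : (k < J)%N -> \sum_(j < J) (if (i + j == i + k)%N then T i j else 0) = T i k.
  move=> kJ; rewrite (bigD1 (Ordinal kJ)) //= eqxx big1 ?addr0 // => j.
  by rewrite -val_eqE /= eqn_add2l => /negPf ->.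
have GE : G 1%N = T 0%N 1%N + T 1%N 0%N.
  rewrite /G (bigD1 (Ordinal lt0J)) //= (inner 0%N 1%N) //; congr (_ + _).
  rewrite (bigD1 (Ordinal lt1J)) //= (inner 1%N 0%N) // big1 ?addr0 // => i /andP[i0 i1].
  apply: big1 => j _; rewrite ifF //.
  by move: i0 i1; rewrite -!val_eqE /=; case: (nat_of_ord i) => [|[|]].
have /eqP := FG 1%N isT; rewrite subr_eq0 GE /F lt1J /T /= !fact0 !expr1 expr0 !divr1 mulr1 mul1r.
by rewrite -scalerDr => /eqP /(scalerI (@twopii_neq0 R)); rewrite addrC.
Qed.

(** The coefficient of t^k in e^(- t N) Y(e^(t N) u) v = Y(u) e^(- t N) v. *)
Lemma Ng_leibniz n k u v :
  \sum_(i < k.+1) ((-1) ^+ i / (i`!%:R * (k - i)`!%:R)) *: iter i N (vY n (iter (k - i) N u) v) =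
  ((-1) ^+ k / k`!%:R : C) *: vY n u (iter k N v).
Proof.
elim: k v => [|k IH] v; first by rewrite big_ord1 /= expr0 fact0 mulr1.
have h1 : (k.+1%:R : C) != 0 by rewrite pnatr_eq0.
apply: (scalerI h1).
have fne (j : nat) : (j`!%:R : C) != 0 by rewrite pnatr_eq0 -lt0n fact_gt0.
transitivity (- (((-1) ^+ k / k`!%:R : C) *: vY n u (iter k N (N v)))); last first.
  rewrite iterSr scalerA -scaleNr; congr (_ *: _).
  by rewrite exprS factS natrM; field; rewrite fne nat1r h1.
rewrite -IH -sumrN scaler_sumr.
pose P i := ((-1) ^+ i / (i`!%:R * (k.+1 - i)`!%:R) : C).
pose X i := iter i N (vY n (iter (k.+1 - i) N u) v).
have -> : \sum_(i < k.+2) k.+1%:R *: (P i *: X i) =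
   \sum_(i < k.+2) ((i%:R * P i) *: X i + ((k.+1 - i)%:R * P i) *: X i).
  apply: eq_bigr => i _; rewrite scalerA -scalerDl -mulrDl -natrD subnKC // -ltnS //.
rewrite big_split /= big_ord_recl /= mul0r scale0r add0r.
rewrite [X in _ + X]big_ord_recr /= subnn mul0r scale0r addr0 -big_split /=.
apply: eq_bigr => i _; have ik : (i <= k)%N by rewrite -ltnS.
rewrite -[bump 0 i]/(i.+1) /X subSS iterSr Ng_der (linD (iter_Ng_linear i)) scalerDr.
rewrite (subSn ik) iterS.
have c1 : i.+1%:R * P i.+1 = - ((-1) ^+ i / (i`!%:R * (k - i)`!%:R)).
  have h2 : (i.+1%:R : C) != 0 by rewrite pnatr_eq0.
  by rewrite /P subSS exprS factS natrM; field; rewrite !fne nat1r h2.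
have c2 : (k - i).+1%:R * P i = (-1) ^+ i / (i`!%:R * (k - i)`!%:R).
  have h2 : ((k - i).+1%:R : C) != 0 by rewrite pnatr_eq0.
  by rewrite /P (subSn ik) factS natrM; field; rewrite !fne nat1r h2.
by rewrite c1 c2 -iterS !scaleNr addrAC addNr add0r.
Qed.

Lemma unipB1_vwt k u : vwt k u -> vwt k (unipB1 u).
Proof.
move=> hu; have hgu := aut_wt hg hu.
rewrite /unipB1 /unip -scaleN1r; apply: vwtD; last exact: vwtZ.
rewrite /expS; have [r ur hr] := gcomp_seq hV hg (g u).
rewrite (@fsumT _ _ r) //; last by move=> a /hr ->; rewrite scaler0.
elim: r {ur hr} => [|a r IH]; first by rewrite big_nil /vwt linear0.
by rewrite big_cons; apply: vwtD => //; apply: vwtZ; exact: gcomp_vwt.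
Qed.

Lemma polyact_stable (P : V -> Prop) p u : P 0 -> (forall x y, P x -> P y -> P (x + y)) ->
  (forall a x, P x -> P (a *: x)) -> (forall x, P x -> P (unipB1 x)) -> P u -> P (polyact unipB1L p u).
Proof.
move=> P0 PD PZ PM Pu; rewrite /polyact; apply: big_ind => // i _; apply: PZ.
by elim: (nat_of_ord i) => // j IH; rewrite iterS; exact: PM.
Qed.

Lemma Ng_vwt k u : vwt k u -> vwt k (N u).
Proof.
move=> hu; have [J hJ] := unipB1_nilp u; rewrite (Ng_polyact hJ).
apply: (@polyact_stable (vwt k)) => //.
- by rewrite /vwt linear0.
- by move=> x y; exact: vwtD.
- by move=> a x; exact: vwtZ.
- exact: unipB1_vwt.
Qed.

Lemma Ng_geneigen z u : geneigen g z u -> geneigen g z (N u).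
Proof.
move=> hu; have [J hJ] := unipB1_nilp u; rewrite (Ng_polyact hJ).
apply: (@polyact_stable (geneigen g z)) => //.
- exact: geneigen0.
- by move=> x y; exact: geneigenD.
- by move=> a x; exact: geneigenZ.
- by move=> x hx; rewrite (unipB1_geneigen hx); apply: geneigenZ; exact: geneigen_eigshift.
Qed.

Lemma Ng_nilp u : exists J, forall k, (J <= k)%N -> iter k N u = 0.
Proof. by have [J hJ] := unipB1_nilp u; exists J => k; exact: iter_Ng0. Qed.

End AutLog.

(** * Exponents and logarithms of twisted vertex operators *)

Section TwistedModuleTheory.
Variables (R : realType) (V : vsa_data R) (hV : is_vsa V).
Variables (g : {linear V -> V}) (hg : is_vsa_aut g).
Variables (W : twmod_data V) (hW : is_twmod g W) (hB : lower_bounded W).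
Local Notation C := R[i].
Local Notation e2 a := (cexp (twopii R * a)).
Local Notation N := (Ng g).
Local Notation hlf := (Defs.half R).
Implicit Types (u v : V) (w : W).

Lemma homogeneous_ind (P : V -> Prop) : P 0 -> (forall u v, P u -> P v -> P (u + v)) ->
  (forall h a u, vwt h u -> in_strip a -> gen_eig g a u -> P u) -> forall u, P u.
Proof.
move=> P0 PD PH u; have [r ->] := grading_decomp (vgr V) u.
apply: big_ind => // k _; have [s _ ->] := gcomp_decomp hV hg (gproj (vgr V) k u).
apply: big_ind => // a _; have [sa|sa] := boolP (in_strip a).
  apply: (PH k a) => //; last exact: gcomp_gen.
  by apply: gcomp_vwt => //; exact: vwt_gproj.
by rewrite (gcomp_strip hV hg).
Qed.

Lemma tweight_gproj i w : tweight i.1.1 (gproj (tgr W) i w).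
Proof. by move=> j /= ji; rewrite gproj_proj; case: eqP => // e; case: ji; rewrite e. Qed.

Lemma tweight_ind (P : W -> Prop) : P 0 -> (forall w w', P w -> P w' -> P (w + w')) ->
  (forall m w, tweight m w -> P w) -> forall w, P w.
Proof.
move=> P0 PD PH w; have [r ->] := grading_decomp (tgr W) w.
by apply: big_ind => // i _; apply: (PH i.1.1); exact: tweight_gproj.
Qed.

Lemma tweight_geneigen m w : tweight m w -> geneigen (tL0 W) m w.
Proof. exact: tw_L0_nilp hW m w. Qed.

(** The weight spaces are the full generalized eigenspaces of L(0), since
    these are independent. *)
Lemma geneigen_tweight m w : geneigen (tL0 W) m w -> tweight m w.
Proof.
move=> hw i0 /= i0m; have [r ur hr] := grading_seq (tgr W) w.
have [ir|/hr//] := boolP (i0 \in r).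
have wE : w = \sum_(i <- r) gproj (tgr W) i w by rewrite -[LHS](gproj_sum (tgr W)) (@fsumT _ _ r).
have hF i : geneigen (tL0 W) i.1.1 (gproj (tgr W) i w).
  by apply: tweight_geneigen; exact: tweight_gproj.
have := geneigen_sum_proj (s := r) hF wE hw.
move=> /(_ i0.1.1) h.
have /h /(congr1 (gproj (tgr W) i0)) : i0.1.1 != m by apply/eqP.
rewrite raddf_sum linear0 -big_filter (bigD1_seq i0) ?filter_uniq ?mem_filter ?eqxx //=.
rewrite gproj_idem big1 ?addr0 // => i /negPf ii.
by rewrite gproj_proj eq_sym ii.
Qed.

(** The commutator with L(0) involves the coefficient of the next power of log
    x: a downward induction on this power inside an induction on the
    nilpotency order at w. *)
Lemma tY_weight h m n k v w : vwt h v -> tweight m w ->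
  tweight (n + hlf h + m) (tY n k v w).
Proof.
move=> hv hw; apply: geneigen_tweight; have [K] := tweight_geneigen hw.
elim: K w k {hw} => [|K IH] w k hK.
  by rewrite [w]hK (lin0 (tw_linr hW n k v)); exact: geneigen0.
have [Kl hKl] := tw_log hW v w.
have : (Kl <= k + Kl)%N by rewrite leq_addl.
move: {2}Kl => j; elim: j k => [|j IHj] k hk.
  by rewrite hKl ?addn0 //; [exact: geneigen0 | rewrite addn0 in hk].
apply: geneigen_eigshift_inv.
have -> : eigshift (tL0 W) (n + hlf h + m) (tY n k v w) =
   tY n k v (eigshift (tL0 W) m w) + k.+1%:R *: tY n k.+1 v w.
  have /eqP := tw_L0 hW v w n k; rewrite subr_eq => /eqP e.
  rewrite /eigshift e /fxddx (vL0_vwt hv) (linZ (tw_linl hW n k w)).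
  rewrite (linB (tw_linr hW n k v)) (linZ (tw_linr hW n k v)) !scalerDl !opprD.
  move: (tY n k v (tL0 W w)) (n *: _) (hlf h *: _) (m *: _) (k.+1%:R *: _) => A B D E F.
  rewrite -!opprD; apply: (addIr (B + D + E)); rewrite subrK.
  rewrite [RHS](ACl (1*3*(4*2))) /= !addrA addrK.
  by rewrite [LHS](ACl (4*2*1*3)).
apply: geneigenD; first by apply: IH; rewrite -iterSr.
by apply: geneigenZ; apply: IHj; rewrite addSnnS.
Qed.

Lemma tY_trunc : exists B : R, forall h m n k v w, vwt h v -> tweight m w ->
  complex.Re (n + hlf h + m) < B -> tY n k v w = 0.
Proof.
have [B hBB] := hB; exists B => h m n k v w hv hw hlt.
by apply: hBB hlt _; exact: tY_weight.
Qed.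

Lemma tYsub_sum K p z n v w : (forall k, (K <= k)%N -> tY n k v w = 0) ->
  tYsub p z n v w = \sum_(k < K) (cexp (n * lp p z) * lp p z ^+ k) *: tY n k v w.
Proof. by move=> h; apply: fsum_nat => k /h ->; rewrite scaler0. Qed.

Lemma tweight_sum m (I : Type) (r : seq I) (F : I -> W) : (forall i, tweight m (F i)) ->
  tweight m (\sum_(i <- r) F i).
Proof. by move=> h i hi; rewrite raddf_sum big1 // => j _; exact: h. Qed.

Lemma tweightZ m a w : tweight m w -> tweight m (a *: w).
Proof. by move=> h i hi; rewrite linearZ /= h // scaler0. Qed.

Lemma tYsub_weight h m p z n v w : vwt h v -> tweight m w ->
  tweight (n + hlf h + m) (tYsub p z n v w).
Proof.
move=> hv hw; have [K hK] := tw_log hW v w; rewrite (@tYsub_sum K) //; last first.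
  by move=> k; exact: hK.
by apply: tweight_sum => k; apply: tweightZ; exact: tY_weight.
Qed.

(** The equivariance axiom is an equality of sums over all exponents in each
    component of W; the weight of the component selects one exponent. *)
Lemma tYsub_equiv h m n v w (x : R) : vwt h v -> tweight m w ->
  tYsub 1 (expR x)%:C n (g v) w = tYsub 0 (expR x)%:C n v w.
Proof.
move=> hv hw; have hgv := aut_wt hg hv.
apply: (@grading_eq _ _ _ (tgr W)) => i.
have [im|im] := eqVneq i.1.1 (n + hlf h + m); last first.
  move/eqP: im => im; have w0 p v' : vwt h v' -> gproj (tgr W) i (tYsub p (expR x)%:C n v' w) = 0.
    by move=> hv'; apply: (@tYsub_weight h m).
  by rewrite !w0.
have z0 : (expR x)%:C != 0 by rewrite gt_eqF // (realC_lt 0) expR_gt0.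
have := tw_equivariance hW 0 v w i z0; rewrite add0r.
have oth p v' n' : vwt h v' -> n' != n -> gproj (tgr W) i (tYsub p (expR x)%:C n' v' w) = 0.
  move=> hv' nn; apply: (@tYsub_weight h m) => //; rewrite /= im => e; case/negP: nn.
  by move: e => /addIr /addIr ->.
by rewrite !(@fsumT1 _ _ n) //= => n' nn; exact: oth.
Qed.

Section LogStructure.
Variables (phi : {scalar W}) (n m : C) (h : int) (w : W) (hw : tweight m w).

(** The coefficient of x^n as a polynomial in log x. *)
Definition logpoly v : {poly C} :=
  \poly_(k < projT1 (cid (tw_log hW v w))) phi (tY n k v w).

Lemma coef_logpoly v k : (logpoly v)`_k = phi (tY n k v w).
Proof.
rewrite coef_poly; case: ifP => // /negbT; rewrite -leqNgt.
by case: cid => K /= hK /hK ->; rewrite linear0.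
Qed.

Lemma logpoly_linear a u v : logpoly (a *: u + v) = a *: logpoly u + logpoly v.
Proof.
apply/polyP => k; rewrite coefD coefZ !coef_logpoly (tw_linl hW n k w).
by rewrite linearD linearZ.
Qed.

Lemma logpoly_tYsub v p (x : R) : phi (tYsub p (expR x)%:C n v w) =
  cexp (n * (x%:C + p%:~R * twopii R)) * (logpoly v).[x%:C + p%:~R * twopii R].
Proof.
have [K hK] := tw_log hW v w.
rewrite (@tYsub_sum K); last by move=> k; exact: hK.
have -> : lp p (expR x)%:C = x%:C + p%:~R * twopii R by rewrite lp_pos ?expR_gt0 // expRK.
rewrite linear_sum (@horner_coef_wide _ K) ?mulr_sumr; last first.
  by apply/leq_sizeP => k /hK e; rewrite coef_logpoly e linear0.
apply: eq_bigr => k _; rewrite linearZ /= coef_logpoly; ring.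
Qed.

(** Equivariance: passing from l_0 to l_1 adds 2 pi i to log x. *)
Lemma logpoly_equiv v : vwt h v ->
  e2 n *: (logpoly (g v) \Po ('X + (twopii R)%:P)) = logpoly v.
Proof.
move=> hv; apply/eqP; rewrite -subr_eq0; apply/eqP.
apply: (@poly_eq0_inj _ (fun k : nat => k%:R)).
  by move=> i j /eqP; rewrite eqr_nat => /eqP.
move=> k; rewrite hornerD hornerN hornerZ horner_comp hornerD hornerX hornerC.
have := congr1 phi (tYsub_equiv n (k%:R : R) hv hw); rewrite !logpoly_tYsub.
rewrite mul1r mul0r addr0 rmorph_nat mulrDr cexpD -mulrA => /(mulfI (cexp_neq0 _)).
by rewrite [n * twopii R]mulrC => ->; rewrite subrr.
Qed.

(** Translations preserve leading coefficients. *)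
Lemma logpoly_shift_eq0 (p : {poly C}) (mu c : C) : mu != 1 -> mu *: (p \Po ('X + c%:P)) = p -> p = 0.
Proof.
move=> mu1 e; apply/eqP; rewrite -lead_coef_eq0.
have := congr1 (fun q : {poly C} => q`_(size p).-1) e.
rewrite coefZ lead_coef_shift -lead_coefE => /eqP.
rewrite -subr_eq0 -[X in _ - X]mul1r -mulrBl mulf_eq0 subr_eq0 (negPf mu1).
by [].
Qed.

(** For an eigenvector, equivariance equates the leading coefficient with its
    multiple by e^(2 pi i (n + a)); generalized eigenvectors follow by
    induction. *)
Lemma logpoly_eq0 a v : vwt h v -> gen_eig g a v -> e2 (n + a) != 1 -> logpoly v = 0.
Proof.
move=> hv [J]; elim: J v hv => [|J IH] v hv hJ hne.
  rewrite [v]hJ; apply/polyP => k; rewrite coef_logpoly coef0.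
  by rewrite (lin0 (tw_linl hW n k w)) linear0.
have hv' : vwt h (eigshift g (e2 a) v).
  by rewrite /eigshift -scaleNr addrC; apply: vwtD; [exact: vwtZ | exact: aut_wt].
have := IH _ hv' _ hne; rewrite -iterSr => /(_ hJ) h0.
have gv : logpoly (g v) = e2 a *: logpoly v.
  have -> : g v = e2 a *: v + eigshift g (e2 a) v by rewrite /eigshift addrC subrK.
  by rewrite logpoly_linear h0 addr0.
apply: (logpoly_shift_eq0 hne (c := twopii R)).
rewrite mulrDr cexpD -scalerA -[RHS](logpoly_equiv hv) gv.
by rewrite comp_polyZ.
Qed.

(** When n lies in - a + Z, the semisimple part of g cancels the monodromy of
    x^n. *)
Lemma logpoly_unip a v : vwt h v -> gen_eig g a v -> e2 (n + a) = 1 ->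
  logpoly (unip g v) \Po ('X + (twopii R)%:P) = logpoly v.
Proof.
move=> hv ha e; rewrite (unip_geneigen hV hg (z := e2 a) ha) -[X in logpoly X]addr0 logpoly_linear.
have -> : logpoly 0 = 0.
  by apply/polyP => k; rewrite coef_logpoly coef0 (lin0 (tw_linl hW n k w)) linear0.
rewrite addr0 comp_polyZ -[RHS](logpoly_equiv hv); congr (_ *: _).
by apply: (mulIf (cexp_neq0 (twopii R * a))); rewrite mulVf ?cexp_neq0 // -cexpD -mulrDr.
Qed.

(** By the preceding lemma the value of the polynomial of v at - 2 pi i j is
    that of e^(2 pi i j N_g) v at 0.  Both are polynomial in j; compare
    coefficients. *)
Lemma logpoly_N a v k : vwt h v -> gen_eig g a v -> e2 (n + a) = 1 ->
  phi (tY n k v w) = (-1) ^+ k / k`!%:R * phi (tY n 0 (iter k N v) w).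
Proof.
move=> hv ha e; have [J hJ] := unipB1_nilp hV hg v.
pose c := twopii R; have c0 : c != 0 := twopii_neq0 R.
pose K := maxn (maxn J (size (logpoly v))) k.+1.
have hJ' : iter K (unipB1 g) v = 0 by apply: (iter_unipB1_le hV hg) hJ; rewrite /K; lia.
have it (j : nat) : (logpoly (iter j (unip g) v)).[0] = (logpoly v).[- (c * j%:R)].
  have st : forall i v', vwt h v' -> gen_eig g a v' ->
      logpoly (iter i (unip g) v') \Po ('X + (c * i%:R)%:P) = logpoly v'.
    elim=> [|i IH] v' hv' ha'; first by rewrite mulr0 addr0 comp_polyXr.
    have hU1 : vwt h (unip g v').
      have -> : unip g v' = unipB1 g v' + v' by rewrite subrK.
      by apply: vwtD => //; exact: unipB1_vwt.
    have hU2 : gen_eig g a (unip g v').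
      by rewrite (unip_geneigen hV hg (z := e2 a) ha'); apply: geneigenZ; exact: geneigen_app.
    rewrite -[RHS](logpoly_unip hv' ha' e) -(IH _ hU1 hU2) -iterSr.
    rewrite -comp_polyA; congr (_ \Po _).
    rewrite comp_polyD comp_polyX comp_polyC -addrA -polyCD; congr (_ + _%:P).
    by rewrite -natr1 /c; ring.
  rewrite -(st j v hv ha) horner_comp hornerD hornerX hornerC addNr //.
have key := @poly_coefs_eq0 R R[i]^o K (fun i =>
  (c ^+ i / i`!%:R) *: (phi (tY n 0 (iter i N v) w) : R[i]^o) - (- c) ^+ i *: (phi (tY n i v w) : R[i]^o)).
have : (c ^+ k / k`!%:R) *: (phi (tY n 0 (iter k N v) w) : R[i]^o) - (- c) ^+ k *: (phi (tY n k v w) : R[i]^o) = 0.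
  apply: key; last by rewrite /K; lia.
  move=> j; under eq_bigr do rewrite scalerBr; rewrite sumrB; apply/eqP; rewrite subr_eq0; apply/eqP.
  transitivity (logpoly (iter j (unip g) v)).[0].
    rewrite horner_coef0 coef_logpoly (iter_unip hV hg _ hJ') (lin_sum (tw_linl hW n 0 w)) linear_sum.
    apply: eq_bigr => i _; rewrite (linZ (tw_linl hW n 0 w)) scalerA.
    by rewrite [RHS]linearZ /= -[LHS]/(_ * _) exprMn -/c; ring.
  rewrite it (@horner_coef_wide _ K); last by rewrite /K; lia.
  apply: eq_bigr => i _; rewrite coef_logpoly scalerA mulrC; congr (_ * _).
  by rewrite -mulNr exprMn mulrC.
move/eqP; rewrite subr_eq0 => /eqP; rewrite -[_ *: _]/(_ * _) -[in RHS]/(_ * _).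
move=> ek; have ck : (- c) ^+ k != 0 by rewrite expf_neq0 // oppr_eq0.
apply: (mulfI ck); rewrite -[LHS]ek mulrA; congr (_ * _).
rewrite mulrA -exprMn mulrN1 opprK //.
Qed.

End LogStructure.

(** The condition on n says that n does not lie in - a + Z. *)
Lemma tY_exponent a n k v w : gen_eig g a v -> e2 (n + a) != 1 -> tY n k v w = 0.
Proof.
move=> ha hne.
have [r rE] := grading_decomp (vgr V) v.
rewrite rE (lin_sum (tw_linl hW n k w)) big1 // => h _.
have hh : gen_eig g a (gproj (vgr V) h v).
  have [J hJ] := ha; exists J.
  rewrite -[RHS](linear0 (gproj (vgr V) h)) -[X in _ = gproj _ _ X]hJ.
  elim: (J) => // j IH; rewrite !iterS IH (linearB (gproj (vgr V) h)) (linearZZ (gproj (vgr V) h)).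
  by rewrite aut_gproj.
apply: (tweight_ind (P := fun w => tY n k (gproj (vgr V) h v) w = 0)).
- exact: (lin0 (tw_linr hW n k _)).
- by move=> x y hx hy; rewrite (linD (tw_linr hW n k _)) hx hy addr0.
move=> m {}w hw; apply: functional_sep => phi; rewrite linear0.
by rewrite -(coef_logpoly phi) (logpoly_eq0 phi hw (vwt_gproj h v) hh hne) coef0.
Qed.

(** That is, Y(v, x) = Y_0(x^(- N_g) v, x) where Y_0 is the part of Y without
    logarithms. *)
Lemma tY_log n k v w : tY n k v w = ((-1) ^+ k / k`!%:R) *: tY n 0 (iter k N v) w.
Proof.
apply: (tweight_ind (P := fun w => tY n k v w = ((-1) ^+ k / k`!%:R) *: tY n 0 (iter k N v) w)).
- by rewrite !(lin0 (tw_linr hW n _ _)) scaler0.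
- by move=> x y hx hy; rewrite !(linD (tw_linr hW n _ _)) hx hy scalerDr.
move=> m {}w hw; move: v; apply: homogeneous_ind.
- rewrite (lin0 (iter_Ng_linear hV hg k)) (lin0 (tw_linl hW n k w)).
  by rewrite (lin0 (tw_linl hW n 0 w)) scaler0.
- move=> x y hx hy; rewrite (linD (iter_Ng_linear hV hg k)) (linD (tw_linl hW n k w)).
  by rewrite hx hy (linD (tw_linl hW n 0 w)) scalerDr.
move=> h a v hv sa ha.
have [e|e] := eqVneq (e2 (n + a)) 1.
  by apply: functional_sep => phi; rewrite (@logpoly_N phi n m h w hw a v k hv ha e) linearZ.
rewrite (tY_exponent _ _ ha e) (@tY_exponent a) ?scaler0 //.
by elim: (k) => // j IH; rewrite iterS; exact: Ng_geneigen.
Qed.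

End TwistedModuleTheory.

(** * Summable families *)

Section Summation.
Variable R : realType.
Local Notation C := R[i].

(** Absolute convergence by bounds on finite partial sums, which pass to
    reindexed subfamilies and linear combinations at once. *)
Definition absbounded (I : choiceType) (F : I -> C) := exists M : C, forall B : {fset I},
  \sum_(i <- B) `|F i| <= M.

Lemma abs_conv_absbounded (I : choiceType) (F : I -> C) : abs_conv F -> absbounded F.
Proof.
rewrite /abs_conv /summable => hF.
have [M hM] : exists M : R, (\esum_(i in [set: I]) `|(cmod (F i))%:E|)%E = M%:E.
  have h0 : (0 <= \esum_(i in [set: I]) `|(cmod (F i))%:E|)%E by apply: esum_ge0.
  move: hF h0; case: (esum _ _) => [M||] //= _ _; by exists M.
exists M%:C => B.
have : (\sum_(i <- B) `|(cmod (F i))%:E| <= M%:E)%E.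
  rewrite -hM; apply: ereal_sup_ubound; exists [set` B].
    by rewrite /fsets /=; split; [exact: finite_fset | ].
  by rewrite -fsbig_seq.
under eq_bigr do rewrite abse_EFin ger0_norm ?cmod_ge0 //.
rewrite sumEFin lee_fin => h.
under eq_bigr do rewrite -cmodE.
by rewrite -rmorph_sum (realC_le).
Qed.

Lemma absboundedD (I : choiceType) (F G : I -> C) : absbounded F -> absbounded G -> absbounded (fun i => F i + G i).
Proof.
move=> [M hM] [M' hM']; exists (M + M') => B.
apply: le_trans (lerD (hM B) (hM' B)); rewrite -big_split.
by apply: ler_sum => i _; exact: ler_normD.
Qed.

Lemma absboundedZ (I : choiceType) (F : I -> C) z : absbounded F -> absbounded (fun i => z * F i).
Proof.
move=> [M hM]; exists (`|z| * M) => B; apply: le_trans (ler_wpM2l (normr_ge0 z) (hM B)).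
by rewrite mulr_sumr; apply: ler_sum => i _; rewrite normrM.
Qed.

Lemma absbounded_sum (I : choiceType) (J : Type) (r : seq J) (F : J -> I -> C) :
  (forall j, absbounded (F j)) -> absbounded (fun i => \sum_(j <- r) F j i).
Proof.
move=> h; elim: r => [|k r IH].
  by exists 0 => B; rewrite big1 // => i _; rewrite big_nil normr0.
rewrite (_ : (fun i => _) = (fun i => F k i + \sum_(j <- r) F j i)); first exact: absboundedD.
by apply: funext => i; rewrite big_cons.
Qed.

Lemma has_sumD (I : choiceType) (F G : I -> C) s t : has_sum F s -> has_sum G t ->
  has_sum (fun i => F i + G i) (s + t).
Proof.
move=> hF hG e e0; have e2 : 0 < e / 2 by rewrite divr_gt0.
have [A hA] := hF _ e2; have [A' hA'] := hG _ e2.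
exists (A `|` A')%fset => B AB.
have h1 := hA B (fsubset_trans (fsubsetUl _ _) AB).
have h2 := hA' B (fsubset_trans (fsubsetUr _ _) AB).
rewrite big_split /= opprD addrACA -realC_lt cmodE.
apply: le_lt_trans (ler_normD _ _) _.
by rewrite [e](splitr e) rmorphD ltrD // -cmodE realC_lt.
Qed.

Lemma has_sumZ (I : choiceType) (F : I -> C) s z : has_sum F s ->
  has_sum (fun i => z * F i) (z * s).
Proof.
move=> hF e e0; have z1 : 0 < cmod z + 1 by rewrite ltr_wpDl ?cmod_ge0.
have [A hA] := hF _ (divr_gt0 e0 z1); exists A => B /hA.
rewrite -mulr_sumr -mulrBr => h; rewrite -realC_lt cmodE normrM -!cmodE -rmorphM realC_lt.
apply: le_lt_trans (_ : (cmod z + 1) * cmod (\sum_(i <- B) F i - s) < _).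
  by rewrite ler_wpM2r ?cmod_ge0 // lerDl.
by rewrite mulrC -ltr_pdivlMr.
Qed.

Lemma has_sum_sum (I : choiceType) (J : Type) (r : seq J) (F : J -> I -> C) s :
  (forall j, has_sum (F j) (s j)) ->
  has_sum (fun i => \sum_(j <- r) F j i) (\sum_(j <- r) s j).
Proof.
move=> h; elim: r => [|k r IH].
  move=> e e0; exists fset0 => B _; rewrite big_nil subr0 big1 => [|i _]; last by rewrite big_nil.
  by rewrite /cmod normr0.
rewrite big_cons (_ : (fun i => _) = (fun i => F k i + \sum_(j <- r) F j i)).
  exact: has_sumD.
by apply: funext => i; rewrite big_cons.
Qed.

Section Reindex.
Variables (I : choiceType) (F : I -> C) (f : nat -> I).
Hypothesis f_inj : injective f.
Hypothesis f_supp : forall i, (forall n, i != f n) -> F i = 0.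

Lemma has_sum_seriessum s : has_sum F s -> seriessum (fun n => F (f n)) s.
Proof.
move=> hF e e0.
have eE : e = (complex.Re e)%:C by case: e e0 => a b; rewrite ltcE /= => /andP[/eqP -> _].
have [A hA] := hF (complex.Re e) (ltac:(by rewrite -realC_lt -eE)).
have [K0 hK0] : exists K0 : nat, forall n, f n \in A -> (n < K0)%N.
  have [r _ hr] : exists2 r : seq nat, uniq r & forall n, f n \in A -> n \in r.
    have fin : finite_set (f @^-1` [set` A]).
      by apply: finite_preimage; [move=> x y _ _; exact: f_inj | exact: finite_fset].
    have [r ur hr] := finite_set_seq fin; exists r => // n nA.
    by apply: contrapT => /negP /hr; apply.
  exists (\max_(n <- r) n).+1 => n /hr nr; rewrite ltnS.
  by rewrite (big_rem n nr) /= leq_maxl.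
exists K0 => K KK.
pose B := (A `|` [fset f n | n in iota 0 K])%fset.
have := hA B (fsubsetUl _ _).
suff -> : \sum_(i <- B) F i = \sum_(n < K) F (f n) by rewrite -realC_lt cmodE -eE.
rewrite -(big_mkord predT (fun n => F (f n))) /index_iota subn0.
rewrite -(big_map f predT F) /=.
rewrite (bigID (mem [seq f n | n <- iota 0 K])) /= [X in _ + X]big1_seq ?addr0.
  rewrite -big_filter; apply: perm_big; apply: uniq_perm.
  - by rewrite filter_uniq ?fset_uniq.
  - by rewrite map_inj_uniq ?iota_uniq.
  move=> i; rewrite mem_filter /B; apply/andP/idP => [[]//|h]; split=> //.
  rewrite in_fsetU; apply/orP; right; have /mapP[n nK ->] := h.
  by apply/imfsetP; exists n.
move=> i /andP[hi]; rewrite /B in_fsetU => /orP[iA|/imfsetP[n /= nK iE]]; last first.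
  by case/negP: hi; rewrite iE map_f.
apply: f_supp => n; apply/negP => /eqP iE; case/negP: hi; rewrite iE map_f //.
by rewrite mem_iota /= add0n (leq_trans _ KK) // hK0 // -iE.
Qed.

Lemma absbounded_seriesabs : absbounded F -> seriesabs (fun n => F (f n)).
Proof.
move=> [M hM]; exists M => K.
have := hM [fset f n | n in iota 0 K]%fset.
rewrite big_imfset /=; last by move=> x y _ _; exact: f_inj.
by rewrite undup_id ?iota_uniq // -(big_mkord predT (fun n => `|F (f n)|)) /index_iota subn0.
Qed.
End Reindex.

Definition isqp (f : R -> C) := exists s, forall x, qp s x = f x.

Lemma isqpD f h : isqp f -> isqp h -> isqp (fun x => f x + h x).
Proof. by move=> [s hs] [t ht]; exists (s ++ t) => x; rewrite qp_cat hs ht. Qed.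

Lemma isqp0 : isqp (fun=> 0).
Proof. by exists [::] => x; rewrite /qp big_nil. Qed.

Lemma isqp_sum (J : Type) (r : seq J) (f : J -> R -> C) : (forall j, isqp (f j)) ->
  isqp (fun x => \sum_(j <- r) f j x).
Proof.
move=> h; elim: r => [|k r [s hs]].
  by have [s hs] := isqp0; exists s => x; rewrite hs big_nil.
by have [t ht] := h k; exists (t ++ s) => x; rewrite qp_cat hs ht big_cons.
Qed.

Lemma isqpM m (p : {poly C}) f : isqp f -> isqp (fun x => cexp (m * x%:C) * p.[x%:C] * f x).
Proof.
move=> [s hs]; exists [seq (m + mp.1, p * mp.2) | mp <- s] => x.
rewrite /qp big_map -hs /qp mulr_sumr; apply: eq_bigr => mp _ /=.
by rewrite mulrDl cexpD hornerM; ring.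
Qed.

Lemma isqp_ext f h : (forall x, f x = h x) -> isqp f -> isqp h.
Proof. by move=> /funext ->. Qed.

Lemma isqp_cst c : isqp (fun=> c).
Proof.
exists [:: (0, c%:P)] => x; rewrite /qp big_seq1 /= mul0r cexp0 mul1r hornerC //.
Qed.

(** With this the functions f that duality provides for the vectors N_g^j u
    are brought to a common order of the pole at z = 1. *)
Lemma isqp_expB1 f k : isqp f -> isqp (fun x => (cexp x%:C - 1) ^+ k * f x).
Proof.
move=> hf; elim: k => [|k IH]; first by apply: isqp_ext hf => x; rewrite expr0 mul1r.
have h1 := isqpM 1 1 IH; have h2 := isqpM 0 (- 1) IH.
apply: isqp_ext (isqpD h1 h2) => x.
by rewrite exprS mul1r mul0r cexp0 hornerN !hornerC; ring.
Qed.

End Summation.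

(** The coefficients of e^(x T) e^(- x T) = 1, with T^n replaced by X_n. *)
Lemma exp_mul_expN (R : realType) (V : lmodType R[i]) (J : nat) (X : nat -> V) (x : R[i]) :
  (0 < J)%N -> (forall n, (J <= n)%N -> X n = 0) ->
  \sum_(j < J) \sum_(k < J) ((x ^+ j / j`!%:R) * ((-1) ^+ k / k`!%:R * x ^+ k)) *: X (j + k)%N = X 0%N.
Proof.
move=> J0 hX.
pose T j k := (x ^+ j / j`!%:R) * ((-1) ^+ k / k`!%:R * x ^+ k).
transitivity (\sum_(n < J) (\sum_(j < n.+1) T j (n - j)%N) *: X n).
  transitivity (\sum_(j < J) \sum_(k < J) \sum_(n < J) (if (j + k == n)%N then T j k *: X n else 0)).
    apply: eq_bigr => j _; apply: eq_bigr => k _.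
    have [jk|jk] := ltnP (j + k) J.
      rewrite (bigD1 (Ordinal jk)) //= eqxx big1 ?addr0 // => n.
      by rewrite -val_eqE /= eq_sym => /negPf ->.
    rewrite hX // scaler0 big1 // => n _; rewrite ifF //.
    by have := ltn_ord n; apply: contraTF => /eqP <-; rewrite -leqNgt.
  under eq_bigr do rewrite exchange_big.
  rewrite exchange_big; apply: eq_bigr => n _; rewrite scaler_suml.
  have nJ : (n.+1 <= J)%N by [].
  rewrite -(big_mkord predT (fun j => \sum_(k < J) (if (j + k == n)%N then T j k *: X n else 0))).
  rewrite (big_cat_nat (leq0n _) nJ) /= [X in _ + X]big1_seq ?addr0; last first.
    move=> j; rewrite mem_index_iota => /andP[_ /andP[nj _]]; apply: big1 => k _.
    by rewrite ifF //; apply/negP => /eqP e; move: nj; rewrite -e ltnNge leq_addr.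
  rewrite big_mkord; apply: eq_bigr => j _.
  have jn : (j <= n)%N by rewrite -ltnS.
  have kJ : (n - j < J)%N by rewrite (leq_ltn_trans (leq_subr _ _)).
  rewrite (bigD1 (Ordinal kJ)) //= subnKC // eqxx big1 ?addr0 // => k.
  rewrite -val_eqE /= => kn; rewrite ifF //; apply/negP => /eqP e; case/negP: kn.
  by rewrite -(addKn j k) e.
rewrite (bigD1 (Ordinal J0)) //= [X in _ + X]big1 ?addr0.
  by rewrite big_ord1 /T !expr0 fact0 !divr1 !mulr1 scale1r.
move=> n; rewrite -val_eqE /= => n0.
rewrite [X in X *: _](_ : _ = 0) ?scale0r //.
transitivity (x ^+ n / n`!%:R * (-1 + 1) ^+ n); last by rewrite addNr expr0n (negPf n0) mulr0.
rewrite exprDn mulr_sumr; apply: eq_bigr => j _.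
have jn : (j <= n)%N by rewrite -ltnS.
rewrite expr1n mulr1 -[_ *+ 'C(n, j)]mulr_natl /T.
have -> : ('C(n, j)%:R : R[i]) = n`!%:R / (j`!%:R * (n - j)`!%:R).
  rewrite -(bin_fact jn) !natrM mulfK // mulf_neq0 // pnatr_eq0 -lt0n fact_gt0 //.
have -> : x ^+ n = x ^+ j * x ^+ (n - j) by rewrite -exprD subnKC.
have fne (i : nat) : (i`!%:R : R[i]) != 0 by rewrite pnatr_eq0 -lt0n fact_gt0.
by field; rewrite !fne.
Qed.

(** * Duality on the positive half-line *)

Lemma sum_ord_stable (M : nmodType) (F : nat -> M) J T :
  (J <= T)%N -> (forall k, (J <= k)%N -> F k = 0) ->
  \sum_(j < T) F j = \sum_(j < J) F j.
Proof.
move=> JT F0; rewrite -!(big_mkord predT F) (@big_cat_nat _ _ _ J) //=.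
by rewrite [X in _ + X]big_nat_cond [X in _ + X]big1 ?addr0 // => k /andP[/andP[/F0]].
Qed.

Section CoreIdentity.
Variables (R : realType) (V : vsa_data R) (hV : is_vsa V).
Variables (g : {linear V -> V}) (hg : is_vsa_aut g).
Variables (W : twmod_data V) (hW : is_twmod g W) (hB : lower_bounded W).
Local Notation C := R[i].
Local Notation e2 a := (cexp (twopii R * a)).
Local Notation N := (Ng g).
Local Notation hlf := (Defs.half R).
Implicit Types (u v : V) (w : W) (x : R).

Lemma vparity_vwt b h u : vwt h u -> odd `|h|%N = b -> vparity b u.
Proof.
move=> hu hb i /= ib; apply: (vwt_other hu).
by apply/negP => /eqP e; apply: ib; rewrite e.
Qed.

Lemma iter_Ng_vwt h j u : vwt h u -> vwt h (iter j N u).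
Proof. by move=> hu; elim: j => // j IH; rewrite iterS; exact: Ng_vwt. Qed.

Lemma iter_Ng_gen_eig a j u : gen_eig g a u -> gen_eig g a (iter j N u).
Proof. by move=> hu; elim: j => // j IH; rewrite iterS; exact: Ng_geneigen. Qed.

(** Duality for z2 = 1 and z1 = e^x, where the logarithms are 0 and x: the
    function f is a quasi-polynomial in x over a power of z1 - 1.  In the
    iterate the variable is z1 - 1. *)
Lemma duality_real bu bv u v w (phi : {scalar W}) :
  vparity bu u -> vparity bv v -> graded_dual (tgr W) phi ->
  exists (f : R -> C) (t : nat), isqp f /\ [/\
    forall x, 0 < x -> let F := fun rs : C * C =>
      phi (tYsub 0 (expR x)%:C rs.1 u (tYsub 0 1%:C rs.2 v w)) in
      absbounded F /\ has_sum F (f x / (cexp x%:C - 1) ^+ t),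
    forall x, x < 0 -> let F := fun rs : C * C =>
      (-1) ^+ (bu && bv) * phi (tYsub 0 1%:C rs.2 v (tYsub 0 (expR x)%:C rs.1 u w)) in
      absbounded F /\ has_sum F (f x / (cexp x%:C - 1) ^+ t) &
    forall x, 0 < x < 1 -> let F := fun rs : int * C =>
      x%:C ^ rs.1 * phi (tYsub 0 1%:C rs.2 (vY rs.1 u v) w) in
      absbounded F /\ has_sum F (f (ln (1 + x)) / x%:C ^+ t)].
Proof.
move=> hu hv hphi; have [K [t [a [m [n H]]]]] := tw_duality hW w hu hv hphi.
pose f x : C := \sum_(i < K.+1) \sum_(j < K.+1) \sum_(k < K.+1) \sum_(l < K.+1)
  a i j k l * cexp (m i * x%:C) * cexp (n j * 0) * x%:C ^+ k * 0 ^+ l.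
have l1 : lp 0 (1 : R)%:C = 0 by rewrite lp0_pos ?ln1.
have lz x : lp 0 (expR x)%:C = x%:C by rewrite lp0_pos ?expR_gt0 // expRK.
have fE x (d : C) : \sum_(i < K.+1) \sum_(j < K.+1) \sum_(k < K.+1) \sum_(l < K.+1)
    a i j k l * cexp (m i * x%:C) * cexp (n j * 0) * x%:C ^+ k * 0 ^+ l / d = f x / d.
  by rewrite /f; do 4! (rewrite mulr_suml; apply: eq_bigr => ? _).
have e1 x : (expR x)%:C - 1%:C = cexp x%:C - 1 by rewrite cexp_real.
have n1 : `|(1 : R)%:C| = 1 by rewrite norm_realC normr1.
have nx x : `|(expR x)%:C| = (expR x)%:C by rewrite norm_realC ger0_norm ?expR_ge0.
exists f, t; split.
  apply: isqp_sum => i; apply: isqp_sum => j; apply: isqp_sum => k; apply: isqp_sum => l.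
  apply: isqp_ext (isqpM (m i) 'X^k (isqp_cst (a i j k l * cexp (n j * 0) * 0 ^+ l))) => x.
  by rewrite hornerXn; ring.
split.
- move=> x x0 F; have [+ _ _] := H 0 (expR x)%:C 1%:C.
  rewrite l1 lz n1 nx fE e1 ltr01 (realC_lt 1) expR_gt1 => /(_ x0)[h1 h2].
  by split => //; exact: abs_conv_absbounded.
- move=> x x0 F; have [_ + _] := H 0 (expR x)%:C 1%:C.
  rewrite l1 lz n1 nx fE e1 (realC_lt 0) (realC_lt _ 1) expR_gt0 expR_lt1 => /(_ x0)[h1 h2].
  by split => //; exact: abs_conv_absbounded.
move=> x /andP[x0 x1] F; have x2 : 0 < 1 + x by rewrite addr_gt0.
have [_ _] := H 0 (expR (ln (1 + x)))%:C 1%:C.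
have e3 : (expR (ln (1 + x)))%:C - 1%:C = x%:C.
  by rewrite lnK ?posrE // rmorphD /= addrC addKr.
rewrite l1 lz fE e3 n1 norm_realC gtr0_norm // (realC_lt 0) (realC_lt _ 1) x0 x1.
rewrite !arg_pos ?expR_gt0 // subrr normr0 divr_gt0 ?pi_gt0 // => /(_ isT)[h1 /(_ isT) h2].
by split => //; exact: abs_conv_absbounded.
Qed.

Lemma tYsub_one n v w : tYsub 0 1%:C n v w = tY n 0 v w.
Proof.
have [K hK] := tw_log hW v w; rewrite (@tYsub_sum _ _ _ K.+1); last by move=> k /ltnW; exact: hK.
have l1 : lp 0 (1 : R)%:C = 0 by rewrite lp0_pos ?ln1.
rewrite l1 mulr0 cexp0 big_ord_recl expr0 mulr1 scale1r big1 ?addr0 // => k _.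
by rewrite expr0n mulr0 scale0r.
Qed.

Lemma tYsub_exp J x n v w : (forall k, (J <= k)%N -> iter k N v = 0) ->
  tYsub 0 (expR x)%:C n v w = \sum_(k < J)
     (cexp (n * x%:C) * ((-1) ^+ k / k`!%:R * x%:C ^+ k)) *: tY n 0 (iter k N v) w.
Proof.
move=> hJ; rewrite (@tYsub_sum _ _ _ J); last first.
  by move=> k /hJ e; rewrite (tY_log hV hg hW) e (lin0 (tw_linl hW n 0 w)) scaler0.
have lz : lp 0 (expR x)%:C = x%:C by rewrite lp0_pos ?expR_gt0 // expRK.
rewrite lz; apply: eq_bigr => k _; rewrite (tY_log hV hg hW) scalerA; congr (_ *: _).
by ring.
Qed.

(** Inserting z^(N_g) u, with z = e^x, cancels the factor x^(- N_g) that
    carries the logarithms. *)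
Lemma tYsub_unlog J x n u w : (0 < J)%N -> (forall k, (J <= k)%N -> iter k N u = 0) ->
  \sum_(j < J) (x%:C ^+ j / j`!%:R) *: tYsub 0 (expR x)%:C n (iter j N u) w =
  cexp (n * x%:C) *: tY n 0 u w.
Proof.
move=> J0 hJ.
have h0 := @exp_mul_expN R W J (fun k => tY n 0 (iter k N u) w) x%:C J0.
rewrite -[tY n 0 u w]h0; last by move=> k /hJ ->; rewrite (lin0 (tw_linl hW n 0 w)).
rewrite scaler_sumr; apply: eq_bigr => j _.
rewrite (@tYsub_exp J); last first.
  by move=> k Jk; rewrite -iterD hJ // (leq_trans Jk) // leq_addr.
rewrite !scaler_sumr; apply: eq_bigr => k _.
by rewrite !scalerA -iterD addnC; congr (_ *: _); ring.
Qed.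

Lemma cexp_twopii_neq1 (z : C) : (forall n : int, z != n%:~R) -> e2 z != 1.
Proof.
move=> hz; apply/negP => /eqP e.
have [n] : exists n : int, z - 0 = n%:~R by apply: cexp_twopii_inj; rewrite mulr0 cexp0.
by rewrite subr0 => zn; case/negP: (hz n); apply/eqP.
Qed.

Section Homogeneous.
Variables (h h' : int) (a m : C) (bu bv : bool) (u v : V) (w : W).
Hypotheses (hu : vwt h u) (ha : gen_eig g a u) (hbu : odd `|h|%N = bu).
Hypotheses (hv : vwt h' v) (hbv : odd `|h'|%N = bv) (hw : tweight m w).

Section Functional.
Variables (phi0 : {scalar W}) (i0 : C * bool * C).
Let phi : {scalar W} := phi0 \o gproj (tgr W) i0.
Let D := i0.1.1 - m - hlf h - hlf h'.

Let phiZ c y : phi (c *: y) = c * phi y.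
Proof. by rewrite linearZ. Qed.

Let phi_sum n (F : 'I_n -> W) : phi (\sum_(i < n) F i) = \sum_(i < n) phi (F i).
Proof. by rewrite linear_sum. Qed.

Let phi_eq0 l y : tweight l y -> l != i0.1.1 -> phi y = 0.
Proof.
move=> hy hl; rewrite /phi /= hy ?linear0 //= => e.
by rewrite e eqxx in hl.
Qed.

Let phi12 r s j : r + s != D -> phi (tY r 0 (iter j N u) (tY s 0 v w)) = 0.
Proof.
move=> rs; apply: (@phi_eq0 (r + hlf h + (s + hlf h' + m))).
  apply: (tY_weight hW); first exact: iter_Ng_vwt.
  exact: (tY_weight hW).
by apply: contra rs => /eqP e; rewrite /D -e; apply/eqP; ring.
Qed.

Let phi21 r s j : r + s != D -> phi (tY s 0 v (tY r 0 (iter j N u) w)) = 0.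
Proof.
move=> rs; apply: (@phi_eq0 (s + hlf h' + (r + hlf h + m))).
  apply: (tY_weight hW) => //.
  by apply: (tY_weight hW) => //; exact: iter_Ng_vwt.
by apply: contra rs => /eqP e; rewrite /D -e; apply/eqP; ring.
Qed.

Let phi_it s p j : p%:~R + s != D -> phi (tY s 0 (vY p (iter j N u) v) w) = 0.
Proof.
move=> rs; apply: (@phi_eq0 (s + hlf (p *+ 2 + h + h') + m)).
  by apply: (tY_weight hW) => //; apply: vwt_vY => //; exact: iter_Ng_vwt.
apply: contra rs => /eqP e; rewrite /D -e /Defs.half mulr2n !intrD; apply/eqP.
by field.
Qed.

Let phi_dual : graded_dual (tgr W) phi.
Proof. exact: graded_dual_comp. Qed.

(** The residue theorem for the matrix coefficients in one component.  The
    functional phi is nonzero on a single weight, so only pairs of exponents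
    of sum D contribute, and all series of the duality are series in one
    variable. *)
Lemma core_functional (n : int) :
  exists T0, forall T, (T0 <= T)%N ->
  phi (tY (- 1 - n%:~R - a) 0 u (tY (D - (- 1 - n%:~R - a)) 0 v w)) -
  (-1) ^+ (bu && bv) * phi (tY (D - (- 1 - n%:~R - a)) 0 v (tY (- 1 - n%:~R - a) 0 u w)) =
  \sum_(i < T) binC n%:~R i * \sum_(q < T) \sum_(j < T) powlog1pc a j q *
    phi (tY (D + 1 + i%:R + q%:R) 0 (vY (- 1 - i%:Z - q%:Z) (iter j N u) v) w).
Proof.
have [J0 hJ0] := Ng_nilp hV hg u; pose J := J0.+1.
have hJ k : (J <= k)%N -> iter k N u = 0 by move=> /ltnW; exact: hJ0.
have /choice[ft H] : forall j : nat, exists ft : (R -> C) * nat, isqp ft.1 /\ [/\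
    forall x, 0 < x -> let F := fun rs : C * C =>
      phi (tYsub 0 (expR x)%:C rs.1 (iter j N u) (tYsub 0 1%:C rs.2 v w)) in
      absbounded F /\ has_sum F (ft.1 x / (cexp x%:C - 1) ^+ ft.2),
    forall x, x < 0 -> let F := fun rs : C * C =>
      (-1) ^+ (bu && bv) * phi (tYsub 0 1%:C rs.2 v (tYsub 0 (expR x)%:C rs.1 (iter j N u) w)) in
      absbounded F /\ has_sum F (ft.1 x / (cexp x%:C - 1) ^+ ft.2) &
    forall x, 0 < x < 1 -> let F := fun rs : int * C =>
      x%:C ^ rs.1 * phi (tYsub 0 1%:C rs.2 (vY rs.1 (iter j N u) v) w) in
      absbounded F /\ has_sum F (ft.1 (ln (1 + x)) / x%:C ^+ ft.2)].
  move=> j; have hj := vparity_vwt (iter_Ng_vwt j hu) hbu.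
  have [f [t Hft]] := duality_real w hj (vparity_vwt hv hbv) phi_dual.
  by exists (f, t).
have [B hBv] := vsa_lower hV.
(* a common order of the poles, which also bounds those of Y_V(., x0) v *)
pose t := (\sum_(j < J) (ft j).2 + `|B| + `|h| + `|h'|)%N.
have tj (j : 'I_J) : ((ft j).2 <= t.+1)%N by rewrite /t (bigD1 j) //=; lia.
have [s sE] : isqp (fun x => \sum_(j < J) (x%:C ^+ j / j`!%:R) *
    ((cexp x%:C - 1) ^+ (t.+1 - (ft j).2) * (ft j).1 x)).
  apply: isqp_sum => j; have [hq _] := H j.
  apply: isqp_ext (isqpM 0 ((j`!%:R)^-1 *: 'X^j) (isqp_expB1 (t.+1 - (ft j).2) hq)) => x.
  by rewrite mul0r cexp0 mul1r hornerZ hornerXn [_^-1 * _]mulrC.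
pose c (k : int) := phi (tY (k%:~R - a) 0 u (tY (D - (k%:~R - a)) 0 v w)).
pose d (k : int) := (-1) ^+ (bu && bv) * phi (tY (D - (k%:~R - a)) 0 v (tY (k%:~R - a) 0 u w)).
pose b (j : nat) (p : int) := phi (tY (D - p%:~R) 0 (vY p (iter j N u) v) w).
pose F j x : C := x%:C ^+ t.+1 * ((ft j).1 (ln (1 + x)) / x%:C ^+ (ft j).2).
(* the sum over j of the functions for N^j u, on a common denominator *)
have combine (x : R) (d0 : C) : d0 != 0 -> \sum_(j < J) (x%:C ^+ j / j`!%:R) * ((ft j).1 x / d0 ^+ (ft j).2) =
    (\sum_(j < J) (x%:C ^+ j / j`!%:R) * (d0 ^+ (t.+1 - (ft j).2) * (ft j).1 x)) / d0 ^+ t.+1.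
  move=> d00; rewrite mulr_suml; apply: eq_bigr => j _.
  have -> : d0 ^+ t.+1 = d0 ^+ (t.+1 - (ft j).2) * d0 ^+ (ft j).2 by rewrite -exprD subnK.
  have := expf_neq0 (t.+1 - (ft j).2) d00; have := expf_neq0 (ft j).2 d00.
  have : (j`!%:R : C) != 0 by rewrite pnatr_eq0 -lt0n fact_gt0.
  move: (d0 ^+ (ft j).2) (d0 ^+ (t.+1 - _)) => p1 p2 h1 h2 h3; field.
  by rewrite h1 h2 h3.
have cexp_n1 x : x != 0 -> cexp x%:C - 1 != 0.
  move=> x0; rewrite subr_eq0 cexp_real; apply/negP => /eqP/complexI.
  by rewrite -expR0 => /expR_inj /eqP; rewrite (negPf x0).
(* the exponents of a nonzero matrix coefficient are determined by one
   integer *)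
have c_supp rs (k0 : int) : (forall k, k0 < k -> c k = 0) ->
    (forall k : nat, rs != ((k0 - k%:Z)%:~R - a, D - ((k0 - k%:Z)%:~R - a))) ->
    phi (tY rs.1 0 u (tY rs.2 0 v w)) = 0.
  case: rs => r s0 /= hk0 hne.
  have [rD|rD] := eqVneq (r + s0) D; last exact: (phi12 0 rD).
  have sE0 : s0 = D - r by rewrite -rD addrC addKr.
  have [[k rk]|nk] := pselect (exists k : int, r + a = k%:~R); last first.
    rewrite (@tY_exponent _ _ _ hg _ hW a) ?linear0 //; apply: cexp_twopii_neq1 => k.
    by apply/negP => /eqP e; apply: nk; exists k.
  have rE : r = k%:~R - a by rewrite -rk addrK.
  have [kk|kk] := ltP k0 k; first by have := hk0 k kk; rewrite /c -rE -sE0.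
  have [l kl] : exists l : nat, k = (k0 - l%:Z)%R by exists (absz (k0 - k)%R); lia.
  by have := hne l; rewrite -kl -rE sE0 eqxx.
have d_supp rs (k0 : int) : (forall k, k < k0 -> d k = 0) ->
    (forall k : nat, rs != ((k0 + k%:Z)%:~R - a, D - ((k0 + k%:Z)%:~R - a))) ->
    phi (tY rs.2 0 v (tY rs.1 0 u w)) = 0.
  case: rs => r s0 /= hk0 hne.
  have [rD|rD] := eqVneq (r + s0) D; last exact: (phi21 0 rD).
  have sE0 : s0 = D - r by rewrite -rD addrC addKr.
  have [[k rk]|nk] := pselect (exists k : int, r + a = k%:~R); last first.
    rewrite (@tY_exponent _ _ _ hg _ hW a _ _ u) ?(lin0 (tw_linr hW s0 0%N v)) ?linear0 //.
    by apply: cexp_twopii_neq1 => k; apply/negP => /eqP e; apply: nk; exists k.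
  have rE : r = k%:~R - a by rewrite -rk addrK.
  have [kk|kk] := ltP k k0.
    have /eqP := hk0 k kk; rewrite /d -rE -sE0 mulf_eq0 signr_eq0 /= => /eqP //.
  have [l kl] : exists l : nat, k = (k0 + l%:Z)%R by exists (absz (k - k0)%R); lia.
  by have := hne l; rewrite -kl -rE sE0 eqxx.
have sub_inj (z1 z2 : C) (e : C) : (z1 - e, D - (z1 - e)) = (z2 - e, D - (z2 - e)) -> z1 = z2.
  by case=> /addIr.
(* z1 > 1: the products in the first order, along the exponents that
   contribute *)
have H12 x (k0 : int) : 0 < x -> (forall k, k0 < k -> c k = 0) ->
    let f := fun k : nat => c (k0 - k%:Z) * cexp (((k0 - k%:Z)%:~R - a) * x%:C) in
    seriesabs f /\ seriessum f (qp s x / (cexp x%:C - 1) ^+ t.+1).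
  move=> x0 hk0 f.
  pose G := fun rs : C * C => \sum_(j < J) (x%:C ^+ j / j`!%:R) *
    phi (tYsub 0 (expR x)%:C rs.1 (iter j N u) (tYsub 0 1%:C rs.2 v w)).
  have GE rs : G rs = cexp (rs.1 * x%:C) * phi (tY rs.1 0 u (tY rs.2 0 v w)).
    have := congr1 phi (tYsub_unlog x rs.1 (tY rs.2 0 v w) (ltn0Sn J0) hJ).
    rewrite phiZ phi_sum => <-; apply: eq_bigr => j _.
    by rewrite tYsub_one phiZ.
  have aG : absbounded G.
    apply: absbounded_sum => j; apply: absboundedZ; have [_ [h1 _ _]] := H j; exact: (h1 x x0).1.
  have sG : has_sum G (qp s x / (cexp x%:C - 1) ^+ t.+1).
    rewrite sE -combine ?cexp_n1 ?gt_eqF //.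
    apply: has_sum_sum => j; apply: has_sumZ; have [_ [h1 _ _]] := H j; exact: (h1 x x0).2.
  pose emb (k : nat) : C * C := ((k0 - k%:Z)%:~R - a, D - ((k0 - k%:Z)%:~R - a)).
  have emb_inj : injective emb.
    by move=> k l /sub_inj /eqP; rewrite eqr_int => /eqP; lia.
  have emb_supp rs : (forall k, rs != emb k) -> G rs = 0.
    by move=> hne; rewrite GE (c_supp rs k0) // mulr0.
  have fE : f = fun k => G (emb k).
    by apply: funext => k; rewrite GE /f /c /= mulrC.
  rewrite fE; split; [exact: absbounded_seriesabs aG | exact: has_sum_seriessum sG].
(* 0 < z1 < 1: the products in the other order *)
have H21 x (k0 : int) : x < 0 -> (forall k, k < k0 -> d k = 0) ->
    let f := fun k : nat => d (k0 + k%:Z) * cexp (((k0 + k%:Z)%:~R - a) * x%:C) in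
    seriesabs f /\ seriessum f (qp s x / (cexp x%:C - 1) ^+ t.+1).
  move=> x0 hk0 f.
  pose G := fun rs : C * C => \sum_(j < J) (x%:C ^+ j / j`!%:R) *
    ((-1) ^+ (bu && bv) * phi (tYsub 0 1%:C rs.2 v (tYsub 0 (expR x)%:C rs.1 (iter j N u) w))).
  have GE rs : G rs = cexp (rs.1 * x%:C) * ((-1) ^+ (bu && bv) * phi (tY rs.2 0 v (tY rs.1 0 u w))).
    have := congr1 (fun y => phi (tY rs.2 0 v y)) (tYsub_unlog x rs.1 w (ltn0Sn J0) hJ).
    rewrite (linZ (tw_linr hW _ _ _)) (lin_sum (tw_linr hW _ _ _)) phiZ phi_sum.
    move=> e; rewrite mulrCA -e mulr_sumr; apply: eq_bigr => j _.
    by rewrite tYsub_one (linZ (tw_linr hW _ _ _)) phiZ mulrCA.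
  have aG : absbounded G.
    apply: absbounded_sum => j; apply: absboundedZ; have [_ [_ h1 _]] := H j; exact: (h1 x x0).1.
  have sG : has_sum G (qp s x / (cexp x%:C - 1) ^+ t.+1).
    rewrite sE -combine ?cexp_n1 ?lt_eqF //.
    apply: has_sum_sum => j; apply: has_sumZ; have [_ [_ h1 _]] := H j; exact: (h1 x x0).2.
  pose emb (k : nat) : C * C := ((k0 + k%:Z)%:~R - a, D - ((k0 + k%:Z)%:~R - a)).
  have emb_inj : injective emb.
    by move=> k l /sub_inj /eqP; rewrite eqr_int => /eqP; lia.
  have emb_supp rs : (forall k, rs != emb k) -> G rs = 0.
    by move=> hne; rewrite GE (d_supp rs k0) // !mulr0.
  have fE : f = fun k => G (emb k).
    by apply: funext => k; rewrite GE /f /d /= mulrC.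
  rewrite fE; split; [exact: absbounded_seriesabs aG | exact: has_sum_seriessum sG].
have b0 j (p : int) : p < - t.+1%:Z -> vY p (iter j N u) v = 0.
  move=> pt; have := vwt_vY hV p (iter_Ng_vwt j hu) hv; rewrite /vwt => <-.
  apply: hBv; move: pt; rewrite /t; move: (\sum_(j < J) _)%N => S; lia.
(* the iterates, as power series in z1 - 1 after clearing the pole *)
have Hb j x : 0 < x < 1 -> let f := fun k : nat => b j (k%:Z - t.+1%:Z) * x%:C ^+ k in
    seriesabs f /\ seriessum f (F j x).
  move=> hx f; have /andP[x0 x1] := hx.
  have [_ [_ _ /(_ x hx)[aG sG]]] := H j.
  move: aG sG; set G := fun rs => _ => aG sG.
  have GE p s0 : G (p, s0) = x%:C ^ p * phi (tY s0 0 (vY p (iter j N u) v) w).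
    by rewrite -tYsub_one.
  pose emb (k : nat) : int * C := (k%:Z - t.+1%:Z, D - (k%:Z - t.+1%:Z)%:~R).
  have emb_inj : injective emb by move=> k l [] /eqP; rewrite subr_eq subrK => /eqP [].
  have emb_supp rs : (forall k, rs != emb k) -> G rs = 0.
    case: rs => p s0 hne; rewrite GE.
    have [pD|pD] := eqVneq (p%:~R + s0) D; last by rewrite (phi_it _ pD) mulr0.
    have [pt|pt] := ltP p (- t.+1%:Z).
      by rewrite b0 // (lin0 (tw_linl hW _ _ _)) linear0 mulr0.
    have [k pk] : exists k : nat, p = (k%:Z - t.+1%:Z)%R by exists (absz (p + t.+1%:Z)%R); lia.
    by have := hne k; rewrite /emb -pk -pD addrC addKr eqxx.
  have xn : x%:C != 0 by rewrite gt_eqF // (realC_lt 0).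
  have fE : f = fun k => x%:C ^+ t.+1 * G (emb k).
    apply: funext => k; rewrite /f /b GE mulrA -[_ ^+ t.+1]/(_ ^ t.+1%:Z).
    by rewrite -expfzDr // [t.+1%:Z + _]addrC subrK mulrC.
  rewrite fE; split.
    have [M hM] := absbounded_seriesabs emb_inj aG; exists (`|x%:C ^+ t.+1| * M) => K.
    apply: le_trans (ler_wpM2l (normr_ge0 _) (hM K)); rewrite mulr_sumr.
    by apply: ler_sum => k _; rewrite normrM.
  by apply: seriessum_scale; exact: (has_sum_seriessum emb_inj emb_supp sG).
have HF x : 0 < x < 1 ->
    \sum_(j < J) ((ln (1 + x))%:C ^+ j / j`!%:R) * F j x = qp s (ln (1 + x)).
  move=> /andP[x0 x1]; have xn : x%:C != 0 by rewrite gt_eqF // (realC_lt 0).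
  have eL : cexp (ln (1 + x))%:C - 1 = x%:C.
    by rewrite cexp_real lnK ?posrE ?addr_gt0 // rmorphD /= addrC addKr.
  have := combine (ln (1 + x)) x%:C xn; rewrite sE eL => e.
  rewrite -[RHS](divfK (expf_neq0 t.+1 xn)) -e mulrC mulr_sumr.
  by apply: eq_bigr => j _; rewrite mulrCA.
have c_top : exists k0 : int, forall k, k0 < k -> c k = 0.
  have [B' hB'] := tY_trunc hW hB.
  pose y := complex.Re (D + a + hlf h' + m) - B'.
  exists (Num.floor y) => k hk; rewrite /c (hB' _ _ _ _ _ _ hv hw) ?(lin0 (tw_linr hW _ _ _)) ?linear0 //.
  have -> : D - (k%:~R - a) + hlf h' + m = (D + a + hlf h' + m) - (k%:~R : R)%:C.
    by rewrite rmorph_int; ring.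
  rewrite complex_ReD -[complex.Re (- _)]/(- k%:~R : R).
  rewrite ltrBlDr -ltrBlDl -/y; apply: lt_le_trans (floorD1_gt y) _.
  by rewrite ler_int lezD1.
have d_bot : exists k0 : int, forall k, k < k0 -> d k = 0.
  have [B' hB'] := tY_trunc hW hB.
  pose y := B' - complex.Re (- a + hlf h + m).
  exists (Num.floor y) => k hk; rewrite /d (hB' _ _ _ _ _ _ hu hw) ?(lin0 (tw_linr hW _ _ _)) ?linear0 ?mulr0 //.
  have -> : k%:~R - a + hlf h + m = (- a + hlf h + m) + (k%:~R : R)%:C.
    by rewrite rmorph_int; ring.
  rewrite complex_ReD -[complex.Re (k%:~R)%:C]/(k%:~R : R).
  rewrite -ltrBrDl -/y; apply: lt_le_trans (floor_le y).
  by rewrite ltr_int.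
exists (t + J).+1 => T TT.
have tT : (t < T)%N by lia.
have bz j (p : int) : p < - t.+1%:Z -> b j p = 0.
  by move=> pt; rewrite /b b0 // (lin0 (tw_linl hW _ _ _)) linear0.
have := twisted_residue c_top d_bot bz H12 H21 Hb HF n tT.
rewrite /c /d.
have -> : (- 1 - n)%:~R = - 1 - n%:~R :> C by rewrite intrB rmorphN1.
move=> ->; apply: eq_bigr => i _; congr (_ * _); apply: eq_bigr => q _.
have JT : (J <= T)%N by lia.
rewrite (sum_ord_stable JT (F := fun j => powlog1pc a j q *
  phi (tY (D + 1 + i%:R + q%:R) 0 (vY (- 1 - i%:Z - q%:Z) (iter j N u) v) w))); last first.
  move=> j /hJ ->; rewrite (lin0 (vsa_linl hV _ _)) (lin0 (tw_linl hW _ _ _)).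
  by rewrite linear0 mulr0.
apply: eq_bigr => j _; congr (_ * phi (tY _ _ _ _)).
rewrite !intrB rmorphN1 -[i%:Z%:~R]/(i%:R : C) -[q%:Z%:~R]/(q%:R : C); ring.
Qed.

End Functional.
End Homogeneous.
End CoreIdentity.

(** * The commutator as a finite sum *)

Section LinearFamilies.
Variables (K : nzRingType) (U U' U'' : lmodType K).

Lemma linear_comp (f : U' -> U'') (f' : U -> U') :
  linear f -> linear f' -> linear (f \o f').
Proof. by move=> hf hf' c x y; rewrite /= hf' hf. Qed.

Lemma linear_bigsum n (F : 'I_n -> U -> U') :
  (forall i, linear (F i)) -> linear (fun x => \sum_(i < n) F i x).
Proof.
move=> hF c x y; rewrite scaler_sumr -big_split; apply: eq_bigr => i _.
exact: hF.
Qed.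

Lemma linear_subf (f f' : U -> U') : linear f -> linear f' -> linear (fun x => f x - f' x).
Proof. by move=> hf hf' c x y; rewrite hf hf' scalerBr opprD addrACA. Qed.

(** Identities in the form of an equality with a sum cut off at T extend by
    linearity, although the bound for T depends on the vector. *)
Lemma eventually_sum (L : U -> U') (F : nat -> U -> U') (I : Type) (s : seq I) (x : I -> U) :
  linear L -> (forall T, linear (F T)) ->
  (forall i, exists T0, forall T, (T0 <= T)%N -> L (x i) = F T (x i)) ->
  exists T0, forall T, (T0 <= T)%N -> L (\sum_(i <- s) x i) = F T (\sum_(i <- s) x i).
Proof.
move=> hL hF hx; elim: s => [|i s [T0 IH]].
  by exists 0%N => T _; rewrite big_nil (lin0 hL) (lin0 (hF T)).
have [T1 h1] := hx i; exists (maxn T0 T1) => T; rewrite geq_max => /andP[h0' h1'].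
by rewrite big_cons (linD hL) (linD (hF T)) (IH T h0') (h1 T h1').
Qed.

End LinearFamilies.

Lemma linear_scalef (K : comNzRingType) (U U' : lmodType K) (b : K) (f : U -> U') :
  linear f -> linear (fun x => b *: f x).
Proof. by move=> hf c x y; rewrite hf scalerDr !scalerA [b * c]mulrC. Qed.

Section Commutator.
Variables (R : realType) (V : vsa_data R) (hV : is_vsa V).
Variables (g : {linear V -> V}) (hg : is_vsa_aut g).
Variables (W : twmod_data V) (hW : is_twmod g W) (hB : lower_bounded W).
Local Notation C := R[i].
Local Notation N := (Ng g).
Local Notation hlf := (Defs.half R).
Implicit Types (u v : V) (w : W) (n : int) (a e : C).

(** For n = - 1 - e1 - a and e = e1 + e2 + 1 this is the part without
    logarithms of the coefficient of x1^e1 x2^e2 in the right-hand side of the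
    commutator formula, for u in V^[a]; the sums are cut off at T. *)
Definition residue_part n a e u v w (T : nat) : W :=
  \sum_(i < T) binC n%:~R i *: \sum_(q < T) \sum_(j < T) powlog1pc a j q *:
    tY (e + i%:R + q%:R) 0 (vY (- 1 - i%:Z - q%:Z) (iter j N u) v) w.

Lemma residue_part_linu n a e v w T : linear (fun u => residue_part n a e u v w T).
Proof.
apply: linear_bigsum => i; apply: linear_scalef; apply: linear_bigsum => q.
apply: linear_bigsum => j; apply: linear_scalef.
apply: (linear_comp (tw_linl hW _ _ _)); apply: (linear_comp (vsa_linl hV _ _)).
exact: iter_Ng_linear.
Qed.

Lemma residue_part_linv n a e u w T : linear (fun v => residue_part n a e u v w T).
Proof.
apply: linear_bigsum => i; apply: linear_scalef; apply: linear_bigsum => q.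
apply: linear_bigsum => j; apply: linear_scalef.
apply: (linear_comp (tw_linl hW _ _ _)); exact: (vsa_linr hV _ _).
Qed.

Lemma residue_part_linw n a e u v T : linear (fun w => residue_part n a e u v w T).
Proof.
apply: linear_bigsum => i; apply: linear_scalef; apply: linear_bigsum => q.
apply: linear_bigsum => j; apply: linear_scalef; exact: (tw_linr hW _ _ _).
Qed.

Lemma vY_Ng_trunc u v : exists L : nat, forall j n,
  n < - L%:Z -> vY n (iter j N u) v = 0.
Proof.
have [J hJ] := Ng_nilp hV hg u.
have [L hL] : exists L : nat, forall j n, (j < J)%N -> n < - L%:Z -> vY n (iter j N u) v = 0.
  elim: J {hJ} => [|J [L hL]]; first by exists 0%N.
  have [M hM] := vY_trunc hV (iter J N u) v.
  exists (maxn L `|M|%N) => j n; rewrite ltnS leq_eqVlt => /orP[/eqP ->|jJ] nL.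
    apply: hM; lia.
  by apply: hL => //; lia.
exists L => j n nL; have [jJ|Jj] := ltnP j J; first exact: hL.
by rewrite hJ // (lin0 (vsa_linl hV _ _)).
Qed.

(** Y_V(., x0) v has finitely many negative powers, and N_g is nilpotent on
    u. *)
Lemma residue_part_stable n a e u v w : exists T0, forall T, (T0 <= T)%N ->
  residue_part n a e u v w T = residue_part n a e u v w T0.
Proof.
have [J hJ] := Ng_nilp hV hg u; have [L hL] := vY_Ng_trunc u v.
exists (maxn J L) => T hT; have JT : (J <= maxn J L)%N by lia.
have LT : (L <= maxn J L)%N by lia.
have hz i q j : (L <= i + q)%N || (J <= j)%N ->
    tY (e + i%:R + q%:R) 0 (vY (- 1 - i%:Z - q%:Z) (iter j N u) v) w = 0.
  case/orP => h; last by rewrite hJ // (lin0 (vsa_linl hV _ _)) (lin0 (tw_linl hW _ _ _)).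
  by rewrite hL ?(lin0 (tw_linl hW _ _ _)) //; lia.
rewrite /residue_part (sum_ord_stable hT (F := fun i => binC n%:~R i *: \sum_(q < T)
  \sum_(j < T) powlog1pc a j q *:
    tY (e + i%:R + q%:R) 0 (vY (- 1 - i%:Z - q%:Z) (iter j N u) v) w)); last first.
  move=> i hi; rewrite big1 ?scaler0 // => q _; rewrite big1 // => j _.
  by rewrite hz ?scaler0 //; apply/orP; left; lia.
apply: eq_bigr => i _; congr (_ *: _).
rewrite (sum_ord_stable hT (F := fun q => \sum_(j < T) powlog1pc a j q *:
    tY (e + i%:R + q%:R) 0 (vY (- 1 - i%:Z - q%:Z) (iter j N u) v) w)); last first.
  move=> q hq; rewrite big1 // => j _.
  by rewrite hz ?scaler0 //; apply/orP; left; lia.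
apply: eq_bigr => q _.
rewrite (sum_ord_stable hT (F := fun j => powlog1pc a j q *:
    tY (e + i%:R + q%:R) 0 (vY (- 1 - i%:Z - q%:Z) (iter j N u) v) w)) //.
by move=> j hj; rewrite hz ?scaler0 //; apply/orP; right; lia.
Qed.

Section Homogeneous.
Variables (h h' : int) (a m : C) (bu bv : bool) (u v : V) (w : W).
Hypotheses (hu : vwt h u) (ha : gen_eig g a u) (hbu : odd `|h|%N = bu).
Hypotheses (hv : vwt h' v) (hbv : odd `|h'|%N = bv) (hw : tweight m w).

(** Linear functionals on the components of W separate its vectors; on
    components of another weight than the common one both sides vanish. *)
Lemma commutator_hom n e2 : exists T0, forall T, (T0 <= T)%N ->
  tY (- 1 - n%:~R - a) 0 u (tY e2 0 v w) -
  (-1) ^+ (bu && bv) *: tY e2 0 v (tY (- 1 - n%:~R - a) 0 u w) =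
  residue_part n a (- 1 - n%:~R - a + e2 + 1) u v w T.
Proof.
set e1 := - 1 - n%:~R - a.
have [T0 hT0] := residue_part_stable n a (e1 + e2 + 1) u v w.
exists T0 => T TT0; rewrite hT0 //; apply: (grading_eq (G := tgr W)) => i0.
apply: functional_sep => phi0.
pose psi y := phi0 (gproj (tgr W) i0 y).
have psiD x y : psi (x + y) = psi x + psi y by rewrite /psi !linearD.
have psiZ c x : psi (c *: x) = c * psi x by rewrite /psi !linearZ.
have psiS k (F : 'I_k -> W) : psi (\sum_(i < k) F i) = \sum_(i < k) psi (F i).
  by rewrite /psi !linear_sum.
rewrite -/(psi _) -/(psi (residue_part _ _ _ _ _ _ _)).
rewrite psiD -scaleNr psiZ.
have psi_eq0 l y : tweight l y -> l != i0.1.1 -> psi y = 0.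
  move=> hy hl; rewrite /psi hy ?linear0 //= => e.
  by rewrite e eqxx in hl.
have [D0|D0] := eqVneq (e1 + e2) (i0.1.1 - m - hlf h - hlf h').
  have [T1 hT1] := core_functional hV hg hW hB hu ha hbu hv hbv hw phi0 i0 n.
  rewrite -(hT0 (maxn T0 T1)) ?leq_maxl //.
  have := hT1 (maxn T0 T1) (leq_maxr _ _); rewrite -/e1 -D0 [e1 + e2]addrC addrK [e2 + e1]addrC.
  rewrite mulNr => e; rewrite -[LHS]/(phi0 (gproj (tgr W) i0 _) - _ * phi0 (gproj (tgr W) i0 _)) in e *.
  rewrite [LHS]e /residue_part psiS; apply: eq_bigr => i _; rewrite psiZ psiS.
  congr (_ * _); apply: eq_bigr => q _; rewrite psiS; apply: eq_bigr => j _.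
  by rewrite psiZ.
rewrite (@psi_eq0 (e1 + hlf h + (e2 + hlf h' + m))); last first.
- by apply: contra D0 => /eqP <-; apply/eqP; ring.
- by apply: (tY_weight hW) => //; exact: (tY_weight hW).
rewrite (@psi_eq0 (e2 + hlf h' + (e1 + hlf h + m))); last first.
- by apply: contra D0 => /eqP <-; apply/eqP; ring.
- by apply: (tY_weight hW) => //; exact: (tY_weight hW).
rewrite mulr0 addr0 /residue_part psiS big1 // => i _; rewrite psiZ psiS big1 ?mulr0 // => q _.
rewrite psiS big1 // => j _; rewrite psiZ.
rewrite (@psi_eq0 (e1 + e2 + 1 + i%:R + q%:R + hlf ((- 1 - i%:Z - q%:Z) *+ 2 + h + h') + m)).
- by rewrite mulr0.
- by apply: (tY_weight hW) => //; apply: vwt_vY => //; exact: iter_Ng_vwt.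
apply: contra D0 => /eqP <-; apply/eqP.
rewrite /Defs.half mulr2n !intrD !intrN -[i%:Z%:~R]/(i%:R : C) -[q%:Z%:~R]/(q%:R : C).
by field.
Qed.

End Homogeneous.

Lemma commutator_hom_log h h' a m bu bv u v w n e2 k1 k2 :
  vwt h u -> gen_eig g a u -> odd `|h|%N = bu ->
  vwt h' v -> odd `|h'|%N = bv -> tweight m w ->
  exists T0, forall T, (T0 <= T)%N ->
  tY (- 1 - n%:~R - a) k1 u (tY e2 k2 v w) -
  (-1) ^+ (bu && bv) *: tY e2 k2 v (tY (- 1 - n%:~R - a) k1 u w) =
  ((-1) ^+ k1 / k1`!%:R * ((-1) ^+ k2 / k2`!%:R)) *:
  residue_part n a (- 1 - n%:~R - a + e2 + 1) (iter k1 N u) (iter k2 N v) w T.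
Proof.
move=> hu ha hbu hv hbv hw.
have [T0 hT0] := commutator_hom (iter_Ng_vwt hV hg k1 hu) (iter_Ng_gen_eig hV hg k1 ha) hbu
  (iter_Ng_vwt hV hg k2 hv) hbv hw n e2.
exists T0 => T /hT0 <-; set e1 := - 1 - n%:~R - a.
rewrite [tY e2 k2 v w](tY_log hV hg hW) [tY e1 k1 u w](tY_log hV hg hW).
rewrite [tY e2 k2 v _](tY_log hV hg hW) [tY e1 k1 u _](tY_log hV hg hW).
rewrite !(linZ (tw_linr hW _ _ _)) scalerBr !scalerA; congr (_ - _ *: _).
by ring.
Qed.

Lemma exponent_split (e : C) : exists n a, in_strip a /\ e = - 1 - n%:~R - a.
Proof.
pose y := complex.Re (- 1 - e); exists (Num.floor y), (- 1 - e - (Num.floor y)%:~R).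
split; last by ring.
rewrite /in_strip.
have -> : complex.Re (- 1 - e - (Num.floor y)%:~R) = y - (Num.floor y)%:~R.
  rewrite (_ : (Num.floor y)%:~R = ((Num.floor y)%:~R : R)%:C); last by rewrite rmorph_int.
  by rewrite complex_ReD.
by rewrite subr_ge0 floor_le ltrBlDl -[1]/(1%:~R) -intrD floorD1_gt.
Qed.

(** Trilinearity.  Components of u and v of the wrong parity vanish, and so do
    both sides for u in V^[b] with b distinct from a. *)
Lemma commutator_formula bu bv u v w n a e2 k1 k2 : vparity bu u -> vparity bv v ->
  in_strip a -> exists T0, forall T, (T0 <= T)%N ->
  tY (- 1 - n%:~R - a) k1 u (tY e2 k2 v w) -
  (-1) ^+ (bu && bv) *: tY e2 k2 v (tY (- 1 - n%:~R - a) k1 u w) =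
  ((-1) ^+ k1 / k1`!%:R * ((-1) ^+ k2 / k2`!%:R)) *:
  residue_part n a (- 1 - n%:~R - a + e2 + 1) (iter k1 N (gcomp g u a)) (iter k2 N v) w T.
Proof.
move=> hu hv sa; set e1 := - 1 - n%:~R - a; set c0 := (_ / _ * _).
have [s ->] := grading_decomp (tgr W) w.
apply: (eventually_sum (L := fun w => tY e1 k1 u (tY e2 k2 v w) -
    (-1) ^+ (bu && bv) *: tY e2 k2 v (tY e1 k1 u w))
  (F := fun T w => c0 *: residue_part n a (e1 + e2 + 1) (iter k1 N (gcomp g u a)) (iter k2 N v) w T)).
- apply: linear_subf; last apply: linear_scalef.
  + exact: (linear_comp (tw_linr hW _ _ _) (tw_linr hW _ _ _)).
  + exact: (linear_comp (tw_linr hW _ _ _) (tw_linr hW _ _ _)).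
- by move=> T; apply: linear_scalef; exact: residue_part_linw.
move=> i {s}; have : tweight i.1.1 (gproj (tgr W) i w) by exact: tweight_gproj.
move: (gproj _ i w) => {}w hw.
have [s vE] := grading_decomp (vgr V) v; rewrite vE.
apply: (eventually_sum (L := fun v => tY e1 k1 u (tY e2 k2 v w) -
    (-1) ^+ (bu && bv) *: tY e2 k2 v (tY e1 k1 u w))
  (F := fun T v => c0 *: residue_part n a (e1 + e2 + 1) (iter k1 N (gcomp g u a)) (iter k2 N v) w T)).
- apply: linear_subf; last apply: linear_scalef.
  + exact: (linear_comp (tw_linr hW _ _ _) (tw_linl hW _ _ _)).
  + exact: (tw_linl hW _ _ _).
- move=> T; apply: linear_scalef; apply: (linear_comp (residue_part_linv _ _ _ _ _ _)).
  exact: iter_Ng_linear.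
move=> h' {s vE}; have [hbv|hbv] := eqVneq (odd `|h'|%N) bv; last first.
  rewrite hv ?(lin0 (iter_Ng_linear hV hg _)) //; last by move=> e; rewrite e eqxx in hbv.
  exists 0%N => T _; rewrite !(lin0 (tw_linl hW _ _ _)) (lin0 (tw_linr hW _ _ _)).
  by rewrite (lin0 (residue_part_linv _ _ _ _ _ _)) !scaler0 subrr.
have := vwt_gproj h' v; move: (gproj _ h' v) => {hv}v hv.
have [s uE] := grading_decomp (vgr V) u; rewrite uE.
pose L u := tY e1 k1 u (tY e2 k2 v w) - (-1) ^+ (bu && bv) *: tY e2 k2 v (tY e1 k1 u w).
pose F T u := c0 *:
  residue_part n a (e1 + e2 + 1) (iter k1 N (gcomp g u a)) (iter k2 N v) w T.
have linL : linear L.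
  apply: linear_subf; last apply: linear_scalef.
  + exact: (tw_linl hW _ _ _).
  + exact: (linear_comp (tw_linr hW _ _ _) (tw_linl hW _ _ _)).
have linR T : linear (F T).
  apply: linear_scalef; apply: (linear_comp (residue_part_linu _ _ _ _ _ _)).
  exact: (linear_comp (iter_Ng_linear hV hg _) (gcomp_linear hV hg _)).
apply: (eventually_sum (L := L) (F := F) _ linL linR) => h {s uE}; rewrite /L /F.
have [hbu|hbu] := eqVneq (odd `|h|%N) bu; last first.
  rewrite hu; last by move=> e; rewrite e eqxx in hbu.
  by exists 0%N => T _; exact: etrans (lin0 linL) (esym (lin0 (linR T))).
have := vwt_gproj h u; move: (gproj _ h u) => {hu}u hu.
have [s _ uE] := gcomp_decomp hV hg u; rewrite uE.
apply: (eventually_sum (L := L) (F := F) _ linL linR) => b {s uE}; rewrite /L /F.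
have := gcomp_vwt hV hg b hu; have := gcomp_gen hV hg u b.
have [sb|/(gcomp_strip hV hg u) ->] := boolP (in_strip b); last first.
  by exists 0%N => T _; exact: etrans (lin0 linL) (esym (lin0 (linR T))).
move: (gcomp g u b) => {hu}u hb hu.
rewrite (gcomp_eig a sb hb); have [ab|ab] := eqVneq a b.
  by subst b; exact: (commutator_hom_log n e2 k1 k2 hu hb hbu hv hbv hw).
exists 0%N => T _.
have ne1 (y : W) : tY e1 k1 u y = 0.
  apply: (@tY_exponent _ _ _ hg _ hW b) => //; apply: contra ab => /eqP e; apply/eqP.
  have [k ek] : exists k : int, e1 + b - 0 = k%:~R by apply: cexp_twopii_inj; rewrite mulr0 cexp0.
  apply: in_strip_inj => //; have -> : b = a + (k + 1 + n)%:~R.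
    by rewrite !intrD -ek /e1; ring.
  by rewrite mulrDr cexpD cexp_twopii_int mulr1.
rewrite !ne1 (lin0 (tw_linr hW _ _ _)) (lin0 (iter_Ng_linear hV hg _)).
by rewrite (lin0 (residue_part_linu _ _ _ _ _ _)) !scaler0 subrr.
Qed.

End Commutator.

(** * Formal series in x0, x1, x2 *)

Section Convolution.
Variable R : realType.
Local Notation C := R[i].

Definition mle (m' m : mono R) : bool := (m'.1.2 <= m.1.2)%N && (m'.2 <= m.2)%N.
Definition msub (m m' : mono R) : mono R :=
  (m.1.1.1.1 - m'.1.1.1.1, m.1.1.1.2 - m'.1.1.1.2, m.1.1.2 - m'.1.1.2,
   (m.1.2 - m'.1.2)%N, (m.2 - m'.2)%N).

Lemma maddE (a b c a' b' c' : C) (k l k' l' : nat) :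
  ((a, b, c, k, l) : mono R) + (a', b', c', k', l') =
  (a + a', b + b', c + c', (k + k')%N, (l + l')%N).
Proof. by []. Qed.

Lemma msubK (m m' : mono R) : mle m' m -> m' + msub m m' = m.
Proof.
case: m => [[[[a b] c] k] l]; case: m' => [[[[a' b'] c'] k'] l'] /andP[/= h1 h2].
by rewrite /msub /= maddE !subrKC !subnKC.
Qed.

Lemma madd_sub (m' m'' m : mono R) : m' + m'' = m -> mle m' m /\ m'' = msub m m'.
Proof.
case: m' => [[[[a' b'] c'] k'] l']; case: m'' => [[[[a'' b''] c''] k''] l''] <-.
by rewrite /mle /msub /= !leq_addr ![_ + _ - _]addrC !addKr !addKn.
Qed.

(** The sums over pairs of monomials with a given product are evaluated by
    listing the first factors that contribute; the second factor is then
    determined. *)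
Lemma conv_seq (J : choiceType) (M : nmodType) (tau : J -> mono R)
    (f : J -> mono R -> M) (js : seq J) m : uniq js ->
  (forall j m', tau j + m' = m -> j \notin js -> f j m' = 0) ->
  \sum_(q \in [set q : J * mono R | tau q.1 + q.2 = m]) f q.1 q.2 =
  \sum_(j <- js | mle (tau j) m) f j (msub m (tau j)).
Proof.
move=> ujs hf; pose r := [seq (j, msub m (tau j)) | j <- js & mle (tau j) m].
rewrite (@fsbigE _ _ _ _ _ r).
- rewrite big_map big_filter_cond; apply: eq_bigl => j /=.
  case hm: (mle _ _) => //=; apply/mem_set; exact: msubK.
- by rewrite map_inj_uniq ?filter_uniq // => i j [].
- move=> q /= /mapP[j]; rewrite mem_filter => /andP[hm _] ->; exact: msubK.
case=> j m' /= hjm; apply: contraNeq => fj; have [hm ->] := madd_sub hjm.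
apply/mapP; exists j => //; rewrite mem_filter hm /=.
by apply: contraNT fj => /(hf _ _ hjm) ->.
Qed.

Section Product.
Variable M : lmodType C.
Implicit Types (s : fser R C) (F : fser R M).

Lemma fmulE s F m (es : seq (mono R)) : uniq es ->
  (forall e m', e + m' = m -> e \notin es -> s e *: F m' = 0) ->
  fmul s F m = \sum_(e <- es | mle e m) s e *: F (msub m e).
Proof. by move=> ues hf; rewrite /fmul (conv_seq (tau := id) (f := fun e m' => s e *: F m') ues hf). Qed.

Lemma fmul_x1 b F y0 y1 y2 k1 k2 :
  fmul (fx1 b) F (y0, y1, y2, k1, k2) = F (y0, y1 - b, y2, k1, k2).
Proof.
rewrite (@fmulE _ _ _ [:: (0, b, 0, 0%N, 0%N)]) //.
  by rewrite big_mkcond big_seq1 /= /mle /msub /= !subr0 !subn0 /fx1 /fmono eqxx scale1r.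
by move=> e m' _; rewrite inE /fx1 /fmono => /negPf ->; rewrite scale0r.
Qed.

Lemma fmul_cone s F m (P : mono R -> Prop) :
  (forall m', ~ P m' -> F m' = 0) ->
  (forall e m', s e != 0 -> P m' -> e + m' = m -> False) -> fmul s F m = 0.
Proof.
move=> hF hs; rewrite (@fmulE _ _ _ [::]) ?big_nil // => e m' em _.
have [->|se] := eqVneq (s e) 0; first by rewrite scale0r.
have [Pm|/hF ->] := pselect (P m'); last by rewrite scaler0.
by case: (hs e m').
Qed.

End Product.

Lemma fmulC_x1r (s : fser R C) b y0 y1 y2 k1 k2 :
  fmulC s (fx1 b) (y0, y1, y2, k1, k2) = s (y0, y1 - b, y2, k1, k2).
Proof.
rewrite /fmulC (@fmulE _ _ _ _ [:: (y0, y1 - b, y2, k1, k2)]) //.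
  rewrite big_mkcond big_seq1 /= /mle /msub /= !leqnn !subrr !subnn subKr /fx1 /fmono eqxx.
  exact: mulr1.
move=> [[[[a0 a1] a2] l1] l2] m' em; rewrite inE /fx1 /fmono.
have [m'E|_] := eqVneq m' (0, b, 0, 0%N, 0%N); last by rewrite scaler0.
move: em; rewrite m'E maddE !addr0 !addn0 => -[<- <- <- <- <-].
by rewrite addrK eqxx.
Qed.

Lemma fx20_in (b : C) i : fx20 b (i%:R, 0, b - i%:R, 0%N, 0%N) = binC b i.
Proof.
rewrite /fx20 /fsum (@fsumT1 _ _ i).
  by rewrite /fscaleC /fscale /fmono eqxx; exact: mulr1.
move=> j ji; rewrite /fscaleC /fscale /fmono.
suff /negPf -> : (i%:R : C, 0 : C, b - i%:R, 0%N, 0%N) != (j%:R, 0, b - j%:R, 0%N, 0%N).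
  exact: mulr0.
apply: contra ji => /eqP[/eqP + _]; rewrite eqr_nat => /eqP ->; exact: eqxx.
Qed.

Lemma fx20_out (b : C) m : (forall i, m <> (i%:R, 0, b - i%:R, 0%N, 0%N)) -> fx20 b m = 0.
Proof.
move=> hm; rewrite /fx20 /fsum fsbig1 // => i _; rewrite /fscaleC /fscale /fmono.
by case: eqP => [/hm|_] //; exact: mulr0.
Qed.

Lemma fdeltaE y0 y1 y2 k1 k2 :
  @fdelta R (y0, y1, y2, k1, k2) = \sum_(n \in [set: int]) fx20 n%:~R (y0, y1 + n%:~R, y2, k1, k2).
Proof.
by rewrite /fdelta /fsum; apply: eq_fsbigr => n _; rewrite fmulC_x1r opprK.
Qed.

Lemma fdelta_in (n : int) i : @fdelta R (i%:R, - n%:~R, n%:~R - i%:R, 0%N, 0%N) = binC n%:~R i.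
Proof.
rewrite fdeltaE (@fsumT1 _ _ n) ?addNr ?fx20_in // => n' n'n.
apply: fx20_out => j [_ /eqP]; rewrite addrC subr_eq0 eqr_int => /eqP e.
by rewrite e eqxx in n'n.
Qed.

Lemma fdelta_out m : (forall (n : int) i, m <> (i%:R, - n%:~R, n%:~R - i%:R, 0%N, 0%N)) ->
  @fdelta R m = 0.
Proof.
case: m => [[[[y0 y1] y2] k1] k2] hm; rewrite fdeltaE fsbig1 // => n _.
apply: fx20_out => j [e0 e1 e2 e3 e4]; apply: (hm n j).
by rewrite e0 e2 e3 e4 -(addrK n%:~R y1) e1 sub0r.
Qed.

(** The series log (x2 + x0) - log x1. *)
Definition logratio : fser R C := fadd (@flog20 R) (fopp (@flog1 R)).

(** The monomials (x0 / x2)^q (log x1)^k1 (log x2)^k2. *)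
Definition on_cone (m : mono R) : Prop :=
  exists q : nat, m.1.1 = (q%:R, 0, - q%:R).

Lemma flog20_tail m : fsum (fun i : nat => fscaleC ((-1) ^+ i / i.+1%:R : C)
   (fmono (i.+1%:R, 0, - i.+1%:R, 0%N, 0%N))) m =
   \sum_(i \in [set: nat]) ((-1) ^+ i / i.+1%:R : C) * (m == (i.+1%:R, 0, - i.+1%:R, 0%N, 0%N))%:R.
Proof. by []. Qed.

Lemma logratio_in i : logratio (i.+1%:R, 0, - i.+1%:R, 0%N, 0%N) = (-1) ^+ i / i.+1%:R :> C.
Proof.
rewrite /logratio /fadd /fopp /flog20 /fadd flog20_tail (@fsumT1 _ _ i).
  rewrite eqxx mulr1 /flog2 /flog1 /fmono.
  have h : (i.+1%:R : C) != 0 by rewrite pnatr_eq0.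
  by rewrite !xpair_eqE (negPf h) /= !add0r subr0.
move=> j ji; case: eqP => [[/eqP + _]|]; last by rewrite mulr0.
by rewrite eqr_nat => /eqP[e]; rewrite e eqxx in ji.
Qed.

Lemma logratio_logs k1 k2 : (0 < k1 + k2)%N -> logratio (0, 0, 0, k1, k2) =
  ((k1 == 0%N) && (k2 == 1%N))%:R - ((k1 == 1%N) && (k2 == 0%N))%:R.
Proof.
move=> k0; rewrite /logratio /fadd /fopp /flog20 /fadd flog20_tail fsbig1.
  by rewrite addr0 /flog2 /flog1 /fmono !xpair_eqE !eqxx.
move=> i _; case: eqP => [[_ _ e1 e2]|_]; last by rewrite mulr0.
by rewrite e1 e2 in k0.
Qed.

Lemma logratio_out m : m <> (0, 0, 0, 0%N, 1%N) -> m <> (0, 0, 0, 1%N, 0%N) ->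
  (forall i : nat, m <> (i.+1%:R, 0, - i.+1%:R, 0%N, 0%N)) -> logratio m = 0.
Proof.
move=> h1 h2 h3; rewrite /logratio /fadd /fopp /flog20 /fadd flog20_tail fsbig1.
  rewrite /flog2 /flog1 /fmono; case: eqP => // _; case: eqP => // _.
  by rewrite !addr0 subr0.
by move=> i _; case: eqP => [/h3|_] //; rewrite mulr0.
Qed.

Lemma logratio_cone m : logratio m != 0 -> on_cone m.
Proof.
move=> h; have [->|h1] := pselect (m = (0, 0, 0, 0%N, 1%N)).
  by exists 0%N; rewrite oppr0.
have [->|h2] := pselect (m = (0, 0, 0, 1%N, 0%N)).
  by exists 0%N; rewrite oppr0.
have [[i ->]|h3] := pselect (exists i : nat, m = (i.+1%:R, 0, - i.+1%:R, 0%N, 0%N)).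
  by exists i.+1.
by case/eqP: h; apply: logratio_out => // i e; apply: h3; exists i.
Qed.

Lemma on_cone_add m m' : on_cone m -> on_cone m' -> on_cone (m + m').
Proof.
case: m => [[[[a b] c] k] l]; case: m' => [[[[a' b'] c'] k'] l'] [q /= [-> -> ->]] [q' /= [-> -> ->]].
by exists (q + q')%N; rewrite maddE /= natrD addr0 opprD.
Qed.

Lemma fpow_out j m : ~ on_cone m -> fpow logratio j m = 0.
Proof.
elim: j m => [|j IH] m hm.
  rewrite /fpow /= /fmono; case: eqP => // e; case: hm; exists 0%N.
  by rewrite e oppr0.
rewrite /fpow iterS -/(fpow _ _); apply: (fmul_cone (P := on_cone)) => [m'|e m' se hm' em].
  exact: IH.
by apply: hm; rewrite -em; apply: on_cone_add => //; exact: logratio_cone.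
Qed.

Lemma log1pcS k q : log1pc R k.+1 q =
  \sum_(i < q) ((-1) ^+ i / i.+1%:R) * log1pc R k (q - i.+1).
Proof.
rewrite /log1pc exprS coefM big_ord_recl.
have -> : (log1p R q)`_0 = 0 by have := @coef_log1pX_lt R q 1 0 isT; rewrite expr1.
rewrite mul0r add0r; apply: eq_bigr => i _; rewrite lift0.
rewrite log1pcE ?leq_subr // /log1p coef_sum (bigD1 i) //= coefZ coefXn eqxx mulr1.
rewrite big1 ?addr0 // => l li; rewrite coefZ coefXn eqSS.
by case: eqP => [e|_]; rewrite ?mulr0 //; case/eqP: li; exact/val_inj.
Qed.

(** The coefficient of (x0 / x2)^q (log x1)^k1 (log x2)^k2 in the j-th power
    of log x2 + log (1 + x0 / x2) - log x1, by the multinomial theorem. *)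
Definition logratio_pow (j q k1 k2 : nat) : C :=
  if (k1 + k2 <= j)%N then
    j`!%:R * (-1) ^+ k1 / (k1`!%:R * k2`!%:R * (j - (k1 + k2))`!%:R) * log1pc R (j - (k1 + k2)) q
  else 0.

(** Writing j + 1 = k1 + k2 + r, the three terms are the fractions k2, k1 and
    r over j + 1 of the left-hand side. *)
Lemma logratio_powS j q k1 k2 : logratio_pow j.+1 q k1 k2 =
  (if k2 is k.+1 then logratio_pow j q k1 k else 0) - (if k1 is k.+1 then logratio_pow j q k k2 else 0) +
  \sum_(i < q) ((-1) ^+ i / i.+1%:R) * logratio_pow j (q - i.+1) k1 k2.
Proof.
have fn (n : nat) : (n`!%:R : C) != 0 by rewrite pnatr_eq0 -lt0n fact_gt0.
have [kj|kj] := leqP (k1 + k2) j.+1; last first.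
  rewrite /logratio_pow leqNgt kj /= big1 ?addr0; last first.
    by move=> i _; rewrite leqNgt (ltn_trans _ kj) //= mulr0.
  rewrite (_ : (if k2 is _.+1 then _ else 0) = 0) ?sub0r; last first.
    by case: k2 kj => // k kj; rewrite leqNgt; have -> : (j < k1 + k)%N by lia.
  rewrite (_ : (if k1 is _.+1 then _ else 0) = 0) ?oppr0 //.
  by case: k1 kj => // k kj; rewrite leqNgt; have -> : (j < k + k2)%N by lia.
have [r rE] : exists r, (j.+1 = k1 + k2 + r)%N by exists (j.+1 - (k1 + k2))%N; lia.
pose X : C := (-1) ^+ k1 / (k1`!%:R * k2`!%:R * r`!%:R) * log1pc R r q.
have -> : logratio_pow j.+1 q k1 k2 = j.+1%:R * (j`!%:R * X).
  have jr : (j.+1 - (k1 + k2) = r)%N by lia.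
  rewrite /logratio_pow kj jr factS natrM /X; ring.
have -> : (if k2 is k.+1 then logratio_pow j q k1 k else 0) = k2%:R * (j`!%:R * X).
  case: k2 kj rE @X => [|k] kj rE X; first by rewrite mul0r.
  rewrite /logratio_pow; have -> : (k1 + k <= j)%N by lia.
  have -> : (j - (k1 + k) = r)%N by lia.
  rewrite /X factS natrM; field.
  by rewrite !fn nat1r pnatr_eq0.
have -> : (if k1 is k.+1 then logratio_pow j q k k2 else 0) = - (k1%:R * (j`!%:R * X)).
  case: k1 kj rE @X => [|k] kj rE X; first by rewrite mul0r oppr0.
  rewrite /logratio_pow; have -> : (k + k2 <= j)%N by lia.
  have -> : (j - (k + k2) = r)%N by lia.
  rewrite /X factS natrM exprS; field.
  by rewrite !fn nat1r pnatr_eq0.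
have -> : \sum_(i < q) (-1) ^+ i / i.+1%:R * logratio_pow j (q - i.+1) k1 k2 = r%:R * (j`!%:R * X).
  case: r rE @X => [|r] rE X.
    rewrite mul0r big1 // => i _; rewrite /logratio_pow leqNgt; have -> : (j < k1 + k2)%N by lia.
    by rewrite mulr0.
  have jr : (j - (k1 + k2) = r)%N by lia.
  have kj' : (k1 + k2 <= j)%N by lia.
  transitivity (j`!%:R * (-1) ^+ k1 / (k1`!%:R * k2`!%:R * r`!%:R) * log1pc R r.+1 q : C).
    rewrite log1pcS mulr_sumr; apply: eq_bigr => i _; rewrite /logratio_pow kj' jr; ring.
  rewrite /X factS natrM; field.
  by rewrite !fn nat1r pnatr_eq0.
rewrite opprK -!mulrDl; congr (_ * _).
by rewrite rE !natrD; ring.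
Qed.

Lemma log1pc0 q : log1pc R 0 q = (q == 0%N)%:R.
Proof. by rewrite /log1pc expr0 coef1. Qed.

Lemma fpow_in j q k1 k2 : fpow logratio j (q%:R, 0, - q%:R, k1, k2) = logratio_pow j q k1 k2.
Proof.
elim: j q k1 k2 => [|j IH] q k1 k2.
  rewrite /fpow /= /fmono /logratio_pow leqn0 addn_eq0.
  have -> : ((q%:R, 0, - q%:R, k1, k2) == 0 :> mono R) = [&& q == 0%N, k1 == 0%N & k2 == 0%N].
    rewrite -[0 : mono R]/(0, 0, 0, 0%N, 0%N) !xpair_eqE oppr_eq0 pnatr_eq0 eqxx.
    by case: (q == _); case: (k1 == _); case: (k2 == _).
  case: k1 => [|k1]; case: k2 => [|k2]; rewrite /= ?andbF //.
  by rewrite andbT log1pc0 fact0 expr0 !mul1r invr1 mul1r.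
rewrite /fpow iterS -/(fpow _ _).
pose es : seq (mono R) := [:: (0, 0, 0, 0%N, 1%N), (0, 0, 0, 1%N, 0%N)
   & [seq (i.+1%:R, 0, - i.+1%:R, 0%N, 0%N) | i <- iota 0 q]].
rewrite /fmulC (@fmulE _ _ _ _ es).
- rewrite big_mkcond /es !big_cons big_map logratio_powS /mle /msub /= addrA; congr (_ + _ + _).
  + rewrite logratio_logs // !subr0 !subn0; case: k2 => [|k2] //=.
    by rewrite scale1r subn1 IH.
  + rewrite logratio_logs // !subr0 !subn0; case: k1 => [|k1] /=; first by rewrite oppr0.
    by rewrite sub0r scaleN1r subn1 IH.
  + rewrite (_ : iota 0 q = index_iota 0 q); last by rewrite /index_iota subn0.
    rewrite big_mkord.
    apply: eq_bigr => i _; rewrite logratio_in !subr0 !subn0 -IH natrB //; congr (_ * fpow _ _ _).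
    by rewrite opprD.
- rewrite /es /= !inE /= map_inj_uniq ?iota_uniq ?andbT.
    apply/andP; split; [apply/norP; split => //; first by rewrite !xpair_eqE !andbF|];
      by apply/mapP => -[i _ [/esym/eqP]]; rewrite pnatr_eq0.
  by move=> i i1 [/eqP]; rewrite eqr_nat => /eqP [].
move=> e m' em ees; have [->|Le] := eqVneq (logratio e) 0; first by rewrite scale0r.
have [hm|/fpow_out ->] := pselect (on_cone m'); last by rewrite scaler0.
have [i ei] : exists i : nat, e = (i.+1%:R, 0, - i.+1%:R, 0%N, 0%N).
  apply: contrapT => h; case/eqP: Le; apply: logratio_out => [e0|e0|i e0].
  - by move: ees; rewrite e0 mem_head.
  - by move: ees; rewrite e0 in_cons mem_head orbT.
  - by apply: h; exists i.
case/negP: ees; rewrite ei !in_cons; apply/orP; right; apply/orP; right.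
apply/mapP; exists i => //; rewrite mem_iota /= add0n.
case: m' hm em => [[[[a b] c] k] l] [q' /= [-> _ _]]; rewrite ei maddE => -[+ _ _ _ _].
by rewrite -natrD => /eqP; rewrite eqr_nat => /eqP <-; rewrite addSn ltnS leq_addr.
Qed.

End Convolution.

(** * The residue of the delta function *)

Section RightHandSide.
Variables (R : realType) (V : vsa_data R) (hV : is_vsa V).
Variables (g : {linear V -> V}) (hg : is_vsa_aut g).
Variables (W : twmod_data V) (hW : is_twmod g W).
Local Notation C := R[i].
Local Notation N := (Ng g).
Implicit Types (u v : V) (w : W) (n : int) (a e : C).

Lemma fexpN_out u m : ~ on_cone m -> fexpN g u m = 0.
Proof.
move=> hm; rewrite /fexpN fsbig1 // => j _.
by rewrite -/(@logratio R) fpow_out // mulr0 scale0r.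
Qed.

Lemma fexpN0 m : fexpN g 0 m = 0.
Proof.
by rewrite /fexpN fsbig1 // => j _; rewrite (lin0 (iter_Ng_linear hV hg j)) scaler0.
Qed.

Lemma fexpN_in u J q k1 k2 : (forall k, (J <= k)%N -> iter k N u = 0) ->
  fexpN g u (q%:R, 0, - q%:R, k1, k2) = \sum_(b < J)
    ((-1) ^+ k1 / (k1`!%:R * k2`!%:R) * (log1pc R b q / b`!%:R)) *: iter (k1 + k2 + b) N u.
Proof.
move=> hJ; rewrite /fexpN (@fsum_nat _ (k1 + k2 + J)); last first.
  by move=> j kj; rewrite hJ ?scaler0 // (leq_trans _ kj) // leq_addl.
(* an exponent j contributes only from k1 + k2 on *)
rewrite big_split_ord /= big1 ?add0r; last first.
  move=> j _; rewrite -/(@logratio R) fpow_in /logratio_pow leqNgt ltn_ord /=.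
  by rewrite mulr0 scale0r.
apply: eq_bigr => b _; rewrite -/(@logratio R) fpow_in /logratio_pow leq_addr addKn; congr (_ *: _).
have fn (n : nat) : (n`!%:R : C) != 0 by rewrite pnatr_eq0 -lt0n fact_gt0.
by field; rewrite !fn.
Qed.

(** The exponent of x1 selects one generalized eigenspace of g. *)
Lemma fpowLE u y0 a y2 k1 k2 : fpowL g u (y0, - a, y2, k1, k2) =
  fmul (fx20 a) (fmul (fx1 (- a)) (fexpN g (gcomp g u a))) (y0, - a, y2, k1, k2).
Proof.
rewrite /fpowL /fsum (@fsumT1 _ _ a) // => a' a'a.
apply: (fmul_cone (P := fun m => exists m', on_cone m' /\ m = (0, - a', 0, 0%N, 0%N) + m')).
  move=> [[[[m0 m1] m2] l1] l2] hm; rewrite fmul_x1 fexpN_out // => hc; apply: hm.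
  by eexists; split; [exact: hc | rewrite maddE !add0r addrC subrK].
move=> [[[[m0 m1] m2] l1] l2] m' he [[[[[x0 x1] x2] j1] j2] [[q /= [-> -> ->]] ->]].
rewrite !maddE => -[_ e1 _ _ _]; case/eqP: he; apply: fx20_out => i [_ e1' _ _ _].
move: e1; rewrite e1' !add0r addr0 => /oppr_inj e1.
by rewrite e1 eqxx in a'a.
Qed.

Lemma fpowL_out u y0 y1 y2 k1 k2 : fpowL g u (y0, y1, y2, k1, k2) != 0 ->
  in_strip (- y1) /\ exists p : nat, y0 = p%:R /\ y2 = - y1 - p%:R.
Proof.
rewrite -[y1]opprK fpowLE opprK => h.
have [sy|/(gcomp_strip hV hg u) e] := boolP (in_strip (- y1)); last first.
  case/eqP: h; apply: (fmul_cone (P := fun=> False)) => //.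
  by move=> [[[[m0 m1] m2] l1] l2] _; rewrite fmul_x1 e fexpN0.
split => //; apply: contrapT => hp; case/eqP: h.
apply: (fmul_cone (P := fun m => exists m', on_cone m' /\ m = (0, y1, 0, 0%N, 0%N) + m')).
  move=> [[[[m0 m1] m2] l1] l2] hm; rewrite fmul_x1 fexpN_out // => hc; apply: hm.
  by eexists; split; [exact: hc | rewrite maddE !add0r addrC subrK].
move=> [[[[m0 m1] m2] l1] l2] m' he [[[[[x0 x1] x2] j1] j2] [[q /= [-> -> ->]] ->]].
rewrite !maddE !add0r => -[e0 e1 e2 _ _]; case/eqP: he; apply: fx20_out => i [f0 f1 f2 _ _].
apply: hp; exists (i + q)%N; rewrite -e0 -e2 f0 f2 natrD; split => //; ring.
Qed.

Lemma fpowL_in u J a p k1 k2 : (forall k, (J <= k)%N -> iter k N (gcomp g u a) = 0) ->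
  fpowL g u (p%:R, - a, a - p%:R, k1, k2) = \sum_(b < J)
    ((-1) ^+ k1 / (k1`!%:R * k2`!%:R) * powlog1pc a b p) *: iter (k1 + k2 + b) N (gcomp g u a).
Proof.
move=> hJ; rewrite fpowLE.
pose es : seq (mono R) := [seq (i%:R, 0, a - i%:R, 0%N, 0%N) | i <- iota 0 p.+1].
rewrite (@fmulE _ _ _ _ _ es).
- rewrite /es big_map (_ : iota 0 p.+1 = index_iota 0 p.+1) // big_mkord.
  transitivity (\sum_(i < p.+1) \sum_(b < J) ((-1) ^+ k1 / (k1`!%:R * k2`!%:R) *
       (binC a i * log1pc R b (p - i) / b`!%:R)) *: iter (k1 + k2 + b) N (gcomp g u a)).
    apply: eq_bigr => i _; rewrite /msub /= fx20_in fmul_x1 subr0 opprK addNr !subn0.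
    rewrite -natrB -1?ltnS //.
    have -> : a - p%:R - (a - i%:R) = - (p - i)%:R by rewrite natrB -1?ltnS //; ring.
    rewrite (fexpN_in _ _ _ hJ) scaler_sumr; apply: eq_bigr => b _; rewrite scalerA; congr (_ *: _).
    ring.
  rewrite exchange_big; apply: eq_bigr => b _; rewrite -scaler_suml; congr (_ *: _).
  by rewrite /powlog1pc mulr_sumr.
- rewrite map_inj_uniq ?iota_uniq // => i j [/eqP]; rewrite eqr_nat => /eqP //.
move=> e m' em hes; have [->|he] := eqVneq (fx20 a e) 0; first by rewrite scale0r.
have [i ei] : exists i : nat, e = (i%:R, 0, a - i%:R, 0%N, 0%N).
  by apply: contrapT => h; case/eqP: he; apply: fx20_out => i ei; apply: h; exists i.
case: m' em => [[[[x0 x1] x2] j1] j2]; rewrite ei maddE fmul_x1 => -[e0 e1 e2 _ _].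
rewrite fexpN_out ?scaler0 // => -[q /= [q0 _ _]]; case/negP: hes.
apply/mapP; exists i => //; rewrite mem_iota /= add0n ltnS.
by move/eqP: e0; rewrite q0 -natrD eqr_nat => /eqP <-; rewrite leq_addr.
Qed.

Lemma fYV_out u v y0 y1 y2 k1 k2 : fYV (fpowL g u) v (y0, y1, y2, k1, k2) != 0 ->
  in_strip (- y1) /\ exists (p : nat) n, y0 = (n + p%:Z)%:~R /\ y2 = - y1 - p%:R.
Proof.
move=> h; apply: contrapT => hp; case/eqP: h.
rewrite /fYV (conv_seq (tau := fun n : int => (n%:~R, 0, 0, 0%N, 0%N) : mono R)
  (f := fun n m' => vY n (fpowL g u m') v) (js := [::])) ?big_nil //.
move=> n [[[[x0 x1] x2] j1] j2]; rewrite maddE !add0r => -[e0 e1 e2 _ _] _.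
have [->|/fpowL_out[sx [p [f0 f2]]]] := eqVneq (fpowL g u (x0, x1, x2, j1, j2)) 0.
  by rewrite (lin0 (vsa_linl hV _ _)).
case: hp; rewrite -e1; split => //; exists p, n.
by rewrite -e0 -e2 f0 f2 intrD.
Qed.

Lemma fYV_in u v a n p k1 k2 : fYV (fpowL g u) v ((n + p%:Z)%:~R, - a, a - p%:R, k1, k2) =
  vY n (fpowL g u (p%:R, - a, a - p%:R, k1, k2)) v.
Proof.
rewrite /fYV (conv_seq (tau := fun n : int => (n%:~R, 0, 0, 0%N, 0%N) : mono R)
  (f := fun n m' => vY n (fpowL g u m') v) (js := [:: n])) //.
  by rewrite big_mkcond big_seq1 /mle /msub /= intrD addrC addKr !subr0 !subn0.
move=> n' [[[[x0 x1] x2] j1] j2]; rewrite maddE !add0r inE => -[e0 e1 e2 _ _] n'n.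
have [->|/fpowL_out[_ [q [f0 f2]]]] := eqVneq (fpowL g u (x0, x1, x2, j1, j2)) 0.
  by rewrite (lin0 (vsa_linl hV _ _)).
move: f2; rewrite e1 e2 opprK => /addrI /oppr_inj /eqP; rewrite eqr_nat => /eqP pq.
move: e0; rewrite f0 -pq intrD => /addIr /eqP; rewrite eqr_int => /eqP e.
by rewrite e eqxx in n'n.
Qed.

Lemma vY_fpowL_trunc u v a : exists L : nat, forall n p k1 k2, n < - L%:Z ->
  vY n (fpowL g u (p%:R, - a, a - p%:R, k1, k2)) v = 0.
Proof.
have [J hJ] := Ng_nilp hV hg (gcomp g u a); have [L hL] := vY_Ng_trunc hV hg (gcomp g u a) v.
exists L => n p k1 k2 nL; rewrite (fpowL_in _ _ _ hJ) (lin_sum (vsa_linl hV _ _)).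
by rewrite big1 // => b _; rewrite (linZ (vsa_linl hV _ _)) hL // scaler0.
Qed.

Lemma fYW_in u v w a : exists L : nat, forall T i e k1 k2, (L <= T)%N ->
  fYW (fYV (fpowL g u) v) w (- 1 - i%:R, - a, e, k1, k2) =
  \sum_(p < T) \sum_(k < k2.+1) tY (e - a + p%:R) k
    (vY (- 1 - i%:Z - p%:Z) (fpowL g u (p%:R, - a, a - p%:R, k1, (k2 - k)%N)) v) w.
Proof.
have [L hL] := vY_fpowL_trunc u v a; exists L => T i e k1 k2 LT.
pose js := [seq (e - a + p%:R, k) | p <- iota 0 T, k <- iota 0 k2.+1].
have i0E (p : nat) : - 1 - i%:R = ((- 1 - i%:Z - p%:Z) + p%:Z)%:~R :> C.
  by rewrite subrK intrB rmorphN1.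
rewrite /fYW (conv_seq (tau := fun j : C * nat => (0, 0, j.1, 0%N, j.2) : mono R)
  (f := fun j m' => tY j.1 j.2 (fYV (fpowL g u) v m') w) (js := js)).
- rewrite /js big_mkcond big_allpairs_dep.
  rewrite (_ : iota 0 T = index_iota 0 T) ?big_mkord; last by rewrite /index_iota subn0.
  apply: eq_bigr => p _; rewrite (_ : iota 0 k2.+1 = index_iota 0 k2.+1) // big_mkord.
  apply: eq_bigr => k _; rewrite /mle /msub /= -ltnS ltn_ord !subr0 subn0 (i0E p).
  have -> : e - (e - a + p%:R) = a - p%:R by ring.
  by rewrite fYV_in.
- apply: allpairs_uniq; rewrite ?iota_uniq // => -[p k] [p' k'] _ _ [/addrI/eqP].
  by rewrite eqr_nat => /eqP -> ->.
move=> [r k] [[[[x0 x1] x2] j1] j2]; rewrite maddE /= !add0r => -[e0 e1 e2 e3 e4] rjs.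
have [->|h] := eqVneq (fYV (fpowL g u) v (x0, x1, x2, j1, j2)) 0.
  by rewrite (lin0 (tw_linl hW _ _ _)).
have [_ [p [n [f0 f2]]]] := fYV_out h.
have re : r = e - a + p%:R by rewrite -e2 f2 e1; ring.
have [pT|Tp] := ltnP p T.
  case/negP: rjs; apply/allpairsP; exists (p, k); split; rewrite ?mem_iota ?add0n ?re //.
  by rewrite leq0n ltnS -e4 leq_addr.
move: f0 f2; rewrite e0 e1 opprK (i0E p) => /eqP; rewrite eqr_int => /eqP nE -> .
by rewrite fYV_in hL ?(lin0 (tw_linl hW _ _ _)) //; lia.
Qed.

Lemma shifted_delta_in n i : fmulC (fx1 (-1)) (@fdelta R)
  (i%:R, - n%:~R - 1, n%:~R - i%:R, 0%N, 0%N) = binC n%:~R i.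
Proof. by rewrite /fmulC fmul_x1 opprK subrK fdelta_in. Qed.

Lemma shifted_delta_out m : fmulC (fx1 (-1)) (@fdelta R) m != 0 ->
  exists n i, m = (i%:R, - n%:~R - 1, n%:~R - i%:R, 0%N, 0%N).
Proof.
case: m => [[[[y0 y1] y2] k1] k2]; rewrite /fmulC fmul_x1 opprK => h.
apply: contrapT => hm; case/eqP: h; apply: fdelta_out => n i [e0 e1 e2 e3 e4]; apply: hm.
by exists n, i; rewrite e0 e2 e3 e4 -e1 addrK.
Qed.

Lemma in_strip_int_shift a (n n' : int) : in_strip a -> in_strip (a + n%:~R - n'%:~R) -> n' = n.
Proof.
rewrite /in_strip => /andP[h1 h2].
rewrite (_ : a + n%:~R - n'%:~R = a + ((n - n')%:~R : R)%:C); last first.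
  by rewrite rmorph_int intrB addrA.
rewrite complex_ReD -[complex.Re ((n - n')%:~R)%:C]/((n - n')%:~R : R) => /andP[h3 h4].
have l1 : (n - n')%:~R < 1%:~R :> R by lra.
have l2 : (- 1)%:~R < (n - n')%:~R :> R by rewrite rmorphN1; lra.
move: l1 l2; rewrite !ltr_int => l1 l2; lia.
Qed.

Lemma fYW_out u v w y0 y1 y2 k1 k2 :
  fYW (fYV (fpowL g u) v) w (y0, y1, y2, k1, k2) != 0 -> in_strip (- y1).
Proof.
move=> h; apply: contraTT h => sy; rewrite negbK; apply/eqP.
rewrite /fYW (conv_seq (tau := fun j : C * nat => (0, 0, j.1, 0%N, j.2) : mono R)
  (f := fun j m' => tY j.1 j.2 (fYV (fpowL g u) v m') w) (js := [::])) ?big_nil //.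
move=> [r k] [[[[x0 x1] x2] j1] j2]; rewrite maddE /= !add0r => -[e0 e1 e2 e3 e4] _.
have [->|/fYV_out[]] := eqVneq (fYV (fpowL g u) v (x0, x1, x2, j1, j2)) 0.
  by rewrite (lin0 (tw_linl hW _ _ _)).
by rewrite e1 (negPf sy).
Qed.

(** The powers of log x2 come from Y_W(., x2) and from the operator applied to
    u; the Leibniz rule transfers them to v. *)
Lemma collect_logs u v w a J n e p k1 k2 :
  (forall k, (J <= k)%N -> iter k N (gcomp g u a) = 0) ->
  \sum_(k < k2.+1) tY e k
    (vY n (fpowL g u (p%:R, - a, a - p%:R, k1, (k2 - k)%N)) v) w =
  ((-1) ^+ k1 / k1`!%:R * ((-1) ^+ k2 / k2`!%:R)) *: \sum_(b < J) powlog1pc a b p *: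
    tY e 0 (vY n (iter b N (iter k1 N (gcomp g u a))) (iter k2 N v)) w.
Proof.
move=> hJ; set U := gcomp g u a.
transitivity (\sum_(b < J) ((-1) ^+ k1 / k1`!%:R * powlog1pc a b p) *: tY e 0
  (\sum_(k < k2.+1) ((-1) ^+ k / (k`!%:R * (k2 - k)`!%:R)) *:
     iter k N (vY n (iter (k2 - k) N (iter (b + k1) N U)) v)) w).
  transitivity (\sum_(k < k2.+1) \sum_(b < J)
      ((-1) ^+ k1 / (k1`!%:R * (k2 - k)`!%:R) * powlog1pc a b p * ((-1) ^+ k / k`!%:R)) *:
      tY e 0 (iter k N (vY n (iter (k2 - k) N (iter (b + k1) N U)) v)) w).
    apply: eq_bigr => k _; rewrite (fpowL_in _ _ _ hJ) (lin_sum (vsa_linl hV _ _)).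
    rewrite (lin_sum (tw_linl hW _ _ _)); apply: eq_bigr => b _.
    rewrite (linZ (vsa_linl hV _ _)) (linZ (tw_linl hW _ _ _)) (tY_log hV hg hW) scalerA.
    by rewrite -iterD; congr (_ *: tY _ _ (iter _ _ (vY _ (iter _ _ _) _)) _); lia.
  rewrite exchange_big; apply: eq_bigr => b _.
  rewrite (lin_sum (tw_linl hW _ _ _)) scaler_sumr; apply: eq_bigr => k _.
  rewrite (linZ (tw_linl hW _ _ _)) scalerA; congr (_ *: _).
  have fn (i : nat) : (i`!%:R : C) != 0 by rewrite pnatr_eq0 -lt0n fact_gt0.
  by field; rewrite !fn.
rewrite scaler_sumr; apply: eq_bigr => b _.
rewrite (Ng_leibniz hV hg) (linZ (tw_linl hW _ _ _)) !scalerA -iterD; congr (_ *: _).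
by ring.
Qed.

(** The exponent of x1 determines a and n, since a lies in the strip; the
    exponents of x0 and x2 leave two free indices, which the truncation of Y_V
    bounds. *)
Lemma fres0_residue_part u v w n a e2 k1 k2 : in_strip a -> exists T0, forall T, (T0 <= T)%N ->
  fres0 (fmul (fmulC (fx1 (-1)) (@fdelta R)) (fYW (fYV (fpowL g u) v) w))
    (- 1 - n%:~R - a) e2 k1 k2 =
  ((-1) ^+ k1 / k1`!%:R * ((-1) ^+ k2 / k2`!%:R)) *:
  residue_part g n a (- 1 - n%:~R - a + e2 + 1) (iter k1 N (gcomp g u a)) (iter k2 N v) w T.
Proof.
move=> sa; have [L hL] := fYW_in u v w a; have [L' hL'] := vY_fpowL_trunc u v a.
have [J hJ] := Ng_nilp hV hg (gcomp g u a).
exists (maxn L (maxn L' J)) => T; rewrite !geq_max => /and3P[LT LT' JT].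
pose es : seq (mono R) := [seq (i%:R, - n%:~R - 1, n%:~R - i%:R, 0%N, 0%N) | i <- iota 0 T].
rewrite /fres0 (@fmulE _ _ _ _ _ es); last 2 first.
- by rewrite map_inj_uniq ?iota_uniq // => i j [/eqP]; rewrite eqr_nat => /eqP.
- move=> e m' em hes.
  have [->|/shifted_delta_out[n' [i ei]]] := eqVneq (fmulC (fx1 (-1)) (@fdelta R) e) 0.
    by rewrite scale0r.
  case: m' em => [[[[x0 x1] x2] j1] j2]; rewrite ei maddE => -[f0 f1 f2 f3 f4].
  have [->|/fYW_out] := eqVneq (fYW (fYV (fpowL g u) v) w (x0, x1, x2, j1, j2)) 0.
    by rewrite scaler0.
  have x1E : x1 = - (a + n%:~R - n'%:~R).
    by rewrite -[x1](addKr (- n'%:~R - 1)) f1; ring.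
  rewrite x1E opprK => /(in_strip_int_shift sa) n'n.
  have [iT|Ti] := ltnP i T.
    by case/negP: hes; rewrite ei n'n; apply/mapP; exists i; rewrite // mem_iota.
  have -> : x0 = - 1 - i%:R by rewrite -[x0](addKr i%:R) f0 addrC.
  rewrite n'n addrK (hL T) // big1 ?scaler0 // => p _; rewrite big1 // => k _.
  by rewrite hL' ?(lin0 (tw_linl hW _ _ _)) //; lia.
rewrite /es big_map (_ : iota 0 T = index_iota 0 T) ?big_mkord; last by rewrite /index_iota subn0.
rewrite /residue_part scaler_sumr; apply: eq_bigr => i _.
rewrite shifted_delta_in [RHS]scalerA [X in _ = X *: _]mulrC -[RHS]scalerA; congr (_ *: _).
rewrite /msub /= ?subn0.
have -> : - 1 - n%:~R - a - (- n%:~R - 1) = - a by ring.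
rewrite (hL T) // scaler_sumr; apply: eq_bigr => p _.
rewrite (collect_logs _ _ _ _ _ _ (J := T)); last by move=> k Tk; apply: hJ; exact: leq_trans Tk.
congr (_ *: _); apply: eq_bigr => b _; congr (_ *: tY _ _ _ _).
by ring.
Qed.

End RightHandSide.

Theorem corollary3p9 (R : realType) (V : vsa_data R) (hV : is_vsa V)
    (g : {linear V -> V}) (hg : is_vsa_aut g)
    (W : twmod_data V) (hW : is_twmod g W) (hB : lower_bounded W)
    (bu bv : bool) (u v : V) (hu : vparity bu u) (hv : vparity bv v)
    (w : W) (e1 e2 : R[i]) (k1 k2 : nat) :
  tY e1 k1 u (tY e2 k2 v w) - (-1) ^+ (bu && bv) *: tY e2 k2 v (tY e1 k1 u w) =
  fres0 (fmul (fmulC (fx1 (-1)) (@fdelta R)) (fYW (fYV (fpowL g u) v) w))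
    e1 e2 k1 k2.
Proof.
have [n [a [sa ->]]] := exponent_split e1.
have [T0 hT0] := commutator_formula hV hg hW hB w n e2 k1 k2 hu hv sa.
have [T1 hT1] := fres0_residue_part hV hg hW u v w n e2 k1 k2 sa.
by rewrite (hT0 (maxn T0 T1)) ?leq_maxl // -hT1 // leq_maxr.
Qed.
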